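(* Let $s \geq 1$ and let $\omega$ be a measurable subset of $\mathbb{R}$. The following two assertions are equivalent: (i) The fractional harmonic Schrödinger equation $$\left\lbrace \begin{array}{ll} \partial_t f(t,x) + i(-\Delta_x+x^2)^s f(t,x)=u(t,x)\mathbf{1}_{\omega}(x), & x \in \mathbb{R},\ t>0,\\ f|_{t=0}=f_0 \in L^2(\mathbb{R}),& \end{array}\right.$$ is exactly controllable from $\omega$ in time $T$ for some $T>0$. (ii) The set $\omega$ satisfies $$\liminf_{R \to +\infty} \frac{|\omega \cap [-R,R]|}{|[-R,R]|}>0.$$ Moreover, if one of these two conditions holds in the non-fractional case $s=1$, then the harmonic Schrödinger equation (the equation above with $s=1$) is exactly controllable from $\omega$ in any time $T \geq \pi$.
   Context: $|E|$ denotes the Lebesgue measure of a measurable set $E$, and $\mathbf{1}_\omega$ the indicator function of $\omega$. Hermite functions: $\psi_n(x)=\pi^{-1/4}2^{-n/2}(n!)^{-1/2}e^{-x^2/2}H_n(x)$, $n\ge 0$, where $H_n(x)=(-1)^n e^{x^2}\frac{d^n}{dx^n}e^{-x^2}$ is the Hermite polynomial of degree $n$; $(\psi_n)_{n\ge0}$ is a Hilbert basis of $L^2(\mathbb{R})$. The fractional harmonic oscillator $(-\Delta_x+x^2)^s$, $s>0$, is the selfadjoint operator on $L^2(\mathbb{R})$ with domain $\{f \in L^2(\mathbb{R}) : \sum_{n\ge 0}(2n+1)^{2s}|\langle f,\psi_n\rangle_{L^2(\mathbb{R})}|^2<+\infty\}$ and $(-\Delta_x+x^2)^s f=\sum_{n\ge0}(2n+1)^s\langle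 f,\psi_n\rangle_{L^2(\mathbb{R})}\psi_n$. Exact controllability: let $A$ be a selfadjoint operator on $L^2(\mathbb{R}^d)$ and $T>0$. The equation $\partial_t f+iAf=u\mathbf{1}_\omega$, $f|_{t=0}=f_0$, is exactly controllable from $\omega$ in time $T$ if for all $f_0,f_T \in L^2(\mathbb{R}^d)$ there exists $u \in L^2((0,T)\times\mathbb{R}^d)$, supported in $(0,T)\times\omega$, such that the mild solution $f(t)=e^{-itA}f_0+\int_0^t e^{-i(t-\tau)A}(\mathbf{1}_\omega u(\tau,\cdot))\,d\tau$ satisfies $f(T,\cdot)=f_T$. Here $d=1$ and $A=(-\Delta_x+x^2)^s$. *)

(* Defs.v *)
From HB Require Import structures.
From mathcomp Require Import all_boot all_order all_algebra.
From mathcomp Require Import all_classical all_reals all_analysis.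
From mathcomp Require Import measurable_realfun.
From mathcomp.real_closed Require Import complex.

Set Implicit Arguments.
Unset Strict Implicit.
Unset Printing Implicit Defensive.

Import Order.TTheory GRing.Theory Num.Theory.
Import numFieldNormedType.Exports.
Import ComplexField.Normc.

Local Open Scope classical_set_scope.
Local Open Scope ring_scope.

(** Elements of [L^2] are represented by functions; equality in [L^2] is
    equality almost everywhere. *)
Section ComplexL2.
Context (d : measure_display) (T : measurableType d) (R : realType).
Variable mu : {measure set T -> \bar R}.
Implicit Types (D : set T) (f g : T -> R[i]).

Definition cmeasurable_fun D f : Prop :=
  measurable_fun D (fun x => complex.Re (f x)) /\
  measurable_fun D (fun x => complex.Im (f x)).

Definition L2norm D f : \bar R :=
  ((\int[mu]_(x in D) ((normc (f x)) ^+ 2)%:E) `^ 2^-1)%E.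

Definition inL2 D f : Prop := cmeasurable_fun D f /\ (L2norm D f < +oo)%E.

Definition cintegral f : R[i] :=
  Complex (\int[mu]_x complex.Re (f x)) (\int[mu]_x complex.Im (f x)).

Definition inner f g : R[i] := cintegral (fun x => f x * conjc (g x)).

Definition is_L2lim (u : nat -> T -> R[i]) f : Prop :=
  inL2 setT f /\
  L2norm setT (fun x => u n x - f x) @[n --> \oo] --> 0%E.

(** The limit is the zero function when [u] does not converge. *)
Definition L2lim (u : nat -> T -> R[i]) : T -> R[i] :=
  xget (fun=> 0) [set f | is_L2lim u f].

Definition L2series (u : nat -> T -> R[i]) : T -> R[i] :=
  L2lim (fun n x => \sum_(k < n) u k x).

End ComplexL2.

(** Bochner integral of [L^2(T)]-valued functions over a subset of [X]. *)
Section Bochner.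
Context (d : measure_display) (T : measurableType d)
        (d' : measure_display) (X : measurableType d') (R : realType).
Variables (mu : {measure set T -> \bar R}) (nu : {measure set X -> \bar R}).
Implicit Types (D : set X) (F : X -> T -> R[i]).

(** The list of pairs [(E, v)] stands for the simple function
    [\sum_(E, v) \1_E v]. *)
Definition L2simple := seq (set X * (T -> R[i])).

Definition simple_integrable D (s : L2simple) : Prop :=
  forall p, p \in s ->
    [/\ measurable p.1, (nu (D `&` p.1) < +oo)%E & inL2 mu setT p.2].

Definition simple_value (s : L2simple) (t : X) : T -> R[i] :=
  fun x => \sum_(p <- s) real_complex R (\1_(p.1) t) * p.2 x.

Definition simple_integral D (s : L2simple) : T -> R[i] :=
  fun x => \sum_(p <- s) real_complex R (fine (nu (D `&` p.1))) * p.2 x.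

Definition is_bochner_integral D F (h : T -> R[i]) : Prop :=
  {ae nu, forall t, D t -> inL2 mu setT (F t)} /\
  exists s : nat -> L2simple,
    let err k : X -> \bar R :=
      fun t => L2norm mu setT (fun x => F t x - simple_value (s k) t x) in
    [/\ forall k, simple_integrable D (s k),
        forall k, measurable_fun D (err k),
        (\int[nu]_(t in D) err k t)%E @[k --> \oo] --> 0%E
      & is_L2lim mu (fun k => simple_integral D (s k)) h].

(** The zero function when [F] is not Bochner integrable. *)
Definition bochner_integral D F : T -> R[i] :=
  xget (fun=> 0) [set h | is_bochner_integral D F h].

End Bochner.

(** The real line with the Lebesgue (and not only the Borel) sigma-algebra. *)
Definition lebR (R : realType) :=
  caratheodory_type (R := R) ((wlength idfun)^*)%mu.

HB.instance Definition _ (R : realType) := Measurable.on (lebR R).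

Definition leb (R : realType) : set (lebR R) -> \bar R :=
  completed_lebesgue_measure.
Arguments leb : clear implicits.

HB.instance Definition _ (R : realType) := Measure.on (leb R).
HB.instance Definition _ (R : realType) := SigmaFiniteMeasure.on (leb R).

Definition lower_density (R : realType) (omega : set (lebR R)) : \bar R :=
  limf_einf
    (fun r : R => (leb R (omega `&` `[(- r)%R, r]%classic)
                   / leb R `[(- r)%R, r]%classic)%E)
    (pinfty_nbhs R).

Section Schroedinger.
Variable R : realType.
Implicit Types (f : lebR R -> R[i]) (t : R) (omega : set (lebR R)).

(** [e^{i theta}] *)
Definition expi (theta : R) : R[i] := Complex (cos theta) (sin theta).

(** Spectral data of an operator [A] on [L^2(R)]. When [eigfun] is a Hilbert
    basis, which is not required here, [A] is selfadjoint with domain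
    [operator_domain A] and action [operator_apply A]. *)
Record diagonal_operator := DiagonalOperator {
  eigfun : nat -> lebR R -> R[i];
  eigval : nat -> R }.

Implicit Type A : diagonal_operator.

(** [phi(A) f = \sum_n phi(lambda_n) <f, e_n> e_n], the series converging in
    [L^2]. *)
Definition fun_calculus A (phi : R -> R[i]) f : lebR R -> R[i] :=
  L2series (leb R) (fun n x =>
    phi (eigval A n) * inner (leb R) f (eigfun A n)
    * eigfun A n x).

Definition operator_domain A f : Prop :=
  inL2 (leb R) setT f /\
  (\sum_(0 <= n <oo) ((eigval A n) ^+ 2 *
     (normc (inner (leb R) f (eigfun A n))) ^+ 2)%:E < +oo)%E.

Definition operator_apply A f := fun_calculus A (fun l => real_complex R l) f.

(** [e^{-itA}] *)
Definition propagator A t f := fun_calculus A (fun l => expi (- (t * l))) f.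

Definition mild_solution A omega f (u : lebR R * lebR R -> R[i]) t :
    lebR R -> R[i] :=
  fun x => propagator A t f x +
    bochner_integral (leb R) (leb R) `]0, t[%classic
      (fun tau => propagator A (t - tau)
         (fun y => real_complex R (\1_omega y) * u (tau, y))) x.

(** [u] is supported in [(0, T) x omega] as an element of [L^2]. *)
Definition exactly_controllable A omega (T : R) : Prop :=
  forall f0 fT : lebR R -> R[i],
  inL2 (leb R) setT f0 -> inL2 (leb R) setT fT ->
  exists u : lebR R * lebR R -> R[i],
    [/\ inL2 (leb R \x leb R)%E (`]0, T[%classic `*` setT) u,
        {ae (leb R \x leb R)%E, forall p,
           p.1 \in `]0, T[ -> ~ omega p.2 -> u p = 0}
      & {ae leb R, forall x, mild_solution A omega f0 u T x = fT x}].

End Schroedinger.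

Section Hermite.
Variable R : realType.

Definition hermite_poly (n : nat) (x : R) : R :=
  (-1) ^+ n * expR (x ^+ 2) * derive1n n (fun y : R => expR (- (y ^+ 2))) x.

Definition hermite_fun (n : nat) (x : R) : R :=
  pi `^ (- 4^-1) * 2 `^ (- (n%:R / 2)) * (n`!)%:R `^ (- 2^-1)
  * expR (- (x ^+ 2 / 2)) * hermite_poly n x.

(** [(- Delta_x + x^2)^s] *)
Definition fractional_harmonic (s : R) : diagonal_operator R :=
  {| eigfun := fun n x => real_complex R (hermite_fun n x);
     eigval := fun n => (2 * n + 1)%:R `^ s |}.

End Hermite.

(* Main.v *)
(** Put [M m n = \int_omega psi_m psi_n].

    If the equation is controllable, every [l^2] sequence [a] is the coefficient
    sequence of a state reached from [0], and Cauchy-Schwarz on [omega] gives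
    [a_m ^ 2 <= B * M m m] with [B] depending on [a]; a gliding hump then forces
    [c <= M n n] for large [n]. Averaging over [n < N], the bound
    [\sum_(n < N) psi_n ^ 2 <= sqrt (2 N)] and the second moments of the [psi_n]
    turn this into positive lower density.

    Conversely, since [psi_n ^ 2 + psi_n' ^ 2 / (lam_n - x ^ 2)] increases away from
    [0], [psi_n] is small only on a small part of [|x| <= sqrt (3 / 4 lam_n)], so
    positive lower density gives [c <= M n n] for all [n]. The control is sought as
    [u(t, x) = v(t) 1_omega(x) \sum_n phi_n e^{i (T / 2 - t) lam_n} psi_n(x)]. Reaching
    the target is the system [\sum_n k(lam_m - lam_n) M m n phi_n = g_m], [k] being
    the Fourier transform of [v]. As [lam_m - lam_n] is at least [2 |m - n|], it is
    diagonally dominant for a parabolic [v] and large [T], and it is diagonal when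
    [s = 1] and [v] is the indicator of an interval of length [pi]. *)

Require Import Defs.
From HB Require Import structures.
From mathcomp Require Import all_boot all_order all_algebra.
From mathcomp Require Import all_classical all_reals all_analysis.
From mathcomp Require Import measurable_realfun.
From mathcomp Require Import ring lra.
From mathcomp.real_closed Require Import complex.
Import Order.TTheory GRing.Theory Num.Theory.
Import numFieldNormedType.Exports.
Import ComplexField.Normc.
Local Open Scope classical_set_scope.
Local Open Scope ring_scope.

Set Implicit Arguments.
Unset Strict Implicit.
Unset Printing Implicit Defensive.

(** * Real square integrable functions *)

Section RealL2.
Context d (T : measurableType d) (R : realType).
Variable mu : {measure set T -> \bar R}.
Implicit Types f g h : T -> R.

(** [L2lim] and [bochner_integral] pick a limit when one exists and return 0 otherwise, so existence
    has to be settled before anything is computed. This is done on the real and imaginary Hermite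
    coefficients, where the propagator acts by plane rotations and a Bochner integral becomes an
    ordinary one. The control also has to be jointly measurable in time and space. The L^2 limits
    that define it are therefore explicit upper limits along a subsequence common to all times. The
    factor e^{i T lam_n / 2} recentres time at T / 2, about which v is even. Hence k is real, and
    one real matrix serves both the real and the imaginary system. A parabola vanishing at both ends
    of (0, 2 a) has k(0) of order a^3 and k(delta) of order at most a / delta^2. The sum of (m -
    n)^-2 is bounded, so for a large the diagonal, at least c k(0), dominates. For s = 1 the gaps
    are exactly 2 (m - n), and an interval of length pi holds whole periods of the cosines. *)

Definition sqint f := measurable_fun setT f /\
  mu.-integrable setT (EFin \o (fun x => f x ^+ 2)).

Definition ip f g : R := \int[mu]_x (f x * g x).

Lemma sqintP f : measurable_fun setT f ->
  (\int[mu]_x ((f x) ^+ 2)%:E < +oo)%E -> sqint f.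
Proof.
move=> mf foo; split => //; apply/integrableP; split.
  by apply/measurable_EFinP; exact: measurable_funX.
rewrite (eq_integral (fun x => ((f x) ^+ 2)%:E))// => x _.
by rewrite gee0_abs// lee_fin sqr_ge0.
Qed.

Lemma sqint_mul f g : sqint f -> sqint g ->
  mu.-integrable setT (EFin \o (fun x => f x * g x)).
Proof.
move=> [mf f2] [mg g2].
apply: (@le_integrable _ _ _ mu setT measurableT _
  ((EFin \o (fun x => f x ^+ 2)) \+ (EFin \o (fun x => g x ^+ 2)))).
- by apply/measurable_EFinP; exact: measurable_funM.
- move=> x _ /=; rewrite lee_fin.
  rewrite [leRHS]ger0_norm ?addr_ge0 ?sqr_ge0// ler_norml.
  have := sqr_ge0 (f x + g x); have := sqr_ge0 (f x - g x).
  by move=> *; apply/andP; split; nra.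
- exact: integrableD.
Qed.

Lemma sqint_measurable f : sqint f -> measurable_fun setT f.
Proof. by case. Qed.

Hint Resolve sqint_measurable : core.

Lemma sqintZ c f : sqint f -> sqint (fun x => c * f x).
Proof.
move=> [mf f2]; split; first exact: measurable_funM.
have := integrableZl measurableT (c ^+ 2) f2.
by apply: eq_integrable => // x _ /=; rewrite -EFinM exprMn.
Qed.

Lemma sqintD f g : sqint f -> sqint g -> sqint (fun x => f x + g x).
Proof.
move=> sf sg; split; first by apply: measurable_funD; exact: sqint_measurable.
have := integrableD measurableT (integrableD measurableT sf.2 sg.2)
  (integrableZl measurableT 2 (sqint_mul sf sg)).
by apply: eq_integrable => // x _ /=; rewrite -EFinM -!EFinD; congr EFin; ring.
Qed.

Lemma sqintN f : sqint f -> sqint (fun x => - f x).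
Proof.
by move=> /(sqintZ (-1)); under eq_fun do rewrite mulN1r.
Qed.

Lemma sqintB f g : sqint f -> sqint g -> sqint (fun x => f x - g x).
Proof. by move=> sf sg; apply: sqintD => //; exact: sqintN. Qed.

Lemma sqint0 : sqint (fun=> 0).
Proof.
split => //; apply: (eq_integrable _ (cst 0%E)) => //; last exact: integrable0.
by move=> x _ /=; rewrite expr0n.
Qed.

Lemma sqint_sum (n : nat) (F : nat -> T -> R) : (forall k, sqint (F k)) ->
  sqint (fun x => \sum_(k < n) F k x).
Proof.
move=> sF; elim: n => [|n IH].
  by under eq_fun do rewrite big_ord0; exact: sqint0.
by under eq_fun do rewrite big_ord_recr/=; exact: sqintD.
Qed.

Lemma le_sqint f g : measurable_fun setT f -> sqint g ->
  (forall x, f x ^+ 2 <= g x ^+ 2) -> sqint f.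
Proof.
move=> mf [mg g2] fg; split => //.
apply: (le_integrable _ _ _ g2) => //.
  by apply/measurable_EFinP; exact: measurable_funX.
by move=> x _ /=; rewrite lee_fin !ger0_norm ?sqr_ge0.
Qed.

Lemma ipC f g : ip f g = ip g f.
Proof. by rewrite /ip; apply: eq_Rintegral => x _; rewrite mulrC. Qed.

Lemma ipE f : ip f f = \int[mu]_x (f x ^+ 2).
Proof. by apply: eq_Rintegral => x _; rewrite expr2. Qed.

Lemma ipDl f g h : sqint f -> sqint g -> sqint h ->
  ip (fun x => f x + g x) h = ip f h + ip g h.
Proof.
move=> sf sg sh; rewrite /ip -RintegralD//; try exact: sqint_mul.
by apply: eq_Rintegral => x _; rewrite mulrDl.
Qed.

Lemma ipZl c f h : sqint f -> sqint h ->
  ip (fun x => c * f x) h = c * ip f h.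
Proof.
move=> sf sh; rewrite /ip -RintegralZl//; try exact: sqint_mul.
by apply: eq_Rintegral => x _; rewrite mulrA.
Qed.

Lemma ipBl f g h : sqint f -> sqint g -> sqint h ->
  ip (fun x => f x - g x) h = ip f h - ip g h.
Proof.
move=> sf sg sh; rewrite /ip -RintegralB//; try exact: sqint_mul.
by apply: eq_Rintegral => x _; rewrite mulrBl.
Qed.

Lemma ip0l h : ip (fun=> 0) h = 0.
Proof.
rewrite /ip (_ : (fun x => _) = cst 0) ?Rintegral_cst ?mul0r//.
by apply/funext => x; rewrite mul0r.
Qed.

Lemma ip_suml (n : nat) (F : nat -> T -> R) h :
  (forall k, sqint (F k)) -> sqint h ->
  ip (fun x => \sum_(k < n) F k x) h = \sum_(k < n) ip (F k) h.
Proof.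
move=> sF sh; elim: n => [|n IH].
  by rewrite big_ord0; under eq_fun do rewrite big_ord0; rewrite ip0l.
rewrite big_ord_recr/= -IH -ipDl//; last exact: sqint_sum.
by under eq_fun do rewrite big_ord_recr.
Qed.

Lemma ip_ge0 f : 0 <= ip f f.
Proof. by rewrite ipE; apply: Rintegral_ge0 => x _; exact: sqr_ge0. Qed.

Lemma ip_EFin f : sqint f -> (\int[mu]_x (f x ^+ 2)%:E = (ip f f)%:E)%E.
Proof. by move=> [_ f2]; rewrite ipE fineK//; exact: integrable_fin_num. Qed.

Lemma ipBB f g : sqint f -> sqint g ->
  ip (fun x => f x - g x) (fun x => f x - g x) = ip f f - 2 * ip f g + ip g g.
Proof.
move=> sf sg; have sfg := sqintB sf sg.
rewrite ipBl// ![ip _ (fun x => _ - _)]ipC !ipBl// [ip g f]ipC; ring.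
Qed.

Lemma ip_CS f g : sqint f -> sqint g -> ip f g ^+ 2 <= ip f f * ip g g.
Proof.
move=> sf sg.
have H c : 0 <= ip f f - 2 * (c * ip f g) + c ^+ 2 * ip g g.
  have := ip_ge0 (fun x => f x - c * g x); have sc := sqintZ c sg.
  by rewrite ipBB// (ipC f (fun x => c * g x)) !ipZl//
    (ipC g (fun x => c * g x)) ipZl// (ipC g f) (mulrA c) -expr2.
have := ip_ge0 g; rewrite le_eqVlt => /orP[/eqP g0|g0].
  rewrite -g0 mulr0.
  have [->|fg0] := eqVneq (ip f g) 0; first by rewrite expr0n.
  (* With [ip g g = 0] the quadratic in c is affine, and this c gives it the value -1. *)
  have := H ((ip f f + 1) / (2 * ip f g)).
  rewrite -g0 mulr0 addr0 (_ : 2 * _ = ip f f + 1); last by field.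
  lra.
have := mulr_ge0 (H (ip f g / ip g g)) (ltW g0).
have -> : (ip f f - 2 * (ip f g / ip g g * ip f g)
    + (ip f g / ip g g) ^+ 2 * ip g g) * ip g g
  = ip f f * ip g g - ip f g ^+ 2 by field; exact: lt0r_neq0.
by rewrite subr_ge0.
Qed.

Lemma ip_eq0_ae f : sqint f -> ip f f = 0 -> {ae mu, forall x, f x = 0}.
Proof.
move=> sf f0.
have : (\int[mu]_x `|(f x ^+ 2)%:E| = 0)%E.
  rewrite (eq_integral (fun x => ((f x) ^+ 2)%:E)); first by rewrite ip_EFin// f0.
  by move=> x _; rewrite gee0_abs// lee_fin sqr_ge0.
have mf : measurable_fun setT (fun x => (f x ^+ 2)%:E).
  by apply/measurable_EFinP; apply: measurable_funX; exact: sqint_measurable.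
move=> /(ae_eq_integral_abs mu measurableT mf); apply: filterS => x /= /(_ I) [] /eqP.
by rewrite sqrf_eq0 => /eqP.
Qed.

Lemma ae_eq_ip f g h k : sqint f -> sqint g -> sqint h -> sqint k ->
  {ae mu, forall x, f x = h x} -> {ae mu, forall x, g x = k x} ->
  ip f g = ip h k.
Proof.
move=> sf sg sh sk fh gk; rewrite /ip /Rintegral; congr fine.
apply: ae_eq_integral => //.
- exact: (measurable_int _ (sqint_mul sf sg)).
- exact: (measurable_int _ (sqint_mul sh sk)).
by apply: filterS2 fh gk => x -> -> _.
Qed.

(* Cauchy-Schwarz with the weights [2 ^ j]. *)
Lemma telescope_sqr_le (u : nat -> R) J n :
  (u (J + n)%N - u J) ^+ 2 <=
  2 / 2 ^+ J * \sum_(J <= j < J + n) 2 ^+ j * (u j.+1 - u j) ^+ 2.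
Proof.
elim: n J => [|n IH] J.
  by rewrite addn0 subrr expr0n big_geq// mulr0.
rewrite big_ltn; last by rewrite -addSnnS leq_addr.
have := IH J.+1; rewrite addSnnS => H.
set S := \sum_(J.+1 <= j < J + n.+1) _ in H *.
have p0 : 0 < 2 ^+ J :> R by rewrite exprn_gt0.
have -> : 2 / 2 ^+ J * (2 ^+ J * (u J.+1 - u J) ^+ 2 + S) =
  2 * (u J.+1 - u J) ^+ 2 + 2 * (2 / 2 ^+ J.+1 * S).
  by rewrite (exprS 2 J); field; exact: lt0r_neq0.
have := sqr_ge0 ((u (J + n.+1)%N - u J.+1) - (u J.+1 - u J)).
nra.
Qed.

Lemma cvg0_ge (u : nat -> R) (y : R) : u @ \oo --> (0 : R) ->
  (\forall n \near \oo, y <= u n) -> y <= 0.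
Proof.
move=> u0 yu; rewrite -(cvg_lim _ u0)//; apply: limr_ge => //.
by apply/cvg_ex; exists 0.
Qed.

(* As an everywhere defined limit, it makes [L^2] limits jointly measurable in
   parameters. *)
Definition flimsup (h : nat -> T -> R) (x : T) : R :=
  fine (limn_esup (fun j => (h j x)%:E)).

Lemma measurable_flimsup (h : nat -> T -> R) :
  (forall j, measurable_fun setT (h j)) -> measurable_fun setT (flimsup h).
Proof.
move=> mh; apply: measurableT_comp => //.
by apply: measurable_fun_limn_esup => j; exact/measurable_EFinP.
Qed.

(** By [telescope_sqr_le] the bounded weighted sum makes the sequence Cauchy at x. The upper limit
    is then a true limit, and the telescoped bound passes to it. *)
Lemma flimsup_bound (h : nat -> T -> R) x (C : R) :
  (forall N, \sum_(0 <= j < N) 2 ^+ j * (h j.+1 x - h j x) ^+ 2 <= C) ->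
  forall J, (flimsup h x - h J x) ^+ 2 <= 2 / 2 ^+ J * C.
Proof.
move=> hC.
have p0 J : 0 < 2 ^+ J :> R by rewrite exprn_gt0.
have b J n : (h (J + n)%N x - h J x) ^+ 2 <= 2 / 2 ^+ J * C.
  apply: le_trans (telescope_sqr_le (fun j => h j x) J n) _.
  rewrite ler_pM2l ?divr_gt0//.
  apply: le_trans (hC (J + n)%N).
  rewrite [leRHS](@big_cat_nat _ _ _ J)//= ?leq_addr// lerDr.
  by apply: sumr_ge0 => j _; apply: mulr_ge0; [exact: exprn_ge0|exact: sqr_ge0].
have C0 : 0 <= C by have := hC 0%N; rewrite big_geq.
have cv : cvgn (fun j => h j x).
  apply/cauchy_cvgP/cauchy_ballP => e e0.
  have [J HJ] : exists J, 2 / 2 ^+ J * C < (e / 2) ^+ 2.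
    have e4 : 0 < (e / 2) ^+ 2 by rewrite exprn_gt0// divr_gt0.
    have : (fun J => 2 * C * (2^-1) ^+ J) @ \oo --> 2 * C * (0 : R).
      by apply: cvgMr; apply: cvg_expr; rewrite ger0_norm ?invr_ge0// invf_lt1// ltr1n.
    rewrite mulr0 => /cvgrPdist_lt /(_ _ e4) [J _ /(_ J (leqnn J))] /=.
    rewrite sub0r normrN => HJ; exists J; apply: le_lt_trans HJ.
    by rewrite (le_trans _ (ler_norm _))// exprVn mulrAC.
  have near2 n : (J <= n)%N -> `|h n x - h J x| < e / 2.
    move=> Jn; rewrite -(@ltr_pXn2r _ 2) ?nnegrE// ?divr_ge0 ?(ltW e0)//.
    rewrite real_normK ?num_real// -(subnKC Jn); exact: le_lt_trans (b _ _) HJ.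
  pose A := [set y : R | `|y - h J x| < e / 2].
  exists (A, A) => /=; first by split; exists J.
  move=> [y z] /= [Ay Az]; rewrite /ball/=.
  rewrite -(subrKA (h J x)) (splitr e) (le_lt_trans (ler_normD _ _))// ltrD//.
  by rewrite distrC.
move: cv => /cvg_ex[l hl].
have -> : flimsup h x = l.
  have hE : (fun j => (h j x)%:E) @ \oo --> l%:E.
    by apply: cvg_EFin => //; exact: nearW.
  by rewrite /flimsup; have [_ ->] := cvg_limn_einf_sup hE.
move=> J.
have hJ : (fun n => (h (n + J)%N x - h J x) ^+ 2) @ \oo --> (l - h J x) ^+ 2.
  have : (fun n => h (n + J)%N x - h J x) @ \oo --> l - h J x.
    by apply: cvgB; [move: hl; rewrite -(cvg_shiftn J)|exact: cvg_cst].
  by move=> cc; under eq_fun do rewrite expr2; rewrite expr2; exact: cvgM.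
rewrite -(cvg_lim _ hJ)//; apply: limr_le; first by apply/cvg_ex; eexists; exact: hJ.
by apply: nearW => n; rewrite addnC.
Qed.

Section RieszFischer.
Variable h : nat -> T -> R.
Hypothesis sh : forall j, sqint (h j).
Hypothesis dh : forall j,
  ip (fun x => h j.+1 x - h j x) (fun x => h j.+1 x - h j x) <= 4^-1 ^+ j.

(** The weights 2^j grow more slowly than the decay 4^-j in [dh], so this sum has a finite
    integral. *)
Let S x := (\sum_(0 <= j <oo) (2 ^+ j * (h j.+1 x - h j x) ^+ 2)%:E)%E.

Let term_ge0 j x : 0 <= 2 ^+ j * (h j.+1 x - h j x) ^+ 2 :> R.
Proof. by apply: mulr_ge0; [exact: exprn_ge0|exact: sqr_ge0]. Qed.

Let mterm j : measurable_fun setT (fun x => (2 ^+ j * (h j.+1 x - h j x) ^+ 2)%:E).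
Proof.
apply/measurable_EFinP/measurable_funM => //; apply: measurable_funX.
by apply: measurable_funB; exact: sqint_measurable.
Qed.

Let mS : measurable_fun setT S.
Proof.
apply: (@ge0_emeasurable_sum _ _ _ _ (fun j x => (2 ^+ j * (h j.+1 x - h j x) ^+ 2)%:E) predT).
  by move=> k x _ _; rewrite lee_fin; exact: term_ge0.
by move=> k _; exact: mterm.
Qed.

Let intS : (\int[mu]_x S x <= 2%:E)%E.
Proof.
rewrite integral_nneseries//; last by move=> n x _; rewrite lee_fin.
have e j : (\int[mu]_x (2 ^+ j * (h j.+1 x - h j x) ^+ 2)%:E <= (2^-1 ^+ j)%:E)%E.
  under eq_integral do rewrite EFinM.
  have sd := sqintB (sh j.+1) (sh j).
  rewrite ge0_integralZl//; last first.
  - by move=> x _; rewrite lee_fin sqr_ge0.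
  - by apply/measurable_EFinP; apply: measurable_funX; exact: sqint_measurable.
  rewrite ip_EFin// -EFinM lee_fin.
  have -> : 2^-1 ^+ j = 2 ^+ j * 4^-1 ^+ j :> R.
    by rewrite -exprMn; congr (_ ^+ _); field.
  by rewrite ler_pM2l ?exprn_gt0.
apply: (@le_trans _ _ (\sum_(0 <= j <oo) (2^-1 ^+ j)%:E)%E).
  apply: lee_nneseries => j _ //.
  by move=> _; apply: integral_ge0 => x _; rewrite lee_fin.
apply: lime_le; first by apply: is_cvg_nneseries => n _ _; rewrite lee_fin exprn_ge0 ?invr_ge0.
apply: nearW => n; rewrite sumEFin lee_fin.
rewrite big_mkord; elim: n => [|n]; first by rewrite big_ord0.
suff : \sum_(i < n) 2^-1 ^+ i + 2 * 2^-1 ^+ n = 2 :> R.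
  move=> H _; rewrite big_ord_recr/=.
  have : 0 <= 2^-1 ^+ n :> R by rewrite exprn_ge0// invr_ge0.
  by lra.
elim: n => [|n]; first by rewrite big_ord0 expr0; ring.
by rewrite big_ord_recr/= exprS => IH; rewrite -[RHS]IH; field.
Qed.

Let ge0S x : (0 <= S x)%E.
Proof. by apply: nneseries_ge0 => j _ _; rewrite lee_fin. Qed.

(** Where [S x] is infinite the right-hand side is +oo. The bound thus holds at every x, including
    those where [h j x] diverges. *)
Let bound x J :
  (((flimsup h x - h J x) ^+ 2)%:E <= (2 / 2 ^+ J)%:E * S x)%E.
Proof.
have p0 : 0 < 2 / 2 ^+ J :> R by rewrite divr_gt0// exprn_gt0.
have [Sfin|] := boolP (S x \is a fin_num); last first.
  rewrite ge0_fin_numE// -leNgt leye_eq => /eqP ->.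
  by rewrite gt0_muley ?lte_fin ?leey.
rewrite -(fineK Sfin) -EFinM lee_fin; apply: flimsup_bound => N.
rewrite -lee_fin (fineK Sfin) -sumEFin.
by apply: nneseries_lim_ge => k _ _; rewrite lee_fin.
Qed.

Let intB J : (\int[mu]_x ((flimsup h x - h J x) ^+ 2)%:E <= (4 / 2 ^+ J)%:E)%E.
Proof.
have p0 : 0 < 2 / 2 ^+ J :> R by rewrite divr_gt0// exprn_gt0.
have mh j : measurable_fun setT (h j) by exact: sqint_measurable.
apply: (@le_trans _ _ (\int[mu]_x ((2 / 2 ^+ J)%:E * S x))%E).
  apply: ge0_le_integral => //.
  - by move=> x _; rewrite lee_fin sqr_ge0.
  - apply/measurable_EFinP/measurable_funX/measurable_funB => //.
    exact: measurable_flimsup.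
  - exact: measurable_funeM.
rewrite ge0_integralZl// ?lee_fin ?(ltW p0)//.
have -> : 4 / 2 ^+ J = 2 / 2 ^+ J * 2 :> R by ring.
by rewrite [leRHS]EFinM lee_pmul2l.
Qed.

Lemma sqint_flimsup : sqint (flimsup h).
Proof.
have mh j : measurable_fun setT (h j) by exact: sqint_measurable.
have mf : measurable_fun setT (flimsup h) by exact: measurable_flimsup.
have -> : flimsup h = fun x => (flimsup h x - h 0%N x) + h 0%N x.
  by apply/funext => x; rewrite subrK.
apply: sqintD => //; apply: sqintP; first exact: measurable_funB.
by apply: le_lt_trans (intB 0) _; rewrite ltry.
Qed.

Lemma ip_flimsup J :
  ip (fun x => flimsup h x - h J x) (fun x => flimsup h x - h J x) <= 4 / 2 ^+ J.
Proof.
have sf := sqintB sqint_flimsup (sh J).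
by rewrite -lee_fin -ip_EFin//; exact: intB.
Qed.

End RieszFischer.

(** These indices provide the geometric increments required by [dh]. They depend on b alone: when b
    dominates coefficients uniformly in time, one choice serves all times. *)
Lemma tail_subseq (b : nat -> R) : (forall k, 0 <= b k) ->
  (exists B, forall N, \sum_(k < N) b k <= B) ->
  exists n_ : nat -> nat, [/\ forall j, (j <= n_ j)%N,
    forall j, (n_ j <= n_ j.+1)%N &
    forall j N, \sum_(n_ j <= k < N) b k <= 4^-1 ^+ j].
Proof.
move=> b0 [B hB].
pose S := sup (range (fun N => \sum_(k < N) b k)).
have hS : has_sup (range (fun N => \sum_(k < N) b k)).
  by split; [exists (\sum_(k < 0) b k); exists 0%N|exists B => _ [N _ <-]].
have p4 j : 0 < 4^-1 ^+ j :> R by rewrite exprn_gt0.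
have : forall j, exists N, S - 4^-1 ^+ j < \sum_(k < N) b k.
  by move=> j; have [_ [N _ <-] H] := sup_adherent (p4 j) hS; exists N.
move=> /choice[f hf].
(* The index [f j] brings the partial sum within 4^-j of the supremum. Summing the [f i + 1]
   dominates [f j] and forces monotonicity and growth. *)
exists (fun j => \sum_(i < j.+1) (f i + 1))%N; split.
- move=> j; rewrite big_split/= sum1_card card_ord.
  by rewrite (leq_trans (leqnSn j))// leq_addl.
- by move=> j; rewrite [leqRHS]big_ord_recr/= leq_addr.
move=> j N; set m := (\sum_(i < _) _)%N.
have fm : (f j <= m)%N by rewrite /m big_ord_recr/= addnCA leq_addr.
have [Nm|mN] := leqP N m; first by rewrite big_geq// ltW.
have H : \sum_(k < N) b k <= S by apply: sup_upper_bound => //; exists N.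
have mono : \sum_(k < f j) b k <= \sum_(k < m) b k.
  rewrite -2!(big_mkord xpredT) [leRHS](@big_cat_nat _ _ _ (f j))//= lerDl.
  exact: sumr_ge0.
have E : \sum_(k < N) b k = \sum_(k < m) b k + \sum_(m <= k < N) b k.
  by rewrite -2!(big_mkord xpredT) (@big_cat_nat _ _ _ m)//= ltnW.
have := hf j; lra.
Qed.

Section Orthonormal.
Variable e : nat -> T -> R.
Hypothesis se : forall n, sqint (e n).
Hypothesis oe : forall m n, ip (e m) (e n) = (m == n)%:R.
Implicit Types a : nat -> R.

Definition psum a N x := \sum_(k < N) a k * e k x.

Lemma sqint_psum a N : sqint (psum a N).
Proof. by apply: (@sqint_sum _ (fun k x => a k * e k x)) => k; exact: sqintZ. Qed.

Lemma ip_psuml a N g : sqint g ->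
  ip (psum a N) g = \sum_(k < N) a k * ip (e k) g.
Proof.
move=> sg; rewrite (@ip_suml _ (fun k x => a k * e k x))//; last first.
  by move=> k; exact: sqintZ.
by apply: eq_bigr => k _; rewrite ipZl.
Qed.

Lemma ip_psum_e a N m : ip (psum a N) (e m) = if (m < N)%N then a m else 0.
Proof.
rewrite ip_psuml//; case: ltnP => mN.
  rewrite (bigD1 (Ordinal mN))//= oe eqxx mulr1 big1 ?addr0// => k km.
  by rewrite oe (_ : (k : nat) == m = false) ?mulr0//; apply: negbTE.
rewrite big1// => k _; rewrite oe (_ : (k : nat) == m = false) ?mulr0//.
by apply/negbTE; rewrite neq_ltn (leq_trans (ltn_ord k)).
Qed.

Lemma ip_psum2 a N : ip (psum a N) (psum a N) = \sum_(k < N) a k ^+ 2.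
Proof.
rewrite ip_psuml; last exact: sqint_psum.
by apply: eq_bigr => k _; rewrite ipC ip_psum_e ltn_ord expr2.
Qed.

Lemma ip_sub_psum f N (c := fun k => ip f (e k)) : sqint f ->
  ip (fun x => f x - psum c N x) (fun x => f x - psum c N x) =
  ip f f - \sum_(k < N) c k ^+ 2.
Proof.
move=> sf; have sp := sqint_psum c N.
rewrite ipBB// ip_psum2 ipC ip_psuml//.
have -> : \sum_(k < N) c k * ip (e k) f = \sum_(k < N) c k ^+ 2.
  by apply: eq_bigr => k _; rewrite ipC expr2.
by ring.
Qed.

Lemma bessel f N : sqint f -> \sum_(k < N) ip f (e k) ^+ 2 <= ip f f.
Proof. by move=> sf; rewrite -subr_ge0 -ip_sub_psum// ip_ge0. Qed.

Lemma bessel1 f m : sqint f -> ip f (e m) ^+ 2 <= ip f f.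
Proof.
move=> sf; apply: le_trans (bessel m.+1 sf).
by rewrite big_ord_recr/= lerDr sumr_ge0// => k _; exact: sqr_ge0.
Qed.

Lemma psum_subE a M N x : (M <= N)%N ->
  psum a N x - psum a M x = psum (fun k => if (M <= k)%N then a k else 0) N x.
Proof.
move=> MN; rewrite /psum -!(big_mkord xpredT (fun k => a k * e k x)).
rewrite -(big_mkord xpredT (fun k => (if (M <= k)%N then a k else 0) * e k x)).
rewrite (@big_cat_nat _ _ _ M)//= addrAC subrr add0r.
rewrite [RHS](@big_cat_nat _ _ _ M)//= [X in _ = X + _]big1_seq ?add0r.
  rewrite !big_nat; apply: eq_bigr => k /andP[-> _] //.
by move=> k /=; rewrite mem_index_iota => /andP[_ kM]; rewrite leqNgt kM mul0r.
Qed.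

Lemma ip_psumB a M N : (M <= N)%N ->
  ip (fun x => psum a N x - psum a M x) (fun x => psum a N x - psum a M x) =
  \sum_(M <= k < N) a k ^+ 2.
Proof.
move=> MN; under eq_fun do rewrite psum_subE//.
rewrite ip_psum2 -(big_mkord xpredT (fun k => (if (M <= k)%N then a k else 0) ^+ 2)).
rewrite (@big_cat_nat _ _ _ M)//= [X in X + _]big1_seq ?add0r.
  by rewrite !big_nat; apply: eq_bigr => k /andP[-> _].
by move=> k /=; rewrite mem_index_iota => /andP[_ kM]; rewrite leqNgt kM expr0n.
Qed.

(** The limit is an explicit upper limit along a prescribed subsequence, so that measurability in a
    parameter on which a depends is kept. Convergence is nevertheless claimed for the whole sequence
    of partial sums. *)
Lemma riesz_fischer_subseq a (n_ : nat -> nat) :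
  (forall j, (j <= n_ j)%N) -> (forall j, (n_ j <= n_ j.+1)%N) ->
  (forall j N, \sum_(n_ j <= k < N) a k ^+ 2 <= 4^-1 ^+ j) ->
  let f := flimsup (fun j => psum a (n_ j)) in
  [/\ sqint f, forall m, ip f (e m) = a m &
    (fun N => ip (fun x => f x - psum a N x) (fun x => f x - psum a N x)) @ \oo
      --> 0].
Proof.
move=> jn nS hn f.
have sh j : sqint (psum a (n_ j)) by exact: sqint_psum.
have dh j : ip (fun x => psum a (n_ j.+1) x - psum a (n_ j) x)
    (fun x => psum a (n_ j.+1) x - psum a (n_ j) x) <= 4^-1 ^+ j.
  by rewrite ip_psumB.
have sf : sqint f by exact: sqint_flimsup.
have bf J := ip_flimsup sh dh J.
have cv0 : (fun J => 4 / 2 ^+ J) @ \oo --> (0 : R).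
  rewrite -(mulr0 4); apply: cvgMr; under eq_fun do rewrite -exprVn.
  by apply: cvg_expr; rewrite ger0_norm ?invr_ge0// invf_lt1// ltr1n.
have cf m : ip f (e m) = a m.
  apply/eqP; rewrite -subr_eq0 -sqrf_eq0 eq_le sqr_ge0 andbT.
  apply: (cvg0_ge cv0); exists m.+1 => // J /= mJ.
  have := bessel1 m (sqintB sf (sh J)); rewrite ipBl// ip_psum_e.
  by rewrite (leq_trans mJ (jn J)) => H; exact: le_trans H (bf J).
split => //.
have E N : ip (fun x => f x - psum a N x) (fun x => f x - psum a N x) =
    ip f f - \sum_(k < N) a k ^+ 2.
  have := ip_sub_psum N sf.
  have -> : (fun k => ip f (e k)) = a by apply/funext.
  by move=> ->; congr (_ - _); apply: eq_bigr => k _; rewrite cf.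
apply/cvgrPdist_le => eps eps0.
have /cvgrPdist_le /(_ _ eps0) [J _ /(_ J (leqnn J))] := cv0.
rewrite /= sub0r normrN => HJ; exists (n_ J) => // N /= JN.
rewrite sub0r normrN ger0_norm ?ip_ge0//; apply: le_trans HJ.
(* By [E] the squared distance is nonincreasing in N, so its smallness at [n_ J] persists
   afterwards. *)
apply: le_trans (ler_norm _); apply: le_trans (bf J); rewrite -/f !E lerB//.
rewrite -2!(big_mkord xpredT (fun k => a k ^+ 2)) [leRHS](@big_cat_nat _ _ _ (n_ J))//=.
by rewrite lerDl sumr_ge0// => k _; exact: sqr_ge0.
Qed.

Definition l2seq a := exists B, forall N, \sum_(k < N) a k ^+ 2 <= B.

Lemma riesz_fischer a : l2seq a -> exists f, [/\ sqint f,
  forall m, ip f (e m) = a m &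
  (fun N => ip (fun x => f x - psum a N x) (fun x => f x - psum a N x)) @ \oo
    --> 0].
Proof.
move=> la; have [n_ [h1 h2 h3]] := tail_subseq (fun k => sqr_ge0 (a k)) la.
by eexists; exact: riesz_fischer_subseq h1 h2 h3.
Qed.

Lemma l2seq_ip f : sqint f -> l2seq (fun k => ip f (e k)).
Proof. by move=> sf; exists (ip f f) => N; exact: bessel. Qed.

Hypothesis ce : forall f, sqint f -> (forall n, ip f (e n) = 0) -> ip f f = 0.

Lemma eq_coef_ae f g : sqint f -> sqint g ->
  (forall n, ip f (e n) = ip g (e n)) -> {ae mu, forall x, f x = g x}.
Proof.
move=> sf sg fg; have sfg := sqintB sf sg.
have : ip (fun x => f x - g x) (fun x => f x - g x) = 0.
  by apply: ce => // n; rewrite ipBl// fg subrr.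
by move=> /(ip_eq0_ae sfg); apply: filterS => x /eqP; rewrite subr_eq0 => /eqP.
Qed.

(** The Riesz-Fischer function with the coefficients of f equals f almost everywhere by
    completeness, and its partial sums converge to it. *)
Lemma complete_cvg f (c := fun k => ip f (e k)) : sqint f ->
  (fun N => ip (fun x => f x - psum c N x) (fun x => f x - psum c N x)) @ \oo
    --> 0.
Proof.
move=> sf; have [g [sg cg]] := riesz_fischer (l2seq_ip sf).
have fg := eq_coef_ae sf sg (fun n => esym (cg n)).
apply: cvg_trans; apply: near_eq_cvg; apply: nearW => N.
apply: ae_eq_ip; do ?[apply: sqintB => //; exact: sqint_psum].
all: by apply: filterS fg => x ->.
Qed.

Lemma parseval f : sqint f ->
  (fun N => \sum_(k < N) ip f (e k) ^+ 2) @ \oo --> ip f f.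
Proof.
move=> sf; have := complete_cvg sf => H.
rewrite -[X in _ --> X]subr0.
have -> : (fun N => \sum_(k < N) ip f (e k) ^+ 2) = (fun N => ip f f -
  ip (fun x => f x - psum (fun k => ip f (e k)) N x)
     (fun x => f x - psum (fun k => ip f (e k)) N x)).
  by apply/funext => N; rewrite ip_sub_psum//; ring.
by apply: cvgB => //; exact: cvg_cst.
Qed.

End Orthonormal.

End RealL2.

(** * Gaussian integrals and Hermite functions *)

Section Calculus.
Context {R : realType}.
Local Notation mu := (@lebesgue_measure R).
Implicit Types (F f : R -> R) (a b : R) (p : {poly R}).

Lemma is_derive_cont F f (x : R) : is_derive x 1 F (f x) -> {for x, continuous F}.
Proof. by case=> dF _; apply/differentiable_continuous/derivable1_diffP. Qed.

Lemma Rintegral_FTC F f a b : a <= b -> (forall x : R, is_derive x 1 F (f x)) ->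
  continuous f -> \int[mu]_(x in `[a, b]) f x = F b - F a.
Proof.
move=> ab dF cf; move: ab; rewrite le_eqVlt => /orP[/eqP <-|ab].
  by rewrite set_itv1 Rintegral_set1 subrr.
rewrite /Rintegral (@continuous_FTC2 _ f F)//.
- exact: continuous_subspaceT.
- split.
  + by move=> x _; have [] := dF x.
  + by apply: cvg_at_right_filter; exact: is_derive_cont (dF a).
  + by apply: cvg_at_left_filter; exact: is_derive_cont (dF b).
- by move=> x _; rewrite derive1E; have [_ ->] := dF x.
Qed.

Lemma cvg_Rintegral_itv f : mu.-integrable setT (EFin \o f) ->
  (fun n : nat => \int[mu]_(x in `[(- n%:R), n%:R]) f x) @ \oo -->
  \int[mu]_x f x.
Proof.
move=> intf; have mf : measurable_fun setT f.
  by apply/measurable_EFinP; exact: measurable_int intf.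
pose I n := `[(- n%:R), n%:R]%classic : set R.
have mI n : measurable (I n) by exact: measurable_itv.
pose g n x := ((f \_ (I n)) x)%:E.
have := @dominated_convergence _ _ _ mu setT measurableT g
  (EFin \o f) (EFin \o (Num.norm \o f)).
have H1 : forall n, measurable_fun setT (g n).
  move=> n; apply/measurable_EFinP.
  apply/(measurable_restrictT _ (mI n)).
  exact: measurable_funTS.
have H2 : measurable_fun setT (EFin \o f) by exact/measurable_EFinP.
have H3 : {ae mu, forall x, setT x -> g ^~ x @ \oo --> (EFin \o f) x}.
  apply: nearW => x _; apply: cvg_near_cst; near=> n.
  rewrite /g patchE ifT// inE /I /= in_itv/= -ler_norml.
  by near: n; exact: nbhs_infty_ger.
have H4 : mu.-integrable setT (EFin \o (Num.norm \o f)) by exact: integrable_norm.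
have H5 : {ae mu, forall x n, setT x -> (`|g n x| <= (EFin \o (Num.norm \o f)) x)%E}.
  apply: nearW => x n _; rewrite /g patchE /=.
  by case: ifPn; rewrite /= lee_fin// normr0.
move=> /(_ H1 H2 H3 H4 H5) [_ _ H].
have fin : (\int[mu]_x (f x)%:E)%E \is a fin_num by exact: integrable_fin_num.
have -> : (fun n => \int[mu]_(x in I n) f x) = fine \o (fun n => \int[mu]_x g n x)%E.
  apply/funext => n /=; rewrite /Rintegral [in LHS]integral_mkcond; congr fine.
  by apply: eq_integral => x _; rewrite /g restrict_EFin.
by apply: fine_cvg; rewrite fineK.
Unshelve. all: by end_near. Qed.

Lemma Rintegral_FTC_line F f : (forall x : R, is_derive x 1 F (f x)) ->
  continuous f -> mu.-integrable setT (EFin \o f) ->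
  (fun n : nat => F n%:R) @ \oo --> 0 -> (fun n : nat => F (- n%:R)) @ \oo --> 0 ->
  \int[mu]_x f x = 0.
Proof.
move=> dF cf intf F1 F2; have H := cvg_Rintegral_itv intf.
rewrite -(cvg_lim _ H)//; apply/cvg_lim => //.
have -> : (fun n : nat => \int[mu]_(x in `[(- n%:R), n%:R]) f x) =
  (fun n : nat => F n%:R - F (- n%:R)).
  by apply/funext => n; apply: Rintegral_FTC => //; rewrite (@le_trans _ _ 0)// oppr_le0.
by rewrite -(subr0 0); apply: cvgB.
Qed.

(** In the induction on the degree, half of the exponent bounds the lower-degree polynomial. The
    other half absorbs the new factor x through 1 + y <= e^y. *)
Lemma poly_exp_bound p (e : R) : 0 < e ->
  exists C, 0 <= C /\ forall x, `|p.[x]| <= C * expR (e * x ^+ 2).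
Proof.
elim/poly_ind: p e => [|p c IH] e e0.
  by exists 0; split => // x; rewrite horner0 normr0 mul0r.
have e2 : 0 < e / 2 by rewrite divr_gt0.
have [C [C0 HC]] := IH _ e2.
exists (C * (1 + 2 / e) + `|c|); split.
  by rewrite addr_ge0// mulr_ge0// addr_ge0// divr_ge0// ltW.
move=> x; rewrite hornerMXaddC (le_trans (ler_normD _ _))// mulrDl.
apply: lerD; last first.
  by rewrite ler_peMr// -expR0 ler_expR mulr_ge0 ?sqr_ge0// ltW.
have -> : e * x ^+ 2 = e / 2 * x ^+ 2 + e / 2 * x ^+ 2 by field.
rewrite expRD mulrA normrM [leRHS]mulrAC.
have -> : C * (1 + 2 / e) * expR (e / 2 * x ^+ 2) * expR (e / 2 * x ^+ 2) =
  (C * expR (e / 2 * x ^+ 2)) * ((1 + 2 / e) * expR (e / 2 * x ^+ 2)) by ring.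
apply: ler_pM => //; apply: le_trans (_ : (1 + 2 / e) * (1 + e / 2 * x ^+ 2) <= _).
  have -> : (1 + 2 / e) * (1 + e / 2 * x ^+ 2) = 1 + x ^+ 2 + (2 / e + e / 2 * x ^+ 2).
    by field; exact: lt0r_neq0.
  apply: (@le_trans _ _ (1 + x ^+ 2)).
    by rewrite ler_norml; apply/andP; split; nra.
  by rewrite lerDl addr_ge0//; [rewrite divr_ge0// ltW|rewrite mulr_ge0 ?sqr_ge0// ltW].
by rewrite ler_pM2l ?expR_ge1Dx// addr_gt0// divr_gt0.
Qed.

(** This class is closed under differentiation and multiplication by x, which turns the Hermite
    calculus into identities in [{poly R}]. *)
Definition pgauss p a x := p.[x] * expR (- (a * x ^+ 2)).

Lemma is_derive_pgauss p a (x : R) :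
  is_derive x 1 (pgauss p a) (pgauss (p^`() - (2 * a) *: ('X * p)) a x).
Proof.
have -> : pgauss p a = (horner p) * (expR \o (- (a \*: (id ^+ 2)))).
  by apply/funext => y; rewrite /pgauss /= !fctE.
apply: is_derive_eq; rewrite /pgauss !hornerE /= !fctE /GRing.scale/=.
by rewrite expr1 (mulrC (expR _)) -!mulrA; do 2!rewrite -?expr2; ring.
Qed.

Lemma continuous_pgauss p a : continuous (pgauss p a).
Proof. by move=> x; apply: is_derive_cont (is_derive_pgauss p a x). Qed.

Lemma measurable_pgauss p a : measurable_fun setT (pgauss p a).
Proof. by apply: continuous_measurable_fun; exact: continuous_pgauss. Qed.

Lemma pgauss_bound p a : 0 < a ->
  exists C, 0 <= C /\ forall x, `|pgauss p a x| <= C * expR (- (a / 2 * x ^+ 2)).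
Proof.
move=> a0; have [|C [C0 HC]] := @poly_exp_bound p (a / 2); first by rewrite divr_gt0.
exists C; split => // x; rewrite /pgauss normrM (ger0_norm (expR_ge0 _)).
apply: le_trans (ler_wpM2r (expR_ge0 _) (HC x)) _.
by rewrite -(mulrA C) -expRD ler_wpM2l// ler_expR; lra.
Qed.

Lemma integrable_pgauss p a : 0 < a -> mu.-integrable setT (EFin \o pgauss p a).
Proof.
move=> a0; have [C [C0 HC]] := pgauss_bound p a0.
(* With variance 1 / a the centred normal density is a multiple of e^{- a x^2 / 2}, the majorant of
   [pgauss_bound]. *)
pose s := Num.sqrt (a^-1).
have s2 : s ^+ 2 = a^-1 by rewrite sqr_sqrtr// invr_ge0 ltW.
have s0 : s != 0 by rewrite -sqrf_eq0 s2 invr_eq0 lt0r_neq0.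
have := integrableZl measurableT (C * (normal_peak s)^-1) (integrable_normal_pdf 0 s).
apply: le_integrable => //.
  by apply/measurable_EFinP; exact: measurable_pgauss.
move=> x _ /=; rewrite lee_fin (le_trans (HC x))// (le_trans _ (ler_norm _))//.
have -> : normal_pdf 0 s x = normal_peak s * normal_fun 0 s x by rewrite normal_pdfE.
rewrite -(mulrA C) mulKf /normal_fun ?subr0; last first.
  by rewrite lt0r_neq0// normal_peak_gt0.
rewrite s2 ler_wpM2l// ler_expR le_eqVlt; apply/orP; left; apply/eqP.
by field; exact: lt0r_neq0.
Qed.

Lemma pgauss_cvg0 p a (u : nat -> R) : 0 < a -> (forall n, n%:R <= `|u n|) ->
  (fun n => pgauss p a (u n)) @ \oo --> 0.
Proof.
move=> a0 hu; have [C [C0 HC]] := pgauss_bound (p * 'X) a0.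
apply: norm_cvg0; rewrite -(cvg_shiftS _) /=.
apply: (@squeeze_cvgr _ _ _ _ (fun=> 0) (fun n => C * n.+1%:R^-1)).
- apply: nearW => n; rewrite normr_ge0/=.
  have un : 0 < `|u n.+1| by apply: lt_le_trans (hu _); rewrite ltr0n.
  apply: (@le_trans _ _ (C * `|u n.+1|^-1)).
    rewrite ler_pdivlMr//; apply: le_trans (_ : `|pgauss (p * 'X) a (u n.+1)| <= _).
      by rewrite /pgauss hornerMX !normrM mulrAC.
    by rewrite (le_trans (HC _))// ler_piMr// -expR0 ler_expR oppr_le0 mulr_ge0 ?sqr_ge0// divr_ge0 ?ltW.
  by rewrite ler_wpM2l// lef_pV2// posrE.
- exact: cvg_cst.
- by rewrite -(mulr0 C); apply: cvgMr; exact: cvg_harmonic.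
Qed.

(** Integration by parts against a Gaussian: the integrand is the derivative of [pgauss p a], which
    vanishes at both infinities. *)
Lemma Rintegral_pgauss_derive p a : 0 < a ->
  \int[mu]_x pgauss (p^`() - (2 * a) *: ('X * p)) a x = 0.
Proof.
move=> a0; apply: (@Rintegral_FTC_line (pgauss p a)).
- by move=> x; exact: is_derive_pgauss.
- exact: continuous_pgauss.
- exact: integrable_pgauss.
- by apply: pgauss_cvg0 => // n; rewrite ger0_norm.
- by apply: pgauss_cvg0 => // n; rewrite normrN ger0_norm.
Qed.

End Calculus.

(** * Transfer from Borel to Lebesgue measurability *)

Section Lebesgue.
Context {R : realType}.
Local Notation mu := (@lebesgue_measure R).

Lemma measurable_lebR_id :
  @measurable_fun _ _ (lebR R) (measurableTypeR R) setT (fun x => x).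
Proof.
move=> _ A mA; rewrite setTI; exact: sub_caratheodory.
Qed.

Lemma measurable_lebR (A : set R) :
  measurable (A : set (measurableTypeR R)) -> measurable (A : set (lebR R)).
Proof. by move=> mA; exact: sub_caratheodory. Qed.

Lemma measurable_fun_lebR (f : R -> R) : measurable_fun setT f ->
  measurable_fun (setT : set (lebR R)) f.
Proof. by move=> mf; apply: (measurableT_comp mf); exact: measurable_lebR_id. Qed.

(** The identity from [lebR R] to the Borel line is measurable and pushes [leb R] forward to
    Lebesgue measure, so the change of variables formula applies. *)
Lemma ge0_integral_leb (f : R -> \bar R) (D : set R) :
  measurable (D : set (measurableTypeR R)) ->
  measurable_fun (setT : set (measurableTypeR R)) f ->
  (forall x, (0 <= f x)%E) ->
  (\int[leb R]_(x in D) f x = \int[mu]_(x in D) f x)%E.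
Proof.
move=> mD mf f0; have mid := measurable_lebR_id.
have := @ge0_integral_pushforward _ _ _ _ R _ mid (leb R) D f mD (measurable_funTS mf) (fun x _ => f0 x).
move=> <-.
apply: eq_measure_integral => A mA _ //.
Qed.

Lemma Rintegral_leb (f : R -> R) (D : set R) :
  measurable (D : set (measurableTypeR R)) ->
  measurable_fun (setT : set (measurableTypeR R)) f ->
  \int[leb R]_(x in D) f x = \int[mu]_(x in D) f x.
Proof.
move=> mD mf; rewrite /Rintegral integralE [in RHS]integralE.
have mE : measurable_fun (setT : set (measurableTypeR R)) (EFin \o f).
  by apply/measurable_EFinP.
congr fine; congr (_ - _)%E; apply: ge0_integral_leb => //.
- exact: measurable_funepos.
- exact: measurable_funeneg.
Qed.

Lemma integrable_leb (f : R -> R) (D : set R) :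
  measurable (D : set (measurableTypeR R)) ->
  measurable_fun (setT : set (measurableTypeR R)) f ->
  mu.-integrable (D : set (measurableTypeR R)) (EFin \o f) ->
  (leb R).-integrable (D : set (lebR R)) (EFin \o f).
Proof.
move=> mD mf /integrableP[_ foo]; apply/integrableP; split.
  by apply/measurable_EFinP/measurable_funTS; exact: measurable_fun_lebR.
rewrite ge0_integral_leb//; apply: measurableT_comp => //.
exact/measurable_EFinP.
Qed.

Lemma sqint_pgauss (p : {poly R}) a : 0 < a -> sqint (leb R) (pgauss p a).
Proof.
move=> a0; split; first by apply: measurable_fun_lebR; exact: measurable_pgauss.
apply: integrable_leb => //.
  by apply: measurable_funX; exact: measurable_pgauss.
have := @integrable_pgauss R (p ^+ 2) (2 * a); rewrite mulr_gt0// => /(_ isT).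
apply: eq_integrable => // x _ /=; rewrite /pgauss exprMn -expRM_natl horner_exp.
by congr (_ * expR _)%:E; ring.
Qed.

End Lebesgue.

(** * Hermite polynomials: recurrences, orthogonality and second moments *)

Section HermitePolynomials.
Context {R : realType}.
Local Notation mu := (@lebesgue_measure R).
Implicit Types p q : {poly R}.

(** The recursion records, up to sign, the derivative of H_m e^{- x^2}. Rodrigues' formula then
    follows by induction. *)
Fixpoint HP n : {poly R} :=
  if n is m.+1 then 2 *: ('X * HP m) - (HP m)^`() else 1.

Lemma HPS n : HP n.+1 = 2 *: ('X * HP n) - (HP n)^`().
Proof. by []. Qed.

Let deriv1 : (1 : {poly R})^`() = 0.
Proof. by rewrite -polyC1 derivC. Qed.

Lemma HP_deriv n : (HP n.+1)^`() = (2 * n.+1%:R) *: HP n.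
Proof.
elim: n => [|n IH].
  by rewrite HPS /= derivB derivZ derivM derivX deriv1 mulr0 addr0 linear0 subr0 ?mulr1 ?mul1r.
rewrite HPS derivB derivZ derivM derivX IH derivZ mul1r.
rewrite -scalerAr scalerDr scalerA -addrA.
have -> : 2 * (2 * n.+1%:R) *: ('X * HP n) - (2 * n.+1%:R) *: (HP n)^`() =
  (2 * n.+1%:R) *: HP n.+1.
  by rewrite HPS scalerBr scalerA; congr (_ *: _ - _); ring.
by rewrite -scalerDl; congr (_ *: _); rewrite -(natr1 n.+1); ring.
Qed.

Lemma HP_rec n : 'X * HP n.+1 = 2^-1 *: HP n.+2 + n.+1%:R *: HP n.
Proof.
rewrite (HPS n.+1) HP_deriv scalerBr !scalerA mulVf// scale1r.
by rewrite mulrA mulVf// mul1r subrK.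
Qed.

Lemma HP_rec0 : 'X * HP 0 = 2^-1 *: HP 1.
Proof. by rewrite HPS /= deriv1 subr0 scalerA mulVf// scale1r. Qed.

Lemma hermite_polyE n (x : R) : hermite_poly n x = (HP n).[x].
Proof.
have H : forall n, derive1n n (fun y : R => expR (- y ^+ 2)) =
    fun x => (-1) ^+ n * pgauss (HP n) 1 x.
  elim=> [|k IH]; apply/funext => y.
    by rewrite derive1n0 /pgauss /= hornerC !mul1r.
  rewrite derive1nS IH derive1E.
  have := is_deriveZ ((-1) ^+ k) (is_derive_pgauss (HP k) 1 y).
  case=> _ ->; transitivity ((-1) ^+ k * - pgauss (HP k.+1) 1 y); last first.
    by rewrite exprS mulN1r mulNr mulrN.
  rewrite HPS; congr (_ * _).
  by rewrite /pgauss mulr1 -opprB hornerN mulNr.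
rewrite /hermite_poly H /pgauss mul1r.
have s1 : (-1) ^+ n * (-1) ^+ n = 1 :> R by rewrite -exprMn mulrNN mulr1 expr1n.
have e1 : expR (x ^+ 2) * expR (- x ^+ 2) = 1 by rewrite -expRD subrr expR0.
transitivity (((-1) ^+ n * (-1) ^+ n) * (expR (x ^+ 2) * expR (- x ^+ 2)) * (HP n).[x]).
  by ring.
by rewrite s1 e1 !mul1r.
Qed.

Definition gint p : R := \int[mu]_x pgauss p 1 x.

Lemma gintD p q : gint (p + q) = gint p + gint q.
Proof.
rewrite /gint -RintegralD//; try exact: integrable_pgauss.
by apply: eq_Rintegral => x _; rewrite /pgauss hornerD mulrDl.
Qed.

Lemma gintZ c p : gint (c *: p) = c * gint p.
Proof.
rewrite /gint -RintegralZl//; try exact: integrable_pgauss.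
by apply: eq_Rintegral => x _; rewrite /pgauss hornerZ -mulrA.
Qed.

Lemma gintB p q : gint (p - q) = gint p - gint q.
Proof. by rewrite gintD -scaleN1r gintZ mulN1r. Qed.

Lemma gint1 : gint 1 = Num.sqrt pi.
Proof.
rewrite /gint /Rintegral -[RHS]/(fine (Num.sqrt pi)%:E) -integralT_gauss.
congr fine; apply: eq_integral => x _.
by rewrite /pgauss /gauss_fun hornerC !mul1r.
Qed.

(** For the weight e^{- x^2}, the operator 2 x - d/dx is the adjoint of d/dx. Each use of this
    identity lowers both degrees by one. *)
Lemma gint_HPSl n q : gint (HP n.+1 * q) = gint (HP n * q^`()).
Proof.
have H := Rintegral_pgauss_derive (HP n * q) (@ltr01 R).
have -> : HP n.+1 * q = HP n * q^`() -
    ((HP n * q)^`() - (2 * 1) *: ('X * (HP n * q))).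
  rewrite HPS derivM mulrBl -scalerAl mulrA mulr1 [(HP n)^`() * q + _]addrC.
  by rewrite -addrA !opprD !opprK !addrA subrr add0r addrC.
by rewrite gintB -[gint (_ - _)]/(\int[mu]_x _) H subr0.
Qed.

(** Squared norm of [HP n] in the weight e^{- x^2}, as [gint_HP] shows. *)
Definition hnorm n : R := 2 ^+ n * n`!%:R * Num.sqrt pi.

Lemma hnorm_gt0 n : 0 < hnorm n.
Proof. by rewrite /hnorm !mulr_gt0 ?exprn_gt0 ?ltr0n ?fact_gt0 ?sqrtr_gt0 ?pi_gt0. Qed.

Lemma hnormS n : hnorm n.+1 = (2 * n.+1%:R) * hnorm n.
Proof. by rewrite /hnorm exprS factS natrM; ring. Qed.

Lemma gint_HP n m : gint (HP n * HP m) = (n == m)%:R * hnorm n.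
Proof.
elim: n m => [|n IH] [|m].
- by rewrite /= mulr1 gint1 /hnorm expr0 !mul1r.
- by rewrite mulrC gint_HPSl deriv1 mulr0 -(scale0r 0) gintZ !mul0r.
- by rewrite gint_HPSl deriv1 mulr0 -(scale0r 0) gintZ !mul0r.
- by rewrite gint_HPSl HP_deriv -scalerAr gintZ IH eqSS hnormS; case: eqP => [->|_];
    rewrite ?mul1r// !mul0r mulr0.
Qed.

(** The three-term recurrence expands x H_n on its two neighbours, and orthogonality leaves only
    their squared norms. *)
Lemma gint_X2HP n : gint (('X * HP n) ^+ 2) = (n%:R + 2^-1) * hnorm n.
Proof.
case: n => [|n]; rewrite expr2.
  by rewrite HP_rec0 -scalerAl -scalerAr !gintZ gint_HP hnormS eqxx /=; field.
have nn2 : (n.+2 == n) = false by rewrite gtn_eqF// ltnW.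
have nn2' : (n == n.+2) = false by rewrite eq_sym.
set r := RHS.
rewrite HP_rec mulrDl !mulrDr -!scalerAl -!scalerAr !gintD !gintZ !gint_HP.
by rewrite {}/r !eqxx nn2 nn2' !hnormS -!(natr1 n.+1) -(natr1 n) /=; field.
Qed.

Definition hcoef n : R :=
  pi `^ (- 4^-1) * 2 `^ (- (n%:R / 2)) * (n`!)%:R `^ (- 2^-1).

Lemma hcoef_gt0 n : 0 < hcoef n.
Proof. by rewrite /hcoef !mulr_gt0// powR_gt0// ?pi_gt0// ltr0n fact_gt0. Qed.

Lemma hcoef2 n : hcoef n ^+ 2 = (hnorm n)^-1.
Proof.
have H (a r : R) : (a `^ r) ^+ 2 = a `^ (r * 2).
  by rewrite powRrM powR_mulrn// powR_ge0.
rewrite /hcoef /hnorm !exprMn !H -mulrA mulrC !invfM; congr (_ * _ * _).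
- rewrite mulNr mulfVK// powRN powR_mulrn//.
- by rewrite mulNr mulVf// powRN powRr1.
- have -> : - 4^-1 * 2 = - 2^-1 :> R by field.
  by rewrite powRN powR12_sqrt// pi_ge0.
Qed.

Lemma hermite_funE n : hermite_fun n = pgauss (hcoef n *: HP n) (2^-1).
Proof.
apply/funext => x; rewrite /hermite_fun -/(hcoef n) hermite_polyE /pgauss hornerZ.
by rewrite [2^-1 * _]mulrC mulrAC.
Qed.

Lemma pgaussM p q a b x : pgauss p a x * pgauss q b x = pgauss (p * q) (a + b) x.
Proof. by rewrite /pgauss hornerM mulrACA -expRD; congr (_ * expR _); ring. Qed.

Lemma pgaussX p a x : x * pgauss p a x = pgauss ('X * p) a x.
Proof. by rewrite /pgauss hornerM hornerX mulrA. Qed.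

Let half2 : 2^-1 + 2^-1 = 1 :> R. Proof. by field. Qed.

Lemma ip_pgauss p q : ip (leb R) (pgauss p (2^-1)) (pgauss q (2^-1)) = gint (p * q).
Proof.
rewrite /ip /gint; under eq_Rintegral do rewrite pgaussM half2.
by rewrite Rintegral_leb//; exact: measurable_pgauss.
Qed.

Lemma sqint_hermite n : sqint (leb R) (hermite_fun n).
Proof. by rewrite hermite_funE; apply: sqint_pgauss; rewrite invr_gt0. Qed.

Lemma ip_hermite m n : ip (leb R) (hermite_fun m) (hermite_fun n) = (m == n)%:R.
Proof.
rewrite !hermite_funE ip_pgauss -scalerAl -scalerAr !gintZ gint_HP.
case: eqP => [->|_]; last by rewrite mul0r !mulr0.
by rewrite mul1r mulrA -expr2 hcoef2 mulVf// lt0r_neq0// hnorm_gt0.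
Qed.

Lemma sqint_Xhermite n : sqint (leb R) (fun x => x * hermite_fun n x).
Proof.
rewrite hermite_funE; under eq_fun do rewrite pgaussX.
by apply: sqint_pgauss; rewrite invr_gt0.
Qed.

(** The value is half of the eigenvalue 2 n + 1. Chebyshev's inequality uses it to localize psi_n,
    once inside its turning points and once inside a given interval. *)
Lemma hermite_moment2 n : ip (leb R) (fun x => x * hermite_fun n x)
  (fun x => x * hermite_fun n x) = n%:R + 2^-1.
Proof.
rewrite hermite_funE; under eq_fun do rewrite pgaussX.
rewrite ip_pgauss -scalerAr -scalerAl -scalerAr !gintZ -expr2 gint_X2HP.
by rewrite mulrA -expr2 hcoef2 mulrCA mulVf ?mulr1// lt0r_neq0// hnorm_gt0.
Qed.

End HermitePolynomials.

(** * Mass of oscillator eigenfunctions on a set *)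

Section HermiteODE.
Context {R : realType}.
Local Notation mu := (@lebesgue_measure R).
Implicit Types p q : {poly R}.

Lemma HP_ode n : (HP n)^`()^`() - 2 *: ('X * (HP n)^`()) + (2 * n%:R) *: HP n = 0 :> {poly R}.
Proof.
case: n => [|n].
  by rewrite /= -polyC1 derivC linear0 mulr0 scaler0 subr0 mulr0 scale0r addr0.
set c := 2 * n.+1%:R.
have -> : (HP n.+1)^`() = c *: HP n :> {poly R} by rewrite HP_deriv.
by rewrite derivZ HPS -!mul_polyC; ring.
Qed.

(** Polynomial factor of the derivative of p e^{- x^2 / 2}. *)
Definition dgauss p : {poly R} := p^`() - 'X * p.

Lemma is_derive_gauss p (x : R) :
  is_derive x 1 (pgauss p (2^-1)) (pgauss (dgauss p) (2^-1) x).
Proof.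
have := is_derive_pgauss p (2^-1) x.
by rewrite mulfV// scale1r.
Qed.

Definition dhermite n : R -> R := pgauss (dgauss (hcoef n *: HP n)) (2^-1).

Lemma is_derive_hermite n (x : R) : is_derive x 1 (hermite_fun n) (dhermite n x).
Proof. by rewrite hermite_funE; exact: is_derive_gauss. Qed.

Definition hermite_lam n : R := (2 * n + 1)%:R.

Lemma is_derive_dhermite n (x : R) :
  is_derive x 1 (dhermite n) ((x ^+ 2 - hermite_lam n) * hermite_fun n x).
Proof.
have := is_derive_gauss (dgauss (hcoef n *: HP n)) x.
rewrite hermite_funE /hermite_lam.
have -> : dgauss (dgauss (hcoef n *: HP n)) =
    ('X ^+ 2 - (2 * n + 1)%:R%:P) * (hcoef n *: HP n).
  apply/eqP; rewrite -subr_eq0; apply/eqP.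
  have := HP_ode n; set H : {poly R} := HP n => Hode.
  transitivity (hcoef n *: (H^`()^`() - 2 *: ('X * H^`()) + (2 * n%:R) *: H)); last first.
    by rewrite Hode scaler0.
  rewrite /dgauss !derivB derivM derivX !derivZ !mul1r -!mul_polyC.
  by rewrite natrD natrM !(polyCD, polyCM, polyCMn, polyC1); ring.
by rewrite /pgauss hornerM -mulrA hornerD hornerN hornerXn hornerC.
Qed.

End HermiteODE.

Section MeanValue.
Context {R : realType}.

(** Both signs of x are treated at once. The condition [0 <= c * x] converts a sign of f into
    monotonicity away from 0. Derivatives are asked for only where y^2 <= x^2, because the second
    energy has lam - y^2 in a denominator. *)
Lemma MVT0 (F f : R -> R) (x : R) :
  (forall y : R, y ^+ 2 <= x ^+ 2 -> is_derive y 1 F (f y)) ->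
  exists c, [/\ 0 <= c * x, c ^+ 2 <= x ^+ 2 & F x - F 0 = f c * x].
Proof.
move=> dF.
have cF (a b : R) : (forall y, y \in `[a, b] -> y ^+ 2 <= x ^+ 2) ->
    {within `[a, b], continuous F}.
  move=> H; apply: continuous_in_subspaceT => y; rewrite inE /= => yab.
  by apply: is_derive_cont (dF y (H _ yab)).
have [x0|x0|->] := ltgtP x 0; last first.
- by exists 0; rewrite subrr !mulr0.
- have H y : y \in `[0, x] -> y ^+ 2 <= x ^+ 2.
    by rewrite in_itv /= => /andP[y0 yx]; rewrite ler_sqr ?nnegrE// ltW.
  have [|c /[!in_itv]/= /andP[c0 cx] E] := @MVT R F f 0 x x0 _ (cF _ _ H).
    by move=> y y0x; apply/dF/H/subset_itv_oo_cc.
  exists c; rewrite E subr0; split=> //; first by rewrite mulr_ge0// ltW.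
  by apply: H; rewrite in_itv/= !ltW.
- have H y : y \in `[x, 0] -> y ^+ 2 <= x ^+ 2.
    rewrite in_itv /= => /andP[xy y0].
    by rewrite -sqrrN -(sqrrN x) ler_sqr ?nnegrE ?oppr_ge0 ?lerN2// ltW.
  have [|c /[!in_itv]/= /andP[cx c0] E] := @MVT R F f x 0 x0 _ (cF _ _ H).
    by move=> y y0x; apply/dF/H/subset_itv_oo_cc.
  exists c; split=> //.
  + by rewrite -mulrNN mulr_ge0// oppr_ge0 ltW.
  + by apply: H; rewrite in_itv/= !ltW.
  + by apply: oppr_inj; rewrite opprB E sub0r mulrN.
Qed.

End MeanValue.

Section LebesgueIntervals.
Context {R : realType}.

Lemma leb_itv (a b : R) : a <= b -> leb R (`[a, b] : set (lebR R)) = (b - a)%:E.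
Proof.
move=> ab; have := @lebesgue_measure_itv R `[a, b]; rewrite /= lte_fin.
rewrite lt_neqAle ab andbT => H.
transitivity (lebesgue_measure (`[a, b]%classic : set R)) => //.
by rewrite H; case: eqVneq => [->|]//=; rewrite subrr.
Qed.

Lemma measurable_itv_lebR (i : interval R) : measurable ([set` i] : set (lebR R)).
Proof. by apply: measurable_lebR; exact: measurable_itv. Qed.

Lemma integrable_indic_leb (A : set (lebR R)) : measurable A ->
  (leb R A < +oo)%E -> (leb R).-integrable setT (EFin \o \1_A).
Proof.
move=> mA Afin; apply/integrableP; split.
  by apply/measurable_EFinP; exact: measurable_indic.
rewrite (eq_integral (fun x => (\1_A x)%:E)) => [|x _]; last first.
  by rewrite gee0_abs// lee_fin.
by rewrite integral_indic// setIT.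
Qed.

Lemma Rintegral_indic_leb (A : set (lebR R)) : measurable A ->
  \int[leb R]_x (\1_A x : R) = fine (leb R A).
Proof. by move=> mA; rewrite /Rintegral integral_indic// setIT. Qed.

End LebesgueIntervals.

(** * Energy estimates for u'' = (x^2 - lam) u *)

Section OscillatorEigenfunction.
Context {R : realType} (u v : R -> R) (lam : R).
Hypothesis du : forall x : R, is_derive x 1 u (v x).
Hypothesis dv : forall x : R, is_derive x 1 v ((x ^+ 2 - lam) * u x).
Hypothesis lam_ge1 : 1 <= lam.

(** Value at 0 of u^2 + v^2 / (lam - x^2), and lam^-1 times the value at 0 of v^2 + (lam - x^2) u^2.
    It is the squared amplitude against which u and v are measured. *)
Definition energy0 : R := u 0 ^+ 2 + v 0 ^+ 2 / lam.

Let potential (y : R) : R := lam - y ^+ 2.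

Let dpotential (y : R) : is_derive y 1 potential (- (2 * y)).
Proof.
have -> : potential = cst lam - id ^+ 2 by apply/funext => z; rewrite /potential !fctE.
by apply: is_derive_eq; rewrite /GRing.scale/=; ring.
Qed.

Let dsqr (f : R -> R) (y d : R) : is_derive y 1 f d -> is_derive y 1 (fun z => f z ^+ 2) (2 * f y * d).
Proof.
move=> df; have -> : (fun z => f z ^+ 2) = f * f by apply/funext => z; rewrite !fctE expr2.
by apply: (is_derive_eq (is_deriveM df df)); rewrite /GRing.scale/=; ring.
Qed.

Let lam_gt0 : 0 < lam. Proof. exact: lt_le_trans ltr01 lam_ge1. Qed.

(* [v^2 + (lam - x^2) u^2] decreases away from [0], and
   [u^2 + v^2 / (lam - x^2)] increases. *)
Lemma energy_le (x : R) : v x ^+ 2 + (lam - x ^+ 2) * u x ^+ 2 <= lam * energy0.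
Proof.
pose F := fun y : R => v y ^+ 2 + (lam - y ^+ 2) * u y ^+ 2.
have [|c [cx _ E]] := @MVT0 R F (fun y => - (2 * y * u y ^+ 2)) x.
  move=> y _.
  have H := is_deriveD (dsqr (dv y)) (is_deriveM (dpotential y) (dsqr (du y))).
  by apply: (is_derive_eq H); rewrite /GRing.scale/= /potential; ring.
have -> : lam * energy0 = F 0.
  by rewrite /F /energy0 expr0n subr0; field; exact: lt0r_neq0.
rewrite -/(F x) -subr_le0 E -mulNr -mulrA.
by have := sqr_ge0 (u c); nra.
Qed.

Lemma energy_ge (x : R) : x ^+ 2 < lam ->
  (lam - x ^+ 2) * (energy0 - u x ^+ 2) <= v x ^+ 2.
Proof.
move=> xl; pose q := potential.
have q0 y : y ^+ 2 <= x ^+ 2 -> 0 < q y.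
  by move=> yx; rewrite /q /potential subr_gt0 (le_lt_trans yx).
pose F := fun y : R => u y ^+ 2 + v y ^+ 2 * (q y)^-1.
have [|c [cx cx2 E]] := @MVT0 R F (fun y => 2 * y * v y ^+ 2 / q y ^+ 2) x.
  move=> y yx.
  have qy := lt0r_neq0 (q0 y yx).
  have H := is_deriveD (dsqr (du y)) (is_deriveM (dsqr (dv y)) (is_deriveV qy (dpotential y))).
  apply: (is_derive_eq H); rewrite /GRing.scale/=.
  have -> : y ^+ 2 - lam = - q y by rewrite /q /potential opprB.
  by field.
have F0 : F 0 = energy0 by rewrite /F /q /potential expr0n subr0.
have : energy0 <= F x.
  rewrite -F0 -subr_ge0 E.
  have -> : 2 * c * v c ^+ 2 / q c ^+ 2 * x = (2 * (c * x)) * (v c / q c) ^+ 2.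
    by rewrite expr_div_n; ring.
  by rewrite mulr_ge0 ?sqr_ge0// mulr_ge0.
rewrite /F -lerBlDl ler_pdivlMr ?q0// mulrC; exact.
Qed.

(** The classical turning point is sqrt lam. The factor 3/4 is below 1, which keeps lam - x^2 >= lam
    / 4 inside. It is above 1/2, so that the second moment lam / 2 cannot put all the mass
    outside. *)
Definition turning_radius : R := Num.sqrt (3 / 4 * lam).
Local Notation rho := turning_radius.
Local Notation e0 := energy0.

Lemma turning_radius2 : rho ^+ 2 = 3 / 4 * lam.
Proof. by rewrite sqr_sqrtr// mulr_ge0// (le_trans _ lam_ge1). Qed.

Lemma turning_radius_gt0 : 0 < rho.
Proof. by rewrite sqrtr_gt0 mulr_gt0// (lt_le_trans _ lam_ge1). Qed.

Lemma itv_radius (x : R) : x \in `[(- rho), rho] -> x ^+ 2 <= 3 / 4 * lam.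
Proof.
rewrite in_itv/= -ler_norml -turning_radius2 => xr.
by rewrite -(real_normK (num_real x)) ler_sqr ?nnegrE// ltW// turning_radius_gt0.
Qed.

Lemma u_le_energy (x : R) : x \in `[(- rho), rho] -> u x ^+ 2 <= 4 * e0.
Proof.
move=> /itv_radius xr; have := energy_le x; have := sqr_ge0 (v x).
have := sqr_ge0 (u x); have := lam_ge1.
set U := u x ^+ 2; set V := v x ^+ 2; set L := lam in xr *.
move=> L1 U0 V0 H.
have : L * U <= L * (4 * e0) by nra.
by rewrite ler_pM2l// (lt_le_trans _ L1).
Qed.

Lemma v_le_energy (x : R) : x \in `[(- rho), rho] -> v x ^+ 2 <= lam * e0.
Proof.
move=> /itv_radius xr; have := energy_le x; have := sqr_ge0 (u x).
have := lam_ge1 => L1 U0; apply: le_trans; rewrite lerDl mulr_ge0//.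
by rewrite subr_ge0; nra.
Qed.

Hypothesis su : sqint (leb R) u.
Hypothesis sx : sqint (leb R) (fun x => x * u x).
Hypothesis u1 : ip (leb R) u u = 1.
Hypothesis xu : ip (leb R) (fun x => x * u x) (fun x => x * u x) = lam / 2.

(** Chebyshev's inequality leaves at most (lam / 2) / (3 lam / 4) = 2/3 of the mass outside the
    radius. Inside, u^2 <= 4 e0 on a length 2 rho, whence 1/3 <= 8 rho e0. *)
Lemma energy0_lower : 1 <= 24 * rho * e0.
Proof.
pose I : set (lebR R) := `[(- rho), rho]%classic.
have mI : measurable I by exact: measurable_itv_lebR.
have r0 := turning_radius_gt0; have r2 := turning_radius2.
have L1 := lam_ge1.
have lebI : leb R I = (2 * rho)%:E.
  by rewrite leb_itv; [congr EFin; ring|rewrite (@le_trans _ _ 0) ?oppr_le0// ltW].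
have iI : (leb R).-integrable setT (EFin \o \1_I).
  by apply: integrable_indic_leb => //; rewrite lebI ltry.
have pt (x : R) : u x ^+ 2 <= 4 * e0 * \1_I x + (3 / 4 * lam)^-1 * (x * u x) ^+ 2.
  have [xI|xI] := boolP (x \in `[(- rho), rho]).
    rewrite indicE mem_set// mulr1 (le_trans (u_le_energy xI))// lerDl.
    by rewrite mulr_ge0 ?sqr_ge0// invr_ge0 mulr_ge0// (le_trans _ L1).
  rewrite indicE memNset/=; last by apply/negP.
  have -> : 4 * e0 * 0 + (3 / 4 * lam)^-1 * (x * u x) ^+ 2 =
    ((3 / 4 * lam)^-1 * x ^+ 2) * u x ^+ 2 by ring.
  rewrite ler_peMl ?sqr_ge0// mulrC ler_pdivlMr ?mul1r.
    rewrite -r2 -(real_normK (num_real x)) ler_sqr ?nnegrE ?(ltW r0)//.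
    by move: xI; rewrite in_itv/= -ler_norml -ltNge => /ltW.
  by rewrite mulr_gt0// (lt_le_trans _ L1).
have : ip (leb R) u u <= \int[leb R]_x (4 * e0 * \1_I x + (3 / 4 * lam)^-1 * (x * u x) ^+ 2).
  rewrite ipE; apply: le_Rintegral => //.
  - exact: su.2.
  - have := integrableD measurableT (integrableZl measurableT (4 * e0) iI)
      (integrableZl measurableT (3 / 4 * lam)^-1 sx.2).
    exact: eq_integrable.
rewrite RintegralD//; last 2 first.
  by have := integrableZl measurableT (4 * e0) iI; exact: eq_integrable.
  by have := integrableZl measurableT (3 / 4 * lam)^-1 sx.2; exact: eq_integrable.
rewrite !RintegralZl//; last exact: sx.2.
rewrite Rintegral_indic_leb// lebI /= -ipE xu u1.
have -> : (3 / 4 * lam)^-1 * (lam / 2) = 2 / 3.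
  have := lt0r_neq0 (lt_le_trans ltr01 L1); move: (lam) => l l0.
  by field.
by rewrite /=; lra.
Qed.

(* With [h = theta * sqrt e0], integrating [(h * atan (u / h) * v)'] bounds the
   integral of [v ^ 2 / (1 + (u / h) ^ 2)], whereas [v ^ 2] is of size [lam * e0]
   where [u ^ 2 < h ^ 2]; hence the latter set is small. *)
Lemma eigenfunction_mass_set (theta : R) (S : set (lebR R)) : 0 < theta ->
  theta ^+ 2 <= 2^-1 -> measurable S -> S `<=` `[(- rho), rho]%classic ->
  theta ^+ 2 * e0 * (fine (leb R S) - 256 * theta * rho) <=
  \int[leb R]_(x in S) (u x ^+ 2).
Proof.
move=> th0 th2 mS SI; set I : set (lebR R) := `[(- rho), rho]%classic in SI.
have mI : measurable I by exact: measurable_itv_lebR.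
have r0 := turning_radius_gt0; have r2 := turning_radius2.
have L1 := lam_ge1; have L0 : 0 < lam by exact: lt_le_trans ltr01 L1.
have rr : - rho <= rho by rewrite (@le_trans _ _ 0) ?oppr_le0// ltW.
have lebI : leb R I = (2 * rho)%:E by rewrite leb_itv//; congr EFin; ring.
have e0p : 0 < e0.
  by have := energy0_lower; rewrite -(pmulr_rgt0 _ (mulr_gt0 (ltr0n R 24) r0)); lra.
have [e ep e2] : exists2 e, 0 < e & e ^+ 2 = e0.
  by exists (Num.sqrt e0); [rewrite sqrtr_gt0|rewrite sqr_sqrtr// ltW].
have [h hE] : exists h, h = theta * e by eexists.
have hp : 0 < h by rewrite hE mulr_gt0.
have h0 : h != 0 by rewrite lt0r_neq0.
(* The linear term is there to make [phi] dominate its first summand. Its slope 4 h lam e bounds the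
   middle summand of [phi], since |atan| <= 2, |x^2 - lam| <= lam and |u| <= 2 e. *)
pose Phi := fun x : R => h * atan (u x / h) * v x + 4 * h * lam * e * x.
pose phi := fun x : R => v x ^+ 2 / (1 + (u x / h) ^+ 2) +
  h * atan (u x / h) * ((x ^+ 2 - lam) * u x) + 4 * h * lam * e.
have dPhi (x : R) : is_derive x 1 Phi (phi x).
  have da := is_derive1_atan (u x / h).
  have duh : is_derive x 1 (fun y => u y / h) (v x / h).
    have -> : (fun y => u y / h) = (h^-1 \*: u).
      by apply/funext => y; rewrite /= mulrC.
    by apply: is_derive_eq; rewrite /GRing.scale/= mulrC.
  have -> : Phi = (h \*: (atan \o (fun y => u y / h))) * v + (4 * h * lam * e) \*: id.
    by apply/funext => y; rewrite /Phi !fctE.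
  apply: is_derive_eq; rewrite /phi /GRing.scale/=.
  rewrite -[h *: atan _]/(h * atan (u x / h)).
  have : 1 + (u x / h) ^+ 2 != 0 by rewrite lt0r_neq0// ltr_wpDr ?sqr_ge0.
  by set w := 1 + (u x / h) ^+ 2 => w0; field; rewrite h0 w0.
have cu : continuous u by move=> x; apply: is_derive_cont (du x).
have cv : continuous v.
  move=> x; have := dv x.
  by case=> dF _; apply/differentiable_continuous/derivable1_diffP.
have cvgX2 (g : R -> R) (x : R) : {for x, continuous g} ->
    (fun y => g y ^+ 2) @ x --> g x ^+ 2.
  by move=> cg; rewrite expr2; under eq_fun do rewrite expr2; exact: cvgM.
have cphi : continuous phi.
  have cuh x : (fun y => u y / h) @ x --> u x / h by apply: cvgMl; exact: cu.
  move=> x; apply: cvgD; last exact: cvg_cst.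
  apply: cvgD.
    apply: cvgM; first by apply: cvgX2; exact: cv.
    apply: cvgV; first by rewrite lt0r_neq0// ltr_wpDr ?sqr_ge0.
    by apply: cvgD; [exact: cvg_cst|apply: (cvgX2 (fun y => u y / h)); exact: cuh].
  apply: cvgM.
    apply: cvgMr; apply: (@cvg_comp _ _ _ _ atan) (cuh x) _.
    exact: continuous_atan.
  apply: cvgM; last exact: cu.
  by apply: cvgB; [apply: cvgX2; exact: cvg_id|exact: cvg_cst].
have atan2 (y : R) : `|atan y| <= 2.
  rewrite ler_norml; have := atan_gtNpi2 y; have := atan_ltpi2 y; have := pihalf_lt2 R.
  by move=> *; apply/andP; split; lra.
have ub x : I x -> `|u x| <= 2 * e.
  move=> xI; rewrite -(@ler_pXn2r _ 2) ?nnegrE ?mulr_ge0 ?(ltW ep)//.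
  have -> : (2 * e) ^+ 2 = 4 * e ^+ 2 by ring.
  by rewrite e2 real_normK ?num_real// u_le_energy.
have vb x : I x -> `|v x| <= 2 * rho * e.
  move=> xI; rewrite -(@ler_pXn2r _ 2) ?nnegrE ?mulr_ge0 ?(ltW ep) ?(ltW r0)//.
  have -> : (2 * rho * e) ^+ 2 = 4 * (rho ^+ 2 * e ^+ 2) by ring.
  rewrite real_normK ?num_real// e2 r2 (le_trans (v_le_energy xI))//.
  by have := mulr_gt0 L0 e0p; lra.
have phib x : I x -> v x ^+ 2 / (1 + (u x / h) ^+ 2) <= phi x.
  move=> xI; rewrite /phi -addrA lerDl.
  have : `|h * atan (u x / h) * ((x ^+ 2 - lam) * u x)| <= 4 * h * lam * e.
    rewrite (normrM (h * atan _)) (normrM h) (normrM (x ^+ 2 - lam)) (gtr0_norm hp).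
    have -> : 4 * h * lam * e = (h * 2) * (lam * (2 * e)) by ring.
    apply: ler_pM; rewrite ?mulr_ge0 ?(ltW hp)//; first by rewrite ler_wpM2l ?(ltW hp).
    apply: ler_pM => //; last exact: ub.
    have := itv_radius xI; have := sqr_ge0 x => x0 xl.
    by rewrite ler_norml; apply/andP; split; lra.
  by rewrite ler_norml => /andP[+ _]; lra.
have k0 : 0 <= 16 / (lam * e0) by rewrite divr_ge0 ?ler0n// ltW// mulr_gt0.
(* Where u^2 >= h^2 the last term already exceeds 1. Elsewhere h^2 <= e0 / 2 and [energy_ge] give
   v^2 >= lam e0 / 8, while 1 + (u / h)^2 <= 2, so the first term does. *)
have key x : I x -> \1_S x <= 16 / (lam * e0) * phi x +
    (h ^+ 2)^-1 * ((fun y => u y ^+ 2) \_ S) x.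
  move=> xI; have w0 : 0 <= v x ^+ 2 / (1 + (u x / h) ^+ 2).
    by rewrite divr_ge0 ?sqr_ge0// addr_ge0 ?sqr_ge0.
  have p0 : 0 <= 16 / (lam * e0) * phi x.
    by rewrite mulr_ge0 ?(le_trans w0 (phib _ xI)).
  rewrite patchE indicE; case: ifPn => xS; last by rewrite mulr0 addr0.
  have [hu|hu] := leP (h ^+ 2) (u x ^+ 2).
    by rewrite ler_wpDl// mulrC ler_pdivlMr ?exprn_gt0// mul1r.
  have q0 : 0 <= (h ^+ 2)^-1 * u x ^+ 2.
    by apply: mulr_ge0; [rewrite invr_ge0|]; exact: sqr_ge0.
  rewrite ler_wpDr//.
  apply: (@le_trans _ _ (16 / (lam * e0) * (v x ^+ 2 / (1 + (u x / h) ^+ 2)))); last first.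
    exact: ler_wpM2l (phib _ xI).
  have uh : (u x / h) ^+ 2 <= 1.
    by rewrite expr_div_n ler_pdivrMr ?exprn_gt0// mul1r ltW.
  have xl := itv_radius xI.
  have := energy_ge (x := x); rewrite (le_lt_trans xl); last by lra.
  move=> /(_ isT) Hv.
  have hh : h ^+ 2 <= e0 / 2 by rewrite hE exprMn e2; nra.
  have Hv2 : lam * e0 / 8 <= v x ^+ 2.
    apply: le_trans Hv; apply: le_trans (_ : (lam / 4) * (e0 / 2) <= _); first by lra.
    by apply: ler_pM; lra.
  have -> : 16 / (lam * e0) * (v x ^+ 2 / (1 + (u x / h) ^+ 2)) =
    (16 * v x ^+ 2) / (lam * e0 * (1 + (u x / h) ^+ 2)).
    have : 1 + (u x / h) ^+ 2 != 0 by rewrite lt0r_neq0// ltr_wpDr ?sqr_ge0.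
    by set w := 1 + (u x / h) ^+ 2 => wn0; field; rewrite wn0 !lt0r_neq0.
  have p1 : 0 < 1 + (u x / h) ^+ 2 by rewrite ltr_wpDr ?sqr_ge0.
  rewrite ler_pdivlMr ?mulr_gt0// mul1r.
  apply: le_trans (_ : lam * e0 * 2 <= _); last by lra.
  by rewrite ler_pM2l ?mulr_gt0//; lra.
have Iphi : \int[leb R]_(x in I) phi x <= 8 * h * rho * e + 8 * h * lam * e * rho.
  rewrite Rintegral_leb; [|exact: measurable_itv|exact: continuous_measurable_fun].
  rewrite (Rintegral_FTC rr dPhi cphi) /Phi.
  have rI : I rho by rewrite /I /= in_itv/= rr lexx.
  have nrI : I (- rho) by rewrite /I /= in_itv/= rr lexx.
  have B x : I x -> `|h * atan (u x / h) * v x| <= 4 * h * rho * e.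
    move=> xI; rewrite (normrM (h * atan _)) (normrM h) (gtr0_norm hp).
    have -> : 4 * h * rho * e = (h * 2) * (2 * rho * e) by ring.
    by apply: ler_pM; rewrite ?mulr_ge0 ?(ltW hp) ?vb// ler_wpM2l ?(ltW hp).
  have := B _ rI; have := B _ nrI; rewrite !ler_norml => /andP[? ?] /andP[? ?].
  lra.
have iS : (leb R).-integrable I (EFin \o (\1_S : _ -> R)).
  apply: (@integrableS _ _ _ _ setT) => //; apply: integrable_indic_leb => //.
  by apply: (@le_lt_trans _ _ (leb R I)); [apply: le_measure; rewrite ?inE|rewrite lebI ltry].
have iphi : (leb R).-integrable I (EFin \o phi).
  apply: integrable_leb; [exact: measurable_itv|exact: continuous_measurable_fun|].
  apply: continuous_compact_integrable; first exact: segment_compact.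
  exact: continuous_subspaceT.
have iu : (leb R).-integrable I (EFin \o ((fun y => u y ^+ 2) \_ S)).
  apply: (@integrableS _ _ _ _ setT) => //.
  rewrite -restrict_EFin; apply/(integrable_mkcond _ mS).
  by apply: (@integrableS _ _ _ _ setT) => //; have [_] := su.
have : \int[leb R]_(x in I) \1_S x <= \int[leb R]_(x in I) (16 / (lam * e0) * phi x +
    (h ^+ 2)^-1 * ((fun y => u y ^+ 2) \_ S) x).
  apply: le_Rintegral => //.
  have := integrableD mI (integrableZl mI (16 / (lam * e0)) iphi)
      (integrableZl mI (h ^+ 2)^-1 iu).
  exact: eq_integrable.
rewrite RintegralD//; last 2 first.
  by have := integrableZl mI (16 / (lam * e0)) iphi; exact: eq_integrable.
  by have := integrableZl mI (h ^+ 2)^-1 iu; exact: eq_integrable.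
rewrite !RintegralZl// -Rintegral_mkcondr setIidr//.
rewrite {1}/Rintegral integral_indic// setIidl//.
set X := \int[leb R]_(x in S) _; set m := fine _ => H.
(* The integral of [phi] contributes 128 theta rho (1 / lam + 1), and lam >= 1 doubles 128. *)
have {}H : m <= 256 * theta * rho + (h ^+ 2)^-1 * X.
  apply: le_trans H _; rewrite lerD2r.
  apply: le_trans (_ : 16 / (lam * e0) * (8 * h * rho * e + 8 * h * lam * e * rho) <= _).
    by rewrite ler_wpM2l.
  have -> : 16 / (lam * e0) * (8 * h * rho * e + 8 * h * lam * e * rho) =
    128 * theta * rho * (lam^-1 + 1).
    by rewrite -e2 hE; field; rewrite !lt0r_neq0.
  have : lam^-1 <= 1 by rewrite invf_le1.
  have := mulr_gt0 th0 r0; nra.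
have -> : theta ^+ 2 * e0 = h ^+ 2 by rewrite hE exprMn e2.
have hh : 0 < h ^+ 2 by rewrite exprn_gt0.
rewrite -ler_pdivlMl// lerBlDl; exact: H.
Qed.

End OscillatorEigenfunction.

(** * Lower density and observed Hermite functions *)

Section LowerDensity.
Context {R : realType}.
Implicit Types omega : set (lebR R).

Lemma leb_cut_le omega (r : R) : measurable omega -> 0 <= r ->
  (leb R (omega `&` `[(- r)%R, r]%classic) <= (2 * r)%:E)%E.
Proof.
move=> mo r0; have -> : (2 * r)%:E = leb R (`[(- r), r]%classic : set (lebR R)).
  by rewrite leb_itv; [congr EFin; ring|rewrite (@le_trans _ _ 0)// oppr_le0].
apply: le_measure; rewrite ?inE; last exact: subIsetr.
- by apply: measurableI => //; exact: measurable_itv_lebR.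
- exact: measurable_itv_lebR.
Qed.

Lemma leb_cut_fin omega (r : R) : measurable omega -> 0 <= r ->
  leb R (omega `&` `[(- r)%R, r]%classic) \is a fin_num.
Proof.
move=> mo r0; rewrite ge0_fin_numE//; apply: le_lt_trans (leb_cut_le mo r0) _.
exact: ltry.
Qed.

Lemma lower_density_ratio omega (r : R) : measurable omega -> 0 < r ->
  (leb R (omega `&` `[(- r)%R, r]%classic) / leb R `[(- r)%R, r]%classic)%E =
  (fine (leb R (omega `&` `[(- r)%R, r]%classic)) / (2 * r))%:E.
Proof.
move=> mo r0; rewrite leb_itv; last by rewrite (@le_trans _ _ 0) ?oppr_le0// ltW.
have -> : r - - r = 2 * r by ring.
rewrite inver mulf_eq0 pnatr_eq0 /= (gt_eqF r0) EFinM.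
by rewrite fineK//; exact: leb_cut_fin (ltW r0).
Qed.

(** The extended-real lower limit becomes a linear lower bound for all large radii, the form in
    which both implications of the theorem use the density. *)
Lemma lower_density_gt0P omega : measurable omega ->
  (0 < lower_density omega)%E <->
  exists kappa r0 : R, [/\ 0 < kappa, 0 < r0 & forall r, r0 < r ->
    kappa * r <= fine (leb R (omega `&` `[(- r)%R, r]%classic))].
Proof.
move=> mo; split.
  rewrite /lower_density /limf_einf oppe_gt0 => /ereal_inf_lt[_ /= [V [M [Mr MV]] <-]] supV.
  have [k k0 kV] : exists2 k : R, 0 < k & forall r, V r -> (k%:E <=
      leb R (omega `&` `[(- r)%R, r]%classic) / leb R `[(- r)%R, r]%classic)%E.
    move: supV; set s := ereal_sup _ => s0.
    have H r : V r -> (- s <=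
        leb R (omega `&` `[(- r)%R, r]%classic) / leb R `[(- r)%R, r]%classic)%E.
      by move=> Vr; rewrite leeNl; apply: ereal_sup_ubound; exists r.
    case: s s0 H => [k| //|] k0 H.
      by exists (- k) => //; rewrite oppr_gt0 -lte_fin.
    (* Here the supremum is -oo, so every real number bounds the ratio from below and 1 is
       arbitrary. *)
    by exists 1 => // r /H; apply: le_trans; rewrite leey.
  exists (2 * k), (Num.max 1 M); split; first by rewrite mulr_gt0.
    by rewrite lt_max ltr01.
  move=> r; rewrite gt_max => /andP[r1 rM].
  have r0 : 0 < r by exact: lt_trans ltr01 r1.
  have := kV _ (MV _ rM); rewrite lower_density_ratio// lee_fin.
  rewrite ler_pdivlMr ?mulr_gt0//; apply: le_trans.
  by rewrite le_eqVlt; apply/orP; left; apply/eqP; ring.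
move=> [k [r0 [k0 r00 H]]]; rewrite /lower_density /limf_einf oppe_gt0.
apply: (@le_lt_trans _ _ (- (k / 2)%:E)%E); last first.
  by rewrite -EFinN lte_fin oppr_lt0 divr_gt0.
set V := [set r | r0 < r].
apply: le_trans (_ : ereal_sup ((\- (fun r : R => (leb R (omega `&` `[(- r)%R, r]%classic)
                   / leb R `[(- r)%R, r]%classic)%E))%E @` V) <= _)%E.
  by apply: ereal_inf_lbound; exists V => //; exists r0; split => //; exact: num_real.
apply: ub_ereal_sup => _ [r Vr <-]; have rp : 0 < r by exact: lt_trans Vr.
rewrite leeN2 lower_density_ratio// lee_fin ler_pdivlMr ?mulr_gt0//.
apply: le_trans (H _ Vr).
by rewrite le_eqVlt; apply/orP; left; apply/eqP; field.
Qed.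

End LowerDensity.

(** * Hermite functions observed from a set of positive lower density *)

Section HermiteObservation.
Context {R : realType}.
Implicit Types omega : set (lebR R).

(** The mass bound is uniform in n: the small amplitude e0, of order at least 1 / rho, is
    compensated by a set whose measure is proportional to rho. *)
Lemma hermite_mass (k : R) : 0 < k -> k <= 1 -> exists2 c : R, 0 < c &
  forall n (S : set (lebR R)), measurable S ->
  S `<=` `[(- turning_radius (hermite_lam n)), turning_radius (hermite_lam n)]%classic ->
  k * turning_radius (hermite_lam n) <= fine (leb R S) ->
  c <= \int[leb R]_(x in S) (hermite_fun n x ^+ 2).
Proof.
(* With this t the exceptional measure 256 t rho is k rho / 2, half of the assumed measure of S. The
   bound 24 rho e0 >= 1 then yields t^2 k / 48. *)
move=> k0 k1; pose t := k / 512; have t0 : 0 < t by rewrite divr_gt0 ?ltr0n.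
have t2 : t ^+ 2 <= 2^-1.
  have t1 : t <= 2^-1 by rewrite /t; lra.
  by rewrite expr2 -[leRHS]mulr1; apply: ler_pM; rewrite ?(ltW t0)//; lra.
exists (t ^+ 2 * k / 48) => [|n S mS SI kS].
  by rewrite divr_gt0 ?ltr0n// mulr_gt0// exprn_gt0.
have l1 : 1 <= hermite_lam n :> R by rewrite /hermite_lam natrD lerDr.
have su := @sqint_hermite R n; have sx := @sqint_Xhermite R n.
have u1 : ip (leb R) (hermite_fun n) (hermite_fun n) = 1 by rewrite ip_hermite eqxx.
have xu : ip (leb R) (fun x => x * hermite_fun n x) (fun x => x * hermite_fun n x) =
    hermite_lam n / 2.
  by rewrite hermite_moment2 /hermite_lam natrD natrM; field.
have du := @is_derive_hermite R n; have dv := @is_derive_dhermite R n.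
apply: le_trans (eigenfunction_mass_set du dv l1 su sx u1 xu t0 t2 mS SI).
have := energy0_lower du dv l1 su sx u1 xu; move: SI kS (turning_radius_gt0 l1).
move: (turning_radius _) (energy0 _ _ _) => rho e0 _ kS r0 e0l.
have -> : t ^+ 2 * k / 48 = t ^+ 2 * (k / 48) by ring.
rewrite -mulrA ler_wpM2l ?sqr_ge0//.
apply: (@le_trans _ _ (e0 * (k * rho / 2))); first by nra.
have e00 : 0 < e0 by rewrite -(pmulr_rgt0 _ r0); nra.
by rewrite ler_wpM2l ?(ltW e00)// /t; lra.
Qed.

Lemma hermite_zeros_null n : leb R [set x : lebR R | hermite_fun n x = 0] = 0%E.
Proof.
pose Z : set R := [set x | root (HP n : {poly R}) x].
have -> : [set x : lebR R | hermite_fun n x = 0] = Z.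
  apply/seteqP; split => x /=; rewrite hermite_funE /pgauss hornerZ /root.
    move=> /eqP; rewrite mulf_eq0 (gt_eqF (expR_gt0 _)) orbF.
    by rewrite mulf_eq0 (gt_eqF (hcoef_gt0 n)).
  by move=> /eqP ->; rewrite mulr0 mul0r.
have HP0 : (HP n : {poly R}) != 0.
  apply/eqP => H; have := @gint_HP R n n; rewrite H mul0r -(scale0r 0) gintZ mul0r eqxx mul1r.
  by move=> /eqP; rewrite eq_sym (gt_eqF (hnorm_gt0 n)).
have finZ : finite_set Z.
  apply: contrapT => /(@infinite_set_fset _ _ (size (HP n : {poly R})))[B BZ].
  rewrite leqNgt max_poly_roots//; first by apply/allP => x xB; exact: BZ.
  exact: finmap.fset_uniq.
have := @countable_lebesgue_measure0 R Z (finite_set_countable finZ).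
by [].
Qed.

Lemma hermite_pos omega n : measurable omega -> leb R omega != 0%E ->
  0 < \int[leb R]_(x in omega) (hermite_fun n x ^+ 2).
Proof.
move=> mo o0; rewrite lt_neqAle Rintegral_ge0 ?andbT; last by move=> x _; exact: sqr_ge0.
apply/eqP => /esym I0.
have mf : measurable_fun (setT : set (lebR R)) (hermite_fun n).
  exact: sqint_measurable (sqint_hermite n).
have ih : (leb R).-integrable omega (EFin \o (fun x => hermite_fun n x ^+ 2)).
  by apply: (@integrableS _ _ _ _ setT) => //; exact: (sqint_hermite n).2.
have : (\int[leb R]_(x in omega) `|(hermite_fun n x ^+ 2)%:E| = 0)%E.
  rewrite (eq_integral (fun x : lebR R => (hermite_fun n x ^+ 2)%:E)); last first.
    by move=> x _; rewrite gee0_abs// lee_fin sqr_ge0.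
  by rewrite -(fineK (integrable_fin_num _ ih))//; move: I0; rewrite /Rintegral => ->.
move/(ae_eq_integral_abs (leb R) mo (measurable_int _ ih)) => [N [mN N0 sN]].
move/eqP: o0; apply.
pose Z := [set x : lebR R | hermite_fun n x = 0].
have mZ : measurable Z.
  rewrite (_ : Z = hermite_fun n @^-1` [set 0]); first by rewrite -[X in measurable X]setTI; exact: mf.
  by apply/seteqP; split.
have sub : omega `<=` N `|` Z.
  move=> x ox; have [xN|xN] := pselect (N x); [by left|right].
  have : ~ ~ (omega x -> (EFin \o (fun x => hermite_fun n x ^+ 2)) x = 0%E).
    by move=> H; apply: xN; apply: sN.
  move/contrapT => /(_ ox) /= [] /eqP; rewrite sqrf_eq0 => /eqP; exact.
apply/eqP; rewrite -measure_le0; apply: le_trans (_ : leb R (N `|` Z) <= _)%E.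
  by apply: le_measure; rewrite ?inE//; exact: measurableU.
apply: (le_trans (measureU2 (leb R) mN mZ)).
by rewrite -[leRHS]adde0; apply: leeD; rewrite le_eqVlt; apply/orP; left; apply/eqP;
  [exact: N0|exact: hermite_zeros_null].
Qed.

(** The density bound applies as soon as the turning radius exceeds [r0]. The finitely many other n
    are handled by [hermite_pos]: omega is not null, whereas the zeros of psi_n are. *)
Lemma hermite_observed omega : measurable omega -> (0 < lower_density omega)%E ->
  exists2 c : R, 0 < c & forall n, c <= \int[leb R]_(x in omega) (hermite_fun n x ^+ 2).
Proof.
move=> mo /(lower_density_gt0P mo)[k [r0 [k0 r00 H]]].
pose k' := Num.min k 1.
have k'0 : 0 < k' by rewrite lt_min k0 ltr01.
have k'1 : k' <= 1 by rewrite ge_min lexx orbT.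
have [c c0 Hc] := hermite_mass k'0 k'1.
have big n : r0 < turning_radius (hermite_lam n) ->
    c <= \int[leb R]_(x in omega) (hermite_fun n x ^+ 2).
  move=> rn; pose r := turning_radius (hermite_lam n : R).
  have rp : 0 < r by exact: lt_trans rn.
  have mS : measurable (omega `&` `[(- r)%R, r]%classic).
    by apply: measurableI => //; exact: measurable_itv_lebR.
  have : c <= \int[leb R]_(x in omega `&` `[(- r)%R, r]%classic) (hermite_fun n x ^+ 2).
    apply: Hc => //.
    apply: le_trans (H _ rn); rewrite ler_wpM2r ?(ltW rp)//.
    by rewrite ge_min lexx.
  move=> /le_trans; apply; rewrite /Rintegral fine_le//.
  - apply: integrable_fin_num => //.
    by apply: (@integrableS _ _ _ _ setT) => //; exact: (sqint_hermite n).2.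
  - apply: integrable_fin_num => //.
    by apply: (@integrableS _ _ _ _ setT) => //; exact: (sqint_hermite n).2.
  - apply: ge0_subset_integral => //; last by move=> x _; rewrite lee_fin sqr_ge0.
    apply/measurable_EFinP/measurable_funX/measurable_funTS.
    exact: sqint_measurable (sqint_hermite n).
have o0 : leb R omega != 0%E.
  apply/eqP => o0; have := H (r0 + 1); rewrite ltrDl ltr01 => /(_ isT).
  rewrite (_ : leb R _ = 0%E); last first.
    apply/eqP; rewrite -measure_le0 -o0; apply: le_measure; rewrite ?inE//.
    by apply: measurableI => //; exact: measurable_itv_lebR.
  by rewrite /= leNgt mulr_gt0// addr_gt0.
have [N HN] : exists N, forall n, (N <= n)%N -> r0 < turning_radius (hermite_lam n).
  exists (Num.bound (r0 ^+ 2)) => n Nn.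
  rewrite /turning_radius -(@ltr_pXn2r _ 2) ?nnegrE ?sqrtr_ge0 ?(ltW r00)//.
  have l1 : 1 <= hermite_lam n :> R by rewrite /hermite_lam natrD lerDr.
  rewrite sqr_sqrtr; last by rewrite mulr_ge0// (le_trans _ l1).
  have := archi_boundP (sqr_ge0 r0).
  have : (Num.bound (r0 ^+ 2))%:R <= n%:R :> R by rewrite ler_nat.
  by rewrite /hermite_lam natrD natrM; lra.
have small M : exists2 c' : R, 0 < c' & forall n, (n < M)%N ->
    c' <= \int[leb R]_(x in omega) (hermite_fun n x ^+ 2).
  elim: M => [|M [c' c'0 IH]]; first by exists 1.
  exists (Num.min c' (\int[leb R]_(x in omega) (hermite_fun M x ^+ 2))).
    by rewrite lt_min c'0 hermite_pos.
  move=> n; rewrite ltnS leq_eqVlt => /orP[/eqP ->|nM]; first by rewrite ge_min lexx orbT.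
  by rewrite ge_min IH.
have [c' c'0 Hc'] := small N.
exists (Num.min c c'); first by rewrite lt_min c0.
move=> n; have [nN|Nn] := ltnP n N; first by rewrite ge_min Hc' ?orbT.
by rewrite ge_min big// HN.
Qed.

End HermiteObservation.

(** * Christoffel functions *)

Section Christoffel.
Context {R : realType}.
Local Notation mu := (@lebesgue_measure R).

Definition christoffel_poly N : {poly R} := \sum_(n < N) (hnorm n)^-1 *: (HP n * HP n).

(* Christoffel-Darboux: [K' = - sqrt (2 (N + 1)) psi_N psi_(N+1)] for
   [K = \sum_(n <= N) psi_n ^ 2], written for the polynomial parts. *)
Lemma christoffel_deriv N :
  (christoffel_poly N.+1)^`() - (2 * 1) *: ('X * christoffel_poly N.+1) =
  - ((hnorm N)^-1 *: (HP N * HP N.+1)).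
Proof.
rewrite mulr1; elim: N => [|N IH].
  rewrite /christoffel_poly big_ord1 derivZ HPS derivM.
  have -> : (HP 0)^`() = 0 :> {poly R} by rewrite /= -polyC1 derivC.
  by rewrite /= -!mul_polyC; ring.
have h0 := lt0r_neq0 (@hnorm_gt0 R N).
have -> : christoffel_poly N.+2 =
    christoffel_poly N.+1 + (hnorm N.+1)^-1 *: (HP N.+1 * HP N.+1).
  by rewrite /christoffel_poly big_ord_recr.
rewrite derivD (mulrDr 'X) (scalerDr 2) opprD addrACA IH.
have Hd : (HP N.+1)^`() = (2 * N.+1%:R) *: HP N :> {poly R} by rewrite HP_deriv.
have Hr : HP N.+2 = 2 *: ('X * HP N.+1) - (2 * N.+1%:R) *: HP N :> {poly R}.
  by rewrite (HPS N.+1) Hd.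
rewrite derivZ derivM Hd Hr.
have -> : (hnorm N)^-1 = (hnorm N.+1)^-1 * (2 * N.+1%:R) :> R.
  by rewrite hnormS (invfM (2 * N.+1%:R)) mulrAC mulVf ?mul1r// mulf_neq0// pnatr_eq0.
by move: (HP N.+1) (HP N) => a b; rewrite -!mul_polyC !polyCM; ring.
Qed.

Definition christoffel N (x : R) : R := \sum_(n < N) hermite_fun n x ^+ 2.

Lemma hermite_fun2 n (x : R) :
  hermite_fun n x ^+ 2 = pgauss ((hnorm n)^-1 *: (HP n * HP n)) 1 x.
Proof.
rewrite expr2 hermite_funE pgaussM -scalerAl -scalerAr scalerA -expr2 hcoef2.
by congr pgauss; field.
Qed.

Lemma christoffelE N : christoffel N = pgauss (christoffel_poly N) 1.
Proof.
apply/funext => x; rewrite /christoffel /pgauss /christoffel_poly horner_sum mulr_suml.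
by apply: eq_bigr => n _; rewrite hermite_fun2.
Qed.

Lemma Rintegral_hermite2_le (n : nat) (a b : R) :
  \int[mu]_(x in `[a, b]) (hermite_fun n x ^+ 2) <= 1.
Proof.
apply: (@le_trans _ _ (ip (leb R) (hermite_fun n) (hermite_fun n))); last first.
  by rewrite ip_hermite eqxx.
rewrite ipE.
have mf : measurable_fun (setT : set R) (fun x : R => hermite_fun n x ^+ 2).
  under eq_fun do rewrite hermite_fun2; exact: measurable_pgauss.
rewrite Rintegral_leb//.
have ih : mu.-integrable setT (EFin \o (fun x : R => hermite_fun n x ^+ 2)).
  have -> : (fun x : R => hermite_fun n x ^+ 2) = pgauss ((hnorm n)^-1 *: (HP n * HP n)) 1.
    by apply/funext => x; rewrite hermite_fun2.
  exact: integrable_pgauss.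
rewrite /Rintegral fine_le//.
- apply: integrable_fin_num => //.
  by apply: (@integrableS _ _ _ _ setT).
- exact: integrable_fin_num.
- apply: ge0_subset_integral => //; last by move=> x _; rewrite lee_fin sqr_ge0.
  exact/measurable_EFinP.
Qed.

(** For K the sum of the first N + 1 squares, -K' = s psi_N psi_(N+1) with s = sqrt (2 (N + 1)),
    hence -K' <= s / 2 (psi_N^2 + psi_(N+1)^2). Since K vanishes at infinity, integrating from x
    bounds K by s. *)
Lemma christoffel_le N (x : R) : christoffel N x <= Num.sqrt (2 * N%:R).
Proof.
case: N => [|N]; first by rewrite /christoffel big_ord0 sqrtr_ge0.
set s := Num.sqrt _; have s0 : 0 < s by rewrite sqrtr_gt0 mulr_gt0// ltr0n.
have s2 : s ^+ 2 = 2 * N.+1%:R by rewrite sqr_sqrtr// mulr_ge0.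
pose K := christoffel N.+1.
pose k := pgauss (christoffel_poly N.+1)^`() 1.
have KE : K = pgauss (christoffel_poly N.+1) 1 by exact: christoffelE.
pose g y : R := s / 2 * (hermite_fun N y ^+ 2) + s / 2 * (hermite_fun N.+1 y ^+ 2).
have dK (y : R) : is_derive y 1 K
    (pgauss ((christoffel_poly N.+1)^`() - (2 * 1) *: ('X * christoffel_poly N.+1)) 1 y).
  by rewrite KE; exact: is_derive_pgauss.
have hN := @hnorm_gt0 R N.
have lower (y : R) : - g y <= pgauss ((christoffel_poly N.+1)^`() -
    (2 * 1) *: ('X * christoffel_poly N.+1)) 1 y.
  rewrite christoffel_deriv /g !hermite_fun2 /pgauss hornerN !hornerZ !hornerM hnormS -s2.
  have := expR_gt0 (- (1 * y ^+ 2)); set E := expR _; set a := (HP N).[y]; set b := (HP N.+1).[y].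
  move=> E0; rewrite mulNr lerN2.
  have -> : s / 2 * ((hnorm N)^-1 * (a * a) * E) + s / 2 * ((s ^+ 2 * hnorm N)^-1 * (b * b) * E)
    = (hnorm N)^-1 * (a * b) * E + (2 * s * hnorm N)^-1 * E * (s * a - b) ^+ 2.
    by field; rewrite !lt0r_neq0.
  rewrite lerDl; apply: mulr_ge0; last exact: sqr_ge0.
  by rewrite mulr_ge0 ?(ltW E0)// invr_ge0 !mulr_ge0// ltW.
have bnd (n : nat) : x <= n%:R -> K x <= K n%:R + s.
  move=> xn; have := Rintegral_FTC xn dK (@continuous_pgauss R _ 1) => FE.
  have imu (m : nat) c : mu.-integrable `[x, n%:R] (EFin \o (fun y => c * hermite_fun m y ^+ 2)).
    have -> : (fun y : R => c * hermite_fun m y ^+ 2) =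
        pgauss (c *: ((hnorm m)^-1 *: (HP m * HP m))) 1.
      by apply/funext => y; rewrite hermite_fun2 /pgauss !hornerZ !mulrA.
    by apply: (@integrableS _ _ _ _ setT) => //; exact: integrable_pgauss.
  have ig : mu.-integrable `[x, n%:R] (EFin \o g).
    have mI : measurable ([set` `[x, n%:R]] : set (measurableTypeR R)) by exact: measurable_itv.
    have := integrableD mI (imu N (s / 2)) (imu N.+1 (s / 2)).
    exact: eq_integrable.
  have gle : \int[mu]_(y in `[x, n%:R]) g y <= s.
    rewrite RintegralD ?RintegralZl//.
    - have := Rintegral_hermite2_le N x n%:R; have := Rintegral_hermite2_le N.+1 x n%:R.
      by nra.
    - by apply: eq_integrable (imu N.+1 1) => // y _; rewrite /= mul1r.
    - by apply: eq_integrable (imu N 1) => // y _; rewrite /= mul1r.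
  have : \int[mu]_(y in `[x, n%:R]) (- g y) <= K n%:R - K x.
    rewrite -FE; apply: le_Rintegral => //.
    - have := integrableN ig; exact: eq_integrable.
    - by apply: (@integrableS _ _ _ _ setT) => //; exact: integrable_pgauss.
  have -> : \int[mu]_(y in `[x, n%:R]) (- g y) = - \int[mu]_(y in `[x, n%:R]) g y.
    rewrite -mulN1r -RintegralZl//; apply: eq_Rintegral => y _; by rewrite mulN1r.
  lra.
have cK : (fun n : nat => K n%:R) @ \oo --> 0.
  by rewrite KE; apply: pgauss_cvg0 => // n; rewrite ger0_norm.
rewrite -subr_le0; apply: (cvg0_ge cK).
exists (Num.bound `|x|) => // n /= xn; rewrite lerBlDr; apply: bnd.
rewrite (le_trans (ler_norm x))// ltW// (lt_le_trans (archi_boundP (normr_ge0 x)))//.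
by rewrite ler_nat.
Qed.

End Christoffel.

Section ObservedDensity.
Context {R : realType}.
Variable omega : set (lebR R).
Hypothesis mo : measurable omega.

(** Chebyshev's inequality: outside [-r, r] the square of psi_n is at most r^-2 (x psi_n)^2. *)
Lemma hermite_cut n (r : R) : 0 < r ->
  \int[leb R]_(x in omega) (hermite_fun n x ^+ 2) <=
  \int[leb R]_(x in omega `&` `[(- r), r]%classic) (hermite_fun n x ^+ 2) +
  (n%:R + 2^-1) / r ^+ 2.
Proof.
move=> r0; set S := omega `&` _.
have mS : measurable S by apply: measurableI => //; exact: measurable_itv_lebR.
have su := @sqint_hermite R n; have sx := @sqint_Xhermite R n.
rewrite Rintegral_mkcond [X in _ <= X + _]Rintegral_mkcond.
rewrite -hermite_moment2 ipE mulrC -RintegralZl//; last exact: sx.2.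
have iE (A : set (lebR R)) : measurable A ->
    (leb R).-integrable setT (EFin \o ((fun x => hermite_fun n x ^+ 2) \_ A)).
  move=> mA; rewrite -restrict_EFin; apply/(integrable_mkcond _ mA).
  by apply: (@integrableS _ _ _ _ setT) => //; exact: su.2.
have iZ : (leb R).-integrable setT (EFin \o (fun x => (r ^+ 2)^-1 * (x * hermite_fun n x) ^+ 2)).
  by have := integrableZl measurableT (r ^+ 2)^-1 sx.2; exact: eq_integrable.
rewrite -RintegralD//; last exact: iE.
apply: le_Rintegral => //; first exact: iE.
  by have := integrableD measurableT (iE _ mS) iZ; exact: eq_integrable.
have pt (x : R) : ((fun x => hermite_fun n x ^+ 2) \_ omega) x <=
    ((fun x => hermite_fun n x ^+ 2) \_ S) x + (r ^+ 2)^-1 * (x * hermite_fun n x) ^+ 2.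
  rewrite !patchE; have := sqr_ge0 (hermite_fun n x) => u0.
  have w0 : 0 <= (r ^+ 2)^-1 * (x * hermite_fun n x) ^+ 2.
    by apply: mulr_ge0; [rewrite invr_ge0|]; exact: sqr_ge0.
  case: (boolP (x \in omega)) => xo; last first.
    by rewrite addr_ge0//; case: ifP.
  case: (boolP (x \in S)) => xS; first by rewrite lerDl.
  have -> : (r ^+ 2)^-1 * (x * hermite_fun n x) ^+ 2 =
    ((r ^+ 2)^-1 * x ^+ 2) * hermite_fun n x ^+ 2 by ring.
  rewrite add0r ler_peMl// mulrC ler_pdivlMr ?exprn_gt0// mul1r.
  rewrite -(real_normK (num_real x)) ler_sqr ?nnegrE ?(ltW r0)//.
  rewrite leNgt; apply/negP => xr; move/negP: xS; apply; rewrite inE; split; first exact: set_mem.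
  by rewrite /= in_itv/= -ler_norml ltW.
by move=> x _; exact: pt.
Qed.

Lemma christoffel_cut N (r : R) : 0 < r ->
  \sum_(n < N) \int[leb R]_(x in omega `&` `[(- r), r]%classic) (hermite_fun n x ^+ 2) <=
  Num.sqrt (2 * N%:R) * fine (leb R (omega `&` `[(- r), r]%classic)).
Proof.
move=> r0; set S := omega `&` _.
have mS : measurable S by apply: measurableI => //; exact: measurable_itv_lebR.
have fS : leb R S \is a fin_num by exact: leb_cut_fin (ltW r0).
have iu n : (leb R).-integrable S (EFin \o (fun x => hermite_fun n x ^+ 2)).
  by apply: (@integrableS _ _ _ _ setT) => //; exact: (@sqint_hermite R n).2.
have ichr M : (leb R).-integrable S (EFin \o christoffel M) /\
    \sum_(n < M) \int[leb R]_(x in S) (hermite_fun n x ^+ 2) = \int[leb R]_(x in S) christoffel M x.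
  elim: M => [|M [iM IH]].
    split; last first.
      rewrite big_ord0 (_ : christoffel 0 = cst 0) ?Rintegral_cst ?mul0r//.
      by apply/funext => x; rewrite /christoffel big_ord0.
    rewrite (_ : _ \o _ = cst 0%E); first exact: integrable0.
    by apply/funext => x; rewrite /christoffel /= big_ord0.
  have E : christoffel M.+1 = (fun x : R => christoffel M x + hermite_fun M x ^+ 2).
    by apply/funext => x; rewrite /christoffel big_ord_recr.
  split; first by rewrite E; have := integrableD mS iM (iu M); exact: eq_integrable.
  by rewrite big_ord_recr/= IH E RintegralD.
have [iN ->] := ichr N.
rewrite -Rintegral_cst//; apply: le_Rintegral => //.
  apply/integrableP; split; first exact: measurable_cst.
  rewrite integral_cst// lte_mul_pinfty// -ge0_fin_numE//.
by move=> x _; exact: christoffel_le.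
Qed.

(** With N of order r^2 the observed mass of the first N functions is of order r^2, and a fixed part
    of it lies in [-r, r]. There the sum of squares is only of order r, so omega must fill a length
    of order r. *)
Lemma density_of_observed (c : R) (N0 : nat) : 0 < c ->
  (forall n, (N0 <= n)%N -> c <= \int[leb R]_(x in omega) (hermite_fun n x ^+ 2)) ->
  (0 < lower_density omega)%E.
Proof.
move=> c0 Hc; apply/(lower_density_gt0P mo).
(* Beyond this radius, r <= r^2 and y >= 2 + 2 N0. Its integer part N then satisfies N >= y / 2 and
   N >= 2 N0, so at least half of the indices below N obey the lower bound. *)
pose r0 := 2 / c * (2 + 2 * N0%:R) + 1 : R.
have r01 : 1 <= r0 by rewrite /r0 lerDr mulr_ge0 ?divr_ge0 ?addr_ge0 ?mulr_ge0 ?(ltW c0).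
have r00 : 0 < r0 by exact: lt_le_trans r01.
pose d := Num.sqrt (c / 2); have d2 : d ^+ 2 = c / 2 by rewrite sqr_sqrtr// divr_ge0// ltW.
have d0 : 0 < d by rewrite sqrtr_gt0 divr_gt0.
exists (c * d / 8), r0; split => // [|r rr].
  by rewrite divr_gt0// mulr_gt0.
have r1 : 1 < r by exact: le_lt_trans rr.
have rp : 0 < r by exact: lt_trans r1.
have r2p : 0 < r ^+ 2 by rewrite exprn_gt0.
(* Chosen so that N <= y makes the tail loss N^2 / (2 r^2) at most c N / 4, half of the observed
   mass c N / 2. *)
pose y := c / 2 * r ^+ 2.
have yN0 : 2 + 2 * N0%:R <= y.
  have H : 2 / c * (2 + 2 * N0%:R) <= r ^+ 2.
    apply: (@le_trans _ _ r); first by rewrite ltW// (lt_trans _ rr)// /r0 ltrDl.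
    by rewrite expr2 ler_peMl// ltW.
  rewrite /y (_ : 2 + _ = c / 2 * (2 / c * (2 + 2 * N0%:R))); last by field; rewrite lt0r_neq0.
  by rewrite ler_wpM2l// divr_ge0// ltW.
pose N := Num.truncn y.
have y0 : 0 <= y by apply: le_trans yN0; rewrite addr_ge0// mulr_ge0.
have /andP[Ny yN] : N%:R <= y < N.+1%:R by exact: truncn_itv.
rewrite -natr1 in yN.
set m := fine _.
have m0 : 0 <= m by exact: fine_ge0.
have N1 : y / 2 <= N%:R by have : 0 <= N0%:R :> R by []; lra.
have N20 : (2 * N0 <= N)%N.
  rewrite -ltnS -(ltr_nat R) -natr1 natrM; lra.
have sumlow : c * N%:R / 2 <= \sum_(n < N) \int[leb R]_(x in omega) (hermite_fun n x ^+ 2).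
  rewrite -(big_mkord xpredT (fun n => \int[leb R]_(x in omega) (hermite_fun n x ^+ 2))).
  rewrite (@big_cat_nat _ _ _ N0)//=; last by rewrite (leq_trans _ N20)// leq_pmull.
  apply: (@le_trans _ _ (\sum_(N0 <= n < N) c)).
    rewrite sumr_const_nat -[c *+ _]mulr_natr natrB; last by rewrite (leq_trans _ N20)// leq_pmull.
    have : 2 * N0%:R <= N%:R :> R by rewrite -natrM ler_nat.
    nra.
  rewrite ler_wpDl//; first by apply: sumr_ge0 => n _; apply: Rintegral_ge0 => x _; exact: sqr_ge0.
  by rewrite !big_nat; apply: ler_sum => n /andP[N0n _]; exact: Hc.
have sumup : \sum_(n < N) \int[leb R]_(x in omega) (hermite_fun n x ^+ 2) <=
    Num.sqrt (2 * N%:R) * m + N%:R ^+ 2 / (2 * r ^+ 2).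
  apply: (@le_trans _ _ (\sum_(n < N)
    (\int[leb R]_(x in omega `&` `[(- r), r]%classic) (hermite_fun n x ^+ 2) +
     (n%:R + 2^-1) / r ^+ 2))).
    by apply: ler_sum => n _; exact: hermite_cut.
  rewrite big_split/= lerD ?christoffel_cut// -mulr_suml le_eqVlt; apply/orP; left; apply/eqP.
  have -> : \sum_(n < N) ((n : nat)%:R + 2^-1) = N%:R ^+ 2 / 2 :> R.
    elim: (N) => [|k IH]; first by rewrite big_ord0 expr0n mul0r.
    by rewrite big_ord_recr/= IH -natr1; field.
  by field; rewrite lt0r_neq0.
set t := Num.sqrt _ in sumup; have t2 : t ^+ 2 = 2 * N%:R by rewrite sqr_sqrtr// mulr_ge0.
have Np : 0 < N%:R :> R by have : 0 <= N0%:R :> R by []; lra.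
have tp : 0 < t by rewrite sqrtr_gt0 mulr_gt0.
have mid : N%:R ^+ 2 / (2 * r ^+ 2) <= c * N%:R / 4.
  rewrite ler_pdivrMr ?mulr_gt0//.
  have -> : c * N%:R / 4 * (2 * r ^+ 2) = N%:R * y by rewrite /y; field.
  by rewrite expr2 ler_wpM2l.
have H1 : c * t ^+ 2 / 8 <= t * m by rewrite t2; lra.
have H2 : c * t / 8 <= m.
  by rewrite -(ler_pM2l tp) (le_trans _ H1)// le_eqVlt; apply/orP; left; apply/eqP; field.
have H3 : d * r <= t.
  rewrite -(@ler_pXn2r _ 2) ?nnegrE ?mulr_ge0 ?(ltW d0) ?(ltW rp) ?(ltW tp)//.
  rewrite exprMn d2 t2 -/y; lra.
by apply: le_trans H2; nra.
Qed.

End ObservedDensity.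

(** * Completeness of the Hermite functions *)

Section ExponentialSeries.
Context d (T : measurableType d) (R : realType).
Variable mu : {measure set T -> \bar R}.

Lemma series_exp_le (y : R) n : `|series (exp_coeff y) n| <= expR `|y|.
Proof.
apply: le_trans (_ : series (exp_coeff `|y|) n <= _).
  rewrite -normed_series_exp_coeff /series /=; exact: ler_norm_sum.
apply: nondecreasing_cvgn_le; last exact: is_cvg_series_exp_coeff.
by apply: nondecreasing_series => k _ _; exact: exp_coeff_ge0.
Qed.

Lemma pow_le_expR (y : R) n : `|y ^+ n| <= n`!%:R * expR `|y|.
Proof.
rewrite normrX mulrC -ler_pdivrMr ?ltr0n ?fact_gt0//.
apply: le_trans (_ : series (exp_coeff `|y|) n.+1 <= _).
  rewrite /series/= big_nat_recr//= lerDr; apply: sumr_ge0 => k _.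
  exact: exp_coeff_ge0.
by rewrite (le_trans (ler_norm _))// (le_trans (series_exp_le _ _))// normr_id.
Qed.

(** The partial sums of the exponential series are dominated by G e^{|p|}, so vanishing moments
    against all powers of p give a vanishing integral against e^p. *)
Lemma Rintegral_expR_eq0 (G p : T -> R) : measurable_fun setT G ->
  measurable_fun setT p ->
  mu.-integrable setT (EFin \o (fun x => G x * expR `|p x|)) ->
  (forall j, \int[mu]_x (G x * p x ^+ j) = 0) ->
  \int[mu]_x (G x * expR (p x)) = 0.
Proof.
move=> mG mp iG Gp.
have mj j : measurable_fun setT (fun x => G x * p x ^+ j).
  by apply: measurable_funM => //; exact: measurable_funX.
have ij j : mu.-integrable setT (EFin \o (fun x => G x * p x ^+ j)).
  have := integrableZl measurableT j`!%:R iG.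
  apply: le_integrable => //; first exact/measurable_EFinP.
  move=> x _ /=; rewrite lee_fin !normrM (ger0_norm (expR_ge0 _)) [leRHS]mulrCA.
  by rewrite ler_wpM2l// (ger0_norm (ler0n _ _)) pow_le_expR.
pose s n x := G x * series (exp_coeff (p x)) n.
have sE n x : s n x = \sum_(k < n) (k`!%:R)^-1 * (G x * p x ^+ k).
  rewrite /s /series/= big_mkord mulr_sumr; apply: eq_bigr => k _.
  by rewrite /exp_coeff /=; ring.
have is_ n : mu.-integrable setT (EFin \o s n) /\ \int[mu]_x s n x = 0.
  elim: n => [|n [IH1 IH2]].
    have -> : s 0%N = cst 0 by apply/funext => x; rewrite sE big_ord0.
    by split; [exact: integrable0|rewrite Rintegral_cst// mul0r].
  have E : s n.+1 = fun x => s n x + (n`!%:R)^-1 * (G x * p x ^+ n).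
    by apply/funext => x; rewrite !sE big_ord_recr.
  have iz : mu.-integrable setT (EFin \o (fun x => (n`!%:R)^-1 * (G x * p x ^+ n))).
    by have := integrableZl measurableT (n`!%:R)^-1 (ij n); exact: eq_integrable.
  rewrite E; split; first by have := integrableD measurableT IH1 iz; exact: eq_integrable.
  by rewrite RintegralD// IH2 RintegralZl// Gp mulr0 addr0.
have mse : measurable_fun setT (fun x => G x * expR (p x)).
  by apply: measurable_funM => //; apply: measurableT_comp.
have := @dominated_convergence _ _ _ mu setT measurableT (fun n => EFin \o s n)
  (EFin \o (fun x => G x * expR (p x))) (EFin \o (fun x => `|G x * expR `|p x| |)).
have H1 n : measurable_fun setT (EFin \o s n) by exact: measurable_int (is_ n).1.
have H2 : measurable_fun setT (EFin \o (fun x => G x * expR (p x))).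
  exact/measurable_EFinP.
have H3 : {ae mu, forall x, setT x ->
    (fun n => (EFin \o s n) x) @ \oo --> (EFin \o (fun x => G x * expR (p x))) x}.
  apply: nearW => x _; apply: cvg_EFin; first exact: nearW.
  by apply: cvgMr; exact: is_cvg_series_exp_coeff.
have H4 : mu.-integrable setT (EFin \o (fun x => `|G x * expR `|p x| |)).
  exact: (integrable_norm iG).
have H5 : {ae mu, forall x n, setT x ->
    (`|(EFin \o s n) x| <= (EFin \o (fun x => (`|G x * expR `|p x| |)%R)) x)%E}.
  apply: nearW => x n _; rewrite /= lee_fin !normrM (ger0_norm (expR_ge0 _)).
  by rewrite ler_wpM2l// series_exp_le.
move=> /(_ H1 H2 H3 H4 H5) [_ _ H].
have E : (fun n => \int[mu]_x ((EFin \o s n) x))%E = cst 0%E.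
  apply/funext => n; have [i1 i2] := is_ n.
  by rewrite -(fineK (integrable_fin_num _ i1))// -[fine _]/(\int[mu]_x s n x) i2.
pose F x := G x * expR (p x).
have {}H : cst 0%E @ \oo --> (\int[mu]_x (EFin \o F) x)%E by rewrite -E.
by rewrite /Rintegral -(cvg_lim _ H)// lim_cst.
Qed.

End ExponentialSeries.

Section ZeroIntegrals.
Context {R : realType}.
Local Notation mu := (leb R).

(** Reduces Lebesgue measurable sets to Borel ones up to a subset of a Borel null set. The monotone
    class argument below reaches Borel sets only. *)
Lemma lebR_borelU (E : set (lebR R)) : measurable E ->
  exists A N F : set R, [/\ measurable (A : set (measurableTypeR R)),
    measurable (F : set (measurableTypeR R)), lebesgue_measure F = 0%E,
    N `<=` F & E = A `|` N].
Proof.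
move=> mE.
have : (completed_algebra_gen (@lebesgue_measure R)).-sigma.-measurable E.
  by rewrite completed_caratheodory_measurable.
rewrite g_sigma_completed_algebra_genE => -[A mA [N [F [mF F0 NF]] <-]].
by exists A, N, F.
Qed.

(** The sets on which f has zero integral form a lambda system containing the half-open intervals, a
    pi system, hence all Borel sets. Null sets then bring in the remaining Lebesgue measurable
    sets. *)
Lemma ae_eq0_of_itv (f : lebR R -> R) : mu.-integrable setT (EFin \o f) ->
  \int[mu]_x f x = 0 ->
  (forall a b : R, a < b -> \int[mu]_(x in `]a, b]%classic) f x = 0) ->
  {ae mu, forall x, f x = 0}.
Proof.
move=> fi f0 fab.
have fiA (A : set (lebR R)) : measurable A -> mu.-integrable A (EFin \o f).
  by move=> mA; apply: (@integrableS _ _ _ _ setT).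
have toE (A : set (lebR R)) : measurable A -> \int[mu]_(x in A) f x = 0 ->
    (\int[mu]_(x in A) (EFin \o f) x = 0)%E.
  by move=> mA A0; rewrite -(fineK (integrable_fin_num _ (fiA _ mA)))// -[fine _]/(\int[mu]_(x in A) f x) A0.
pose H := [set A : set (lebR R) | measurable A /\ (\int[mu]_(x in A) (EFin \o f) x = 0)%E].
have lamH : lambda_system setT H.
  have DH (A B : set (lebR R)) : B `<=` A -> H A -> H B -> H (A `\` B).
    move=> BA [mA A0] [mB B0]; have mD := measurableD mA mB; split => //.
    have := @integral_setU_EFin _ _ _ mu (A `\` B) B f mD mB.
    rewrite setUC setDUK// => E.
    have {}E : (\int[mu]_(x in A) (EFin \o f) x = \int[mu]_(x in A `\` B) (EFin \o f) x +
        \int[mu]_(x in B) (EFin \o f) x)%E.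
      apply: E; last by apply/disj_setPS => x [[_ nB] /nB].
      by apply/measurable_EFinP; exact: measurable_int (fiA _ mA).
    by move: E; rewrite A0 B0 adde0 => <-.
  split => //; first by split => //; exact: toE.
  move=> F ndF HF; split; first by apply: bigcupT_measurable => i; exact: (HF i).1.
  rewrite -eq_bigcup_seqD integral_bigcup//.
  - rewrite eseries0// => i _ _; case: i => [|i]; first exact: (HF 0%N).2.
    by apply: (DH _ _ _ (HF i.+1) (HF i)).2; exact/subsetPset/ndF.
  - exact: trivIset_seqD.
  - by move=> [|i]; [exact: (HF 0%N).1|exact: measurableD (HF i.+1).1 (HF i).1].
  - by rewrite eq_bigcup_seqD; apply: fiA; apply: bigcupT_measurable => i; exact: (HF i).1.
have ocH : @ocitv R `<=` H.
  move=> _ [[a b] _ <-]; have mab : measurable (`]a, b]%classic : set (lebR R)).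
    exact: measurable_itv_lebR.
  split => //; have [ab|ba] := ltP a b; first by apply: toE => //; exact: fab.
  by rewrite set_itv_ge ?integral_set0//= bnd_simp -leNgt.
have borH (A : set R) : measurable (A : set (measurableTypeR R)) -> H A.
  move=> mA; apply: (@lambda_system_subset _ (@ocitv R) (@ocitvI R) setT H lamH ocH) => //.
have zero (E : set (lebR R)) : measurable E -> (\int[mu]_(x in E) (EFin \o f) x = 0)%E.
  move=> mE; have [A [N [F [mA mF F0 NF EAN]]]] := lebR_borelU mE.
  have mA' := measurable_lebR mA; have mF' := measurable_lebR mF.
  have F0' : mu F = 0%E by exact: F0.
  rewrite (negligible_integral mF' mE (fiA _ mE) F0').
  have -> : E `\` F = A `\` F.
    rewrite EAN; apply/seteqP; split => x [].
      by move=> [Ax|Nx] nFx; split => //; exfalso; apply: nFx; exact: NF.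
    by move=> Ax nFx; split => //; left.
  by rewrite -(negligible_integral mF' mA' (fiA _ mA') F0'); exact: (borH _ mA).2.
have : ae_eq mu setT (EFin \o f) (cst 0%E).
  by apply: integral_ae_eq => // E _ mE; rewrite zero// integral0.
by apply: filterS => x /= /(_ I) [].
Qed.

End ZeroIntegrals.

Section StepApproximation.
Context {R : realType}.
Implicit Types v w : R.

Lemma bernoulli_le w m : 0 <= w <= 1 -> 1 - (1 - w) ^+ m <= m%:R * w.
Proof.
move=> /andP[w0 w1]; elim: m => [|m IH]; first by rewrite expr0 subrr mul0r.
have p1 : (1 - w) ^+ m <= 1 by rewrite exprn_ile1// ?subr_ge0// lerBlDr lerDl.
by rewrite exprS -natr1; nra.
Qed.

Lemma bernoulli_inv w m : 0 <= w <= 1 -> (1 - w) ^+ m <= (1 + m%:R * w)^-1.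
Proof.
move=> /andP[w0 w1].
have H : 1 + m%:R * w <= (1 + w) ^+ m.
  elim: m => [|m IH]; first by rewrite mul0r addr0 expr0.
  rewrite exprS -natr1; have : 0 <= m%:R :> R by [].
  by have := sqr_ge0 w; nra.
have d0 : 0 < 1 + m%:R * w by rewrite ltr_pwDl// mulr_ge0.
rewrite -[leRHS]mul1r ler_pdivlMr//.
apply: (@le_trans _ _ ((1 - w) ^+ m * (1 + w) ^+ m)).
  by rewrite ler_wpM2l// exprn_ge0// subr_ge0.
rewrite -exprMn exprn_ile1//; first by nra.
by nra.
Qed.

(* Converges to the indicator of [v > 1/2]; with [v] a Gaussian it is a finite
   combination of Gaussians. *)
Definition step_poly k v : R := 1 - (1 - v ^+ k.+1) ^+ (2 ^ k.+1).

Lemma step_poly_bound k v : 0 <= v <= 1 -> 0 <= step_poly k v <= 2 * v.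
Proof.
move=> /andP[v0 v1].
have vk : 0 <= v ^+ k.+1 <= 1 by rewrite exprn_ge0// exprn_ile1.
have q1 : 0 <= (1 - v ^+ k.+1) ^+ (2 ^ k.+1) <= 1.
  have /andP[a b] := vk.
  by rewrite exprn_ge0 ?subr_ge0// exprn_ile1// ?subr_ge0// lerBlDr lerDl.
have /andP[q0 q2] := q1.
rewrite /step_poly subr_ge0 q2 /=.
have [v2|v2] := leP (2 * v) 1; last by apply: le_trans (ltW v2); rewrite lerBlDr lerDl.
apply: le_trans (bernoulli_le _ vk) _.
rewrite natrX -exprMn exprS ler_piMr ?mulr_ge0//.
by rewrite exprn_ile1// mulr_ge0.
Qed.

Lemma step_poly_cvg0 v : 0 <= v < 2^-1 -> (fun k => step_poly k v) @ \oo --> (0 : R).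
Proof.
move=> /andP[v0 v2]; have v1 : 0 <= v <= 1 by rewrite v0; lra.
apply: (@squeeze_cvgr _ _ _ _ (fun=> 0) (fun k => (2 * v) ^+ k.+1)).
- apply: nearW => k; have /andP[-> _] := step_poly_bound k v1.
  have vk : 0 <= v ^+ k.+1 <= 1 by rewrite exprn_ge0// exprn_ile1//; case/andP: v1.
  by apply: le_trans (bernoulli_le _ vk) _; rewrite natrX -exprMn.
- exact: cvg_cst.
- rewrite (cvg_shiftS (fun k => (2 * v) ^+ k)); apply: cvg_expr.
  by rewrite ger0_norm ?mulr_ge0//; lra.
Qed.

Lemma step_poly_cvg1 v : 2^-1 < v <= 1 -> (fun k => step_poly k v) @ \oo --> (1 : R).
Proof.
move=> /andP[v2 v1].
rewrite -[X in _ --> X]subr0 /step_poly; apply: cvgB; first exact: cvg_cst.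
have v01 : 0 <= v by lra.
apply: (@squeeze_cvgr _ _ _ _ (fun=> 0) (fun k => ((2 * v)^-1) ^+ k.+1)).
- apply: nearW => k.
  have vk : 0 <= v ^+ k.+1 <= 1 by rewrite exprn_ge0// exprn_ile1.
  rewrite exprn_ge0 /=; last by case/andP: vk => _; rewrite subr_ge0.
  apply: le_trans (bernoulli_inv _ vk) _; rewrite natrX -exprMn exprVn.
  have p0 : 0 < (2 * v) ^+ k.+1 by rewrite exprn_gt0//; lra.
  by rewrite lef_pV2 ?posrE// ?lerDr// ltr_wpDl.
- exact: cvg_cst.
- rewrite (cvg_shiftS (fun k => (2 * v)^-1 ^+ k)); apply: cvg_expr.
  rewrite ger0_norm ?invr_ge0 ?mulr_ge0// invf_lt1; last by lra.
  by lra.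
Qed.

End StepApproximation.

(** * A function orthogonal to all Hermite functions vanishes *)

Section HermiteComplete.
Context {R : realType}.
Local Notation mu := (leb R).
Variable g : lebR R -> R.
Hypothesis sg : sqint mu g.
Hypothesis g0 : forall n, ip mu g (hermite_fun n) = 0.
Implicit Types p q : {poly R}.

Let mg : measurable_fun setT g. Proof. exact: sqint_measurable sg. Qed.

Let mpg p a : measurable_fun (setT : set (lebR R)) (pgauss p a).
Proof. by apply: measurable_fun_lebR; exact: measurable_pgauss. Qed.

Let gpD p q a : 0 < a -> ip mu g (pgauss (p + q) a) = ip mu g (pgauss p a) + ip mu g (pgauss q a).
Proof.
move=> a0; rewrite !(ipC mu g) -ipDl//; try exact: sqint_pgauss.
by congr ip; apply/funext => x; rewrite /pgauss hornerD mulrDl.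
Qed.

Let gpZ c p a : 0 < a -> ip mu g (pgauss (c *: p) a) = c * ip mu g (pgauss p a).
Proof.
move=> a0; rewrite !(ipC mu g) -ipZl//; try exact: sqint_pgauss.
by congr ip; apply/funext => x; rewrite /pgauss hornerZ -mulrA.
Qed.

(** Multiplication by x keeps the span of the H_n stable, so orthogonality extends to every
    polynomial times e^{- x^2 / 2}. *)
Let orth_HP p n : ip mu g (pgauss (p * HP n) 2^-1) = 0.
Proof.
have base m : ip mu g (pgauss (HP m) 2^-1) = 0.
  have := g0 m; rewrite hermite_funE gpZ// => /eqP.
  by rewrite mulf_eq0 (gt_eqF (hcoef_gt0 m)) => /eqP.
elim/poly_ind: p n => [|p c IH] n.
  by rewrite mul0r -(scale0r 0) gpZ// mul0r.
rewrite mulrDl gpD// mul_polyC gpZ// base mulr0 addr0 -mulrA.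
case: n => [|n]; first by rewrite HP_rec0 -scalerAr gpZ// IH mulr0.
by rewrite HP_rec mulrDr gpD// -!scalerAr !gpZ// !IH !mulr0 addr0.
Qed.

(** The exponent is changed from a to b by expanding e^{(a - b) x^2}. The dominating function has
    exponent a - |a - b|, which is positive exactly when 0 < b < 2 a. *)
Let orth_step a b : (forall p, ip mu g (pgauss p a) = 0) -> 0 < b -> b < 2 * a ->
  forall p, ip mu g (pgauss p b) = 0.
Proof.
move=> ga b0 b2 p; have a0 : 0 < a by lra.
have := @Rintegral_expR_eq0 _ _ _ mu (fun x => g x * pgauss p a x)
  (fun x : R => (a - b) * x ^+ 2).
have m1 : measurable_fun setT (fun x => g x * pgauss p a x) by exact: measurable_funM.
have m2 : measurable_fun (setT : set (lebR R)) (fun x : R => (a - b) * x ^+ 2).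
  apply: (@measurable_fun_lebR R (fun x => (a - b) * x ^+ 2)).
  by apply: measurable_funM => //; exact: measurable_funX.
have E1 : (fun x : lebR R => g x * pgauss p a x * expR `|(a - b) * x ^+ 2|) =
    (fun x => g x * pgauss p (a - `|a - b|) x).
  apply/funext => x; rewrite /pgauss normrM (ger0_norm (sqr_ge0 _)) -!(mulrA (g x)) -(mulrA p.[x]) -expRD.
  by congr (_ * (_ * expR _)); ring.
have m3 : mu.-integrable setT (EFin \o (fun x : lebR R =>
    g x * pgauss p a x * expR `|(a - b) * x ^+ 2|)).
  rewrite E1; apply: sqint_mul => //; apply: sqint_pgauss.
  by case: (ger0P (a - b)) => _; lra.
have m4 j : \int[mu]_x (g x * pgauss p a x * ((a - b) * x ^+ 2) ^+ j) = 0.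
  rewrite -(ga (p * ((a - b) *: 'X^2) ^+ j)); apply: eq_Rintegral => x _.
  by rewrite /pgauss hornerM horner_exp hornerZ hornerXn; ring.
move=> /(_ m1 m2 m3 m4) <-; apply: eq_Rintegral => x _.
by rewrite /pgauss -!(mulrA (g x)) -(mulrA p.[x]) -expRD; congr (_ * (_ * expR _)); ring.
Qed.

Let orth_gauss b p : 0 < b -> ip mu g (pgauss p b) = 0.
Proof.
move=> b0.
(* A ratio of 3/2 stays below the limit 2 of [orth_step]. Once the exponent exceeds b / 2, a single
   further step reaches b. *)
have H j : forall q, ip mu g (pgauss q (2^-1 * (3 / 2) ^+ j)) = 0.
  elim: j => [|j IH]; first by rewrite expr0 mulr1 => q; rewrite -[q]mulr1; exact: (orth_HP q 0).
  apply: (orth_step IH); first by rewrite mulr_gt0// exprn_gt0.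
  have : 0 < (3 / 2) ^+ j :> R by rewrite exprn_gt0.
  by rewrite exprS; lra.
have H2 j : 1 + j%:R / 2 <= (3 / 2) ^+ j :> R.
  elim: j => [|j IH]; first by rewrite mul0r addr0.
  rewrite exprS -natr1; have : 0 <= j%:R :> R by []; lra.
pose j := Num.bound (2 * b).
have : 2 * b < j%:R by apply: archi_boundP; rewrite mulr_ge0// ltW.
move=> jb; apply: (orth_step (H j)) => //; have := H2 j; lra.
Qed.

Let gauss_trans b y : 0 < b ->
  mu.-integrable setT (EFin \o (fun x : lebR R => g x * expR (- (b * (x - y) ^+ 2)))) /\
  \int[mu]_x (g x * expR (- (b * (x - y) ^+ 2))) = 0.
Proof.
move=> b0.
pose G x := g x * pgauss 1 b x.
have E0 (x : R) : G x * expR (2 * b * y * x) = expR (b * y ^+ 2) * (g x * expR (- (b * (x - y) ^+ 2))).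
  rewrite /G /pgauss hornerC mul1r -(mulrA (g x)) -expRD (mulrCA (expR _) (g x)) -expRD.
  congr (_ * expR _).
  by ring.
have mG : measurable_fun setT G by exact: measurable_funM.
have mp : measurable_fun (setT : set (lebR R)) (fun x : R => 2 * b * y * x).
  by apply: (@measurable_fun_lebR R (fun x => 2 * b * y * x)); exact: measurable_funM.
have iG : mu.-integrable setT (EFin \o (fun x : lebR R => G x * expR `|2 * b * y * x|)).
  have i1 := sqint_mul sg (@sqint_pgauss R 1 (b / 2) (divr_gt0 b0 (ltr0n R 2))).
  (* By 2 b |y x| <= b x^2 / 2 + 2 b y^2, half of the Gaussian decay survives the exponential of the
     linear term. *)
  have i2 := integrableZl measurableT (expR (2 * b * y ^+ 2)) i1.
  apply: (@le_integrable _ _ _ mu setT measurableT _ _ _ _ i2).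
    apply/measurable_EFinP; apply: measurable_funM; first exact: mG.
    by apply: (measurableT_comp (@measurable_expR R)); exact: (measurableT_comp (@normr_measurable R setT) mp).
  have pt (x : R) : `|G x * expR `|2 * b * y * x| | <=
      `|expR (2 * b * y ^+ 2) * (g x * pgauss 1 (b / 2) x)|.
    rewrite /G /pgauss !hornerC !mul1r !normrM -(mulrA `|g x|) (mulrCA _ `|g x|) ler_wpM2l//.
    rewrite !(ger0_norm (expR_ge0 _)) -!expRD ler_expR (gtr0_norm b0) (ger0_norm (ler0n _ 2)).
    have := sqr_ge0 (`|x| - 2 * `|y|); rewrite sqrrB real_normK ?num_real//.
    rewrite exprMn real_normK ?num_real// => H.
    have : 0 <= b / 2 * (x ^+ 2 - `|x| * (2 * `|y|) *+ 2 + 2 ^+ 2 * y ^+ 2).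
      by rewrite mulr_ge0// divr_ge0// ltW.
    by rewrite -mulr_natl; lra.
  by move=> x _; rewrite /= lee_fin; exact: pt.
have Gj j : \int[mu]_x (G x * (2 * b * y * x) ^+ j) = 0.
  rewrite -(orth_gauss (((2 * b * y) *: 'X) ^+ j) b0); apply: eq_Rintegral => x _.
  by rewrite /G /pgauss horner_exp hornerZ hornerX hornerC; ring.
have Z := Rintegral_expR_eq0 mG mp iG Gj.
have iE : mu.-integrable setT (EFin \o (fun x : lebR R => g x * expR (- (b * (x - y) ^+ 2)))).
  have i2 := integrableZl measurableT (expR (- (b * y ^+ 2))) iG.
  apply: (@le_integrable _ _ _ mu setT measurableT _ _ _ _ i2).
    apply/measurable_EFinP; apply: measurable_funM; first exact: mg.
    apply: (@measurable_fun_lebR R (fun x => expR (- (b * (x - y) ^+ 2)))).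
    apply: (measurableT_comp (@measurable_expR R)).
    apply: measurable_funN; apply: measurable_funM => //.
    by apply: measurable_funX; exact: measurable_funB.
  have pt (x : R) : `|g x * expR (- (b * (x - y) ^+ 2))| <=
      `|expR (- (b * y ^+ 2)) * (G x * expR `|2 * b * y * x|)|.
    have -> : g x * expR (- (b * (x - y) ^+ 2)) =
        expR (- (b * y ^+ 2)) * (G x * expR (2 * b * y * x)).
      by rewrite E0 mulrA -expRD addNr expR0 mul1r.
    rewrite !normrM !(ger0_norm (expR_ge0 _)) ler_wpM2l ?expR_ge0//.
    by rewrite ler_wpM2l// ler_expR -!normrM ler_norm.
  by move=> x _; rewrite /= lee_fin; exact: pt.
split; first exact: iE.
have Z2 : \int[mu]_x (expR (b * y ^+ 2) * (g x * expR (- (b * (x - y) ^+ 2)))) = 0.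
  by rewrite -Z; apply: eq_Rintegral => x _; rewrite E0.
have := @RintegralZl _ _ _ mu setT _ (expR (b * y ^+ 2)) measurableT iE; rewrite Z2 => /esym/eqP.
by rewrite mulf_eq0 (gt_eqF (expR_gt0 _)) => /eqP.
Qed.

(** The powers of w are Gaussians with other exponents, which is why all exponents were treated. At
    least one factor w is kept, as g is only known to be square integrable. *)
Let gauss_poly b y m l : 0 < b -> let w x := expR (- (b * (x - y) ^+ 2)) in
  mu.-integrable setT (EFin \o (fun x : lebR R => g x * (w x ^+ l.+1 * (1 - w x) ^+ m))) /\
  \int[mu]_x (g x * (w x ^+ l.+1 * (1 - w x) ^+ m)) = 0.
Proof.
move=> b0 w; elim: m l => [|m IH] l.
  have bl : 0 < b * l.+1%:R by rewrite mulr_gt0.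
  have E : (fun x : lebR R => g x * (w x ^+ l.+1 * (1 - w x) ^+ 0)) =
      (fun x : lebR R => g x * expR (- (b * l.+1%:R * (x - y) ^+ 2))).
    apply/funext => x; rewrite expr0 mulr1 /w -expRM_natl; congr (_ * expR _).
    by ring.
  by rewrite E; exact: gauss_trans.
have E : (fun x : lebR R => g x * (w x ^+ l.+1 * (1 - w x) ^+ m.+1)) =
    (fun x => g x * (w x ^+ l.+1 * (1 - w x) ^+ m) - g x * (w x ^+ l.+2 * (1 - w x) ^+ m)).
  by apply/funext => x; rewrite !exprS; ring.
have [i1 z1] := IH l; have [i2 z2] := IH l.+1.
rewrite E; split; last by rewrite RintegralB// z1 z2 subrr.
have := integrableB measurableT i1 i2; exact: eq_integrable.
Qed.

Let gauss_poly1 b y m : 0 < b -> let w x := expR (- (b * (x - y) ^+ 2)) in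
  mu.-integrable setT (EFin \o (fun x : lebR R => g x * (1 - (1 - w x) ^+ m))) /\
  \int[mu]_x (g x * (1 - (1 - w x) ^+ m)) = 0.
Proof.
move=> b0 w; elim: m => [|m [i1 z1]].
  have E : (fun x : lebR R => g x * (1 - (1 - w x) ^+ 0)) = cst 0.
    by apply/funext => x; rewrite expr0 subrr mulr0.
  by rewrite E; split; [exact: integrable0|rewrite Rintegral_cst// mul0r].
have [i2 z2] := gauss_poly y m 0 b0.
have E : (fun x : lebR R => g x * (1 - (1 - w x) ^+ m.+1)) =
    (fun x => g x * (1 - (1 - w x) ^+ m) + g x * (w x ^+ 1 * (1 - w x) ^+ m)).
  by apply/funext => x; rewrite exprS expr1; ring.
rewrite E; split; last by rewrite RintegralD// z1 z2 addr0.
have := integrableD measurableT i1 i2; exact: eq_integrable.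
Qed.

Let ae_neq (a : R) : {ae mu, forall x : lebR R, x <> a}.
Proof.
exists [set a]; split.
- by apply: measurable_lebR; exact: measurable_set1.
- exact: (@lebesgue_measure_set1 R a).
- by move=> x /= /contrapT.
Qed.

Let gauss_itv y r : 0 < r ->
  \int[mu]_(x in `](y - r), (y + r)]%classic) g x = 0.
Proof.
move=> r0; have r2 : 0 < r ^+ 2 by rewrite exprn_gt0.
have ln20 : 0 < ln 2 :> R by rewrite ln_gt0// ltr1n.
(* This makes w equal to 1/2 exactly at distance r from y, so that [step_poly] tends to the
   indicator of the interval except at its two ends. *)
pose b := ln 2 / r ^+ 2; have b0 : 0 < b by rewrite divr_gt0.
pose w (x : R) := expR (- (b * (x - y) ^+ 2)).
pose I : set (lebR R) := `](y - r), (y + r)]%classic.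
have mI : measurable I by exact: measurable_itv_lebR.
pose f k (x : lebR R) := g x * step_poly k (w x).
have fk k : mu.-integrable setT (EFin \o f k) /\ \int[mu]_x f k x = 0.
  have bk : 0 < b * k.+1%:R by rewrite mulr_gt0.
  have -> : f k = (fun x : lebR R =>
      g x * (1 - (1 - expR (- (b * k.+1%:R * (x - y) ^+ 2))) ^+ (2 ^ k.+1))).
    apply/funext => x; rewrite /f /step_poly /w -expRM_natl.
    by congr (_ * (1 - (1 - expR _) ^+ _)); ring.
  exact: (gauss_poly1 y (2 ^ k.+1) bk).
have w01 x : 0 <= w x <= 1.
  by rewrite expR_ge0/= -expR0 ler_expR oppr_le0 mulr_ge0 ?sqr_ge0// ltW.
have half : 2^-1 = expR (- ln 2) :> R by rewrite expRN lnK// posrE.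
have wlt (x : R) : (2^-1 < w x) = (`|x - y| < r).
  rewrite half /w ltr_expR ltrN2 /b mulrAC ltr_pdivrMr// ltr_pM2l//.
  by rewrite -(real_normK (num_real (x - y))) ltr_pXn2r ?nnegrE// ltW.
have wgt (x : R) : (w x < 2^-1) = (r < `|x - y|).
  rewrite half /w ltr_expR ltrN2 /b mulrAC ltr_pdivlMr// ltr_pM2l//.
  by rewrite -(real_normK (num_real (x - y))) ltr_pXn2r ?nnegrE// ltW.
have sW : sqint mu (pgauss 1 b : lebR R -> R) by exact: sqint_pgauss.
have [iw _] := gauss_trans y b0.
have := @dominated_convergence _ _ _ mu setT measurableT (fun n => EFin \o f n)
  (EFin \o (g \_ I)) (EFin \o (fun x => `|2 * (g x * w x)|)).
have H1 n : measurable_fun setT (EFin \o f n) by exact: measurable_int (fk n).1.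
have H2 : measurable_fun setT (EFin \o (g \_ I)).
  apply/measurable_EFinP/(measurable_restrictT _ mI).
  exact: measurable_funTS.
have H3 : {ae mu, forall x, setT x -> (fun n => (EFin \o f n) x) @ \oo --> (EFin \o (g \_ I)) x}.
  have := ae_neq (y - r); have := ae_neq (y + r); apply: filterS2 => x x1 x2 _.
  apply: cvg_EFin; first exact: nearW.
  have [/[dup] xr|] := ltP (`|x - y|) r.
    rewrite -wlt => wx; rewrite patchE ifT; last first.
      rewrite inE /I /= in_itv/=; move: xr; rewrite ltr_norml => /andP[? ?].
      by apply/andP; split; lra.
    rewrite -[X in _ --> X]mulr1; apply: cvgMr; apply: step_poly_cvg1.
    by rewrite wx /=; case/andP: (w01 x).
  rewrite le_eqVlt => /orP[/eqP xr|/[dup] xr].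
    exfalso; move: xr; case: (ger0P (x - y)) => _ xr.
      by apply: x1; lra.
    by apply: x2; lra.
  rewrite -wgt => wx; rewrite patchE ifF; last first.
    apply/negP; rewrite inE /I /= in_itv/= => /andP[? ?].
    have : `|x - y| <= r by rewrite ler_norml; apply/andP; split; lra.
    by rewrite leNgt xr.
  rewrite -[X in _ --> X](mulr0 (g x)); apply: cvgMr; apply: step_poly_cvg0.
  by rewrite wx andbT; case/andP: (w01 x).
have H4 : mu.-integrable setT (EFin \o (fun x => `|2 * (g x * w x)|)).
  apply: (@integrable_norm _ _ _ mu setT (fun x => 2 * (g x * w x))).
  have := integrableZl measurableT 2 iw; exact: eq_integrable.
have H5 : {ae mu, forall x n, setT x ->
    (`|(EFin \o f n) x| <= (EFin \o (fun x => `|2 * (g x * w x)|%R)) x)%E}.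
  apply: nearW => x n _; rewrite /= lee_fin /f !normrM (ger0_norm (ler0n _ 2)) mulrCA.
  have /andP[s0 s1] := step_poly_bound n (w01 x).
  by rewrite ler_wpM2l// (ger0_norm s0) (ger0_norm (proj1 (andP (w01 x)))).
move=> /(_ H1 H2 H3 H4 H5) [_ _ H].
have E : (fun n => \int[mu]_x ((EFin \o f n) x))%E = cst 0%E.
  apply/funext => n; have [i1 i2] := fk n.
  by rewrite -(fineK (integrable_fin_num _ i1))// -[fine _]/(\int[mu]_x f n x) i2.
have {}H : cst 0%E @ \oo --> (\int[mu]_x (EFin \o (g \_ I)) x)%E by rewrite -E.
by rewrite Rintegral_mkcond /Rintegral -(cvg_lim _ H)// lim_cst.
Qed.

Let itv0 a b : a < b -> \int[mu]_(x in `]a, b]%classic) g x = 0.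
Proof.
move=> ab; have := @gauss_itv ((a + b) / 2) ((b - a) / 2).
rewrite divr_gt0 ?subr_gt0// => /(_ isT).
have -> : (a + b) / 2 - (b - a) / 2 = a by field.
by have -> : (a + b) / 2 + (b - a) / 2 = b by field.
Qed.

(** Cutting to bounded intervals makes g integrable, as [ae_eq0_of_itv] requires. The countably many
    null sets are then united. *)
Lemma hermite_complete : ip mu g g = 0.
Proof.
pose I (M : nat) : set (lebR R) := `](- M%:R), M%:R]%classic.
have mI M : measurable (I M) by exact: measurable_itv_lebR.
have ae0 M : {ae mu, forall x, (g \_ (I M)) x = 0}.
  have lI : (mu (I M) < +oo)%E.
    apply: (@le_lt_trans _ _ (mu (`[(- M%:R), M%:R]%classic : set (lebR R)))).
      apply: le_measure; rewrite ?inE//; first exact: measurable_itv_lebR.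
      by apply: subset_itvr; rewrite bnd_simp.
    by rewrite leb_itv ?ltry// (@le_trans _ _ 0)// oppr_le0.
  have s1 : sqint mu (\1_(I M)).
    apply: sqintP; first exact: measurable_indic.
    rewrite (eq_integral (fun x => (\1_(I M) x)%:E)) ?integral_indic// ?setIT//.
    by move=> x _; rewrite indicE; case: (x \in _); rewrite ?expr1n ?expr0n.
  have E : g \_ (I M) = (fun x => g x * \1_(I M) x).
    by apply/funext => x; rewrite patchE indicE; case: ifP; rewrite ?mulr1 ?mulr0.
  apply: ae_eq0_of_itv.
  - by rewrite E; exact: sqint_mul.
  - rewrite -Rintegral_mkcond; case: M {lI s1 E} => [|M].
      by rewrite /I oppr0 set_itv_ge ?Rintegral_set0// bnd_simp ltxx.
    by apply: itv0; rewrite (@lt_trans _ _ 0)// oppr_lt0.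
  - move=> a b ab; rewrite -Rintegral_mkcondr.
    have -> : `]a, b]%classic `&` I M = `](Num.max a (- M%:R)), (Num.min b M%:R)]%classic :> set (lebR R).
      apply/seteqP; split => x; rewrite /I /= !in_itv/= gt_max le_min.
        by move=> [/andP[-> ->] /andP[-> ->]].
      by move=> /andP[/andP[-> ->] /andP[-> ->]].
    have [h|h] := ltP (Num.max a (- M%:R)) (Num.min b M%:R); first exact: itv0.
    by rewrite set_itv_ge ?Rintegral_set0// bnd_simp -leNgt.
have g_ae : {ae mu, forall x, g x = 0}.
  have : {ae mu, forall x, forall M, (g \_ (I M)) x = 0} by exact: ae_foralln.
  apply: filterS => x /(_ (Num.bound `|x|)); rewrite patchE ifT// inE /I /= in_itv/=.
  have := archi_boundP (normr_ge0 x); rewrite ltr_norml => /andP[-> h]; exact: ltW.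
rewrite -(ip0l mu (fun=> 0)); apply: ae_eq_ip => //; exact: sqint0.
Qed.

End HermiteComplete.

(** * Gliding hump and diagonally dominant systems *)

Section GlidingHump.
Context {R : realType}.
Variable w : nat -> R.
Hypothesis w0 : forall n, 0 <= w n.

(* The [k]-th hump, of height [2 ^ - k], is placed at the first index after the
   previous one where [w < 16 ^ - k]. *)
Fixpoint hump_count n : nat :=
  if n is m.+1 then
    if w m < 16^-1 ^+ hump_count m then (hump_count m).+1 else hump_count m
  else 0.

Definition hump n : R :=
  if w n < 16^-1 ^+ hump_count n then 2^-1 ^+ hump_count n else 0.

Lemma sum_hump N : \sum_(n < N) hump n ^+ 2 = 4 / 3 * (1 - 4^-1 ^+ hump_count N).
Proof.
elim: N => [|N IH]; first by rewrite big_ord0 expr0 subrr mulr0.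
rewrite big_ord_recr/= IH /hump; case: ifP => _; last by rewrite expr0n addr0.
have -> : 2^-1 ^+ hump_count N ^+ 2 = 4^-1 ^+ hump_count N :> R.
  by rewrite -exprM mulnC exprM; congr (_ ^+ _); field.
by rewrite exprS; field.
Qed.

(** Values of w below any threshold occur arbitrarily far out, so the wait for the k-th hump always
    ends. *)
Lemma hump_reached : (forall c N0, 0 < c -> exists2 n, (N0 <= n)%N & w n < c) ->
  forall k, exists n, hump n = 2^-1 ^+ k /\ w n < 16^-1 ^+ k.
Proof.
move=> small k.
have p16 j : 0 < 16^-1 ^+ j :> R by rewrite exprn_gt0// invr_gt0 ltr0n.
have step n : exists m, hump_count m = hump_count n /\ w m < 16^-1 ^+ hump_count n.
  have [m' nm' wm'] := small _ n (p16 (hump_count n)).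
  rewrite -(subnKC nm') in wm'; move: (m' - n)%N wm' => j; clear.
  elim: j n => [|j IH] n; first by rewrite addn0 => wn; exists n.
  have [wn _|wn] := boolP (w n < 16^-1 ^+ hump_count n); first by exists n.
  have E : hump_count n.+1 = hump_count n by rewrite /= (negbTE wn).
  by rewrite -addSnnS -E; exact: IH.
have reach : exists n, hump_count n = k.
  elim: k => [|k [n <-]]; first by exists 0%N.
  by have [m [E wm]] := step n; exists m.+1; rewrite /= E wm.
have [n <-] := reach; have [m [E wm]] := step n.
by exists m; rewrite /hump E wm.
Qed.

(** If w had no positive lower bound at infinity, all humps would be placed. The bound B attached to
    the hump sequence would then satisfy 4^-k <= B 16^-k for every k, which fails once 4^k > B. *)
Lemma l2_dominated_lower : (forall a, l2seq a ->
    exists B, forall m, a m ^+ 2 <= B * w m) ->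
  exists c N0, 0 < c /\ forall n, (N0 <= n)%N -> c <= w n.
Proof.
move=> H; apply: contrapT => no.
have small c N0 : 0 < c -> exists2 n, (N0 <= n)%N & w n < c.
  move=> c0; apply: contrapT => no2; apply: no; exists c, N0; split => // n nN.
  by rewrite leNgt; apply/negP => wn; apply: no2; exists n.
have l2h : l2seq hump.
  exists (4 / 3) => N; rewrite sum_hump.
  have : 0 <= 4^-1 ^+ hump_count N :> R by rewrite exprn_ge0// invr_ge0.
  by lra.
have [B' HB'] := H _ l2h; pose B := Num.max B' 1.
have HB m : hump m ^+ 2 <= B * w m.
  by apply: le_trans (HB' m) _; rewrite ler_wpM2r// le_max lexx.
have B0 : 0 < B by rewrite lt_max ltr01 orbT.
clearbody B; clear B' HB'.
pose k := Num.bound B; have [n [hn wn]] := hump_reached small k.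
have := HB n; rewrite hn.
have kB : B < k%:R by apply: archi_boundP; exact: ltW.
have p4 : k%:R <= 4 ^+ k :> R.
  elim: (k) => [|j IH]; first by rewrite expr0.
  rewrite exprS -natr1; have : 1 <= 4 ^+ j :> R by rewrite exprn_ege1// ler1n.
  by lra.
have q : 0 < 16^-1 ^+ k :> R by rewrite exprn_gt0// invr_gt0 ltr0n.
have -> : 2^-1 ^+ k ^+ 2 = 4 ^+ k * 16^-1 ^+ k :> R.
  by rewrite -exprMn -exprM mulnC exprM; congr (_ ^+ _); field.
have : B * w n < B * 16^-1 ^+ k by rewrite ltr_pM2l.
have : B * 16^-1 ^+ k <= 4 ^+ k * 16^-1 ^+ k.
  by rewrite ler_pM2r// (le_trans (ltW kB)).
by lra.
Qed.

End GlidingHump.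

(** * Infinite matrices with bounded row and column sums *)

Section DiagonallyDominant.
Context {R : realType}.
Variables (O b : nat -> nat -> R) (beta : R).
Hypothesis Ob : forall m n, `|O m n| <= b m n.
Hypothesis rowb : forall m N, \sum_(n < N) b m n <= beta.
Hypothesis colb : forall n M, \sum_(m < M) b m n <= beta.
Implicit Types phi : nat -> R.

Let b0 m n : 0 <= b m n. Proof. exact: le_trans (Ob m n). Qed.

Let beta0 : 0 <= beta. Proof. by have := rowb 0 0; rewrite big_ord0. Qed.

Lemma weighted_CS (c x : nat -> R) N : (forall n, 0 <= c n) ->
  (\sum_(n < N) c n * x n) ^+ 2 <= (\sum_(n < N) c n) * \sum_(n < N) c n * x n ^+ 2.
Proof.
move=> c0; elim: N => [|N IH]; first by rewrite !big_ord0 expr0n mulr0.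
rewrite !big_ord_recr/=.
have : 0 <= \sum_(n < N) c n by exact: sumr_ge0.
have : 0 <= \sum_(n < N) c n * x n ^+ 2.
  by apply: sumr_ge0 => n _; rewrite mulr_ge0 ?sqr_ge0.
move: (\sum_(n < N) c n) (\sum_(n < N) c n * x n ^+ 2) (\sum_(n < N) c n * x n) IH.
move=> B Y X BY Y0 B0; have c0N := c0 N; move: (c N) (x N) c0N => k y k0.
have Q : 0 <= B * y ^+ 2 - 2 * X * y + Y.
  move: B0; rewrite le_eqVlt => /orP[/eqP BE|Bp].
    move: BY; rewrite -BE !mul0r add0r => X2.
    have -> : X = 0 by apply/eqP; rewrite -sqrf_eq0 eq_le X2 sqr_ge0.
    by rewrite mulr0 mul0r oppr0 add0r.
  rewrite -(pmulr_rge0 _ Bp).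
  have -> : B * (B * y ^+ 2 - 2 * X * y + Y) = (B * y - X) ^+ 2 + (B * Y - X ^+ 2) by ring.
  by rewrite addr_ge0 ?sqr_ge0// subr_ge0.
have -> : (B + k) * (Y + k * y ^+ 2) = (X + k * y) ^+ 2 + (B * Y - X ^+ 2) +
    k * (B * y ^+ 2 - 2 * X * y + Y) by ring.
by rewrite -addrA lerDl addr_ge0 ?subr_ge0// mulr_ge0.
Qed.

(** Cauchy-Schwarz with weights [b m n] uses the row sums. Exchanging the two summations then uses
    the column sums. *)
Lemma schur_test phi M N :
  \sum_(m < M) (\sum_(n < N) O m n * phi n) ^+ 2 <=
  beta ^+ 2 * \sum_(n < N) phi n ^+ 2.
Proof.
have row m : (\sum_(n < N) O m n * phi n) ^+ 2 <= beta * \sum_(n < N) b m n * phi n ^+ 2.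
  apply: (@le_trans _ _ ((\sum_(n < N) b m n * `|phi n|) ^+ 2)).
    rewrite -(real_normK (num_real _)) ler_sqr ?nnegrE//; last first.
      by apply: sumr_ge0 => n _; rewrite mulr_ge0.
    apply: le_trans (ler_norm_sum _ _ _) _; apply: ler_sum => n _.
    by rewrite normrM ler_wpM2r.
  apply: le_trans (weighted_CS (fun n => `|phi n|) N (b0 m)) _.
  apply: ler_pM => //; first exact: sumr_ge0.
    by apply: sumr_ge0 => n _; rewrite mulr_ge0 ?sqr_ge0.
  by apply: ler_sum => n _; rewrite real_normK ?num_real.
apply: le_trans (ler_sum _ (fun (m : 'I_M) _ => row m)) _.
rewrite -mulr_sumr exchange_big/= expr2 -mulrA ler_wpM2l//.
rewrite mulr_sumr; apply: ler_sum => n _.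
by rewrite -mulr_suml; apply: ler_wpM2r; [exact: sqr_ge0|exact: colb].
Qed.

Definition offdiag phi m : R := limn (fun N => \sum_(n < N) O m n * phi n).

Lemma offdiag_partial phi m (C : R) N : (forall n, `|phi n| <= C) ->
  `|\sum_(n < N) O m n * phi n| <= beta * C.
Proof.
move=> pC; apply: le_trans (ler_norm_sum _ _ _) _.
apply: (@le_trans _ _ (\sum_(n < N) b m n * C)).
  by apply: ler_sum => n _; rewrite normrM ler_pM.
by rewrite -mulr_suml ler_wpM2r// (le_trans (normr_ge0 _) (pC 0%N)).
Qed.

Lemma offdiag_cvg phi m (C : R) : (forall n, `|phi n| <= C) ->
  (fun N => \sum_(n < N) O m n * phi n) @ \oo --> offdiag phi m.
Proof.
move=> pC; suff : cvgn (fun N => \sum_(n < N) O m n * phi n) by [].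
have -> : (fun N => \sum_(n < N) O m n * phi n) = series (fun n => O m n * phi n).
  by apply/funext => N; rewrite /series /= big_mkord.
apply: normed_cvg; apply: nondecreasing_is_cvgn.
  by apply: (@nondecreasing_series _ (fun n => `|O m n * phi n|)) => n _ _.
exists (beta * C) => _ [N _ <-]; rewrite /normed_series_of /series /= big_mkord.
apply: (@le_trans _ _ (\sum_(n < N) b m n * C)).
  by apply: ler_sum => n _; rewrite normrM ler_pM.
by rewrite -mulr_suml ler_wpM2r// (le_trans (normr_ge0 _) (pC 0%N)).
Qed.

Lemma offdiag_bound phi m (C : R) : (forall n, `|phi n| <= C) -> `|offdiag phi m| <= beta * C.
Proof.
move=> pC; have cv := offdiag_cvg (m := m) pC.
have cn : (fun N => `|\sum_(n < N) O m n * phi n|) @ \oo --> `|offdiag phi m|.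
  exact: cvg_norm.
rewrite -(cvg_lim _ cn)//; apply: limr_le; first by apply/cvg_ex; eexists; exact: cn.
by apply: nearW => N; exact: offdiag_partial.
Qed.

Lemma offdiagB phi psi m (C : R) : (forall n, `|phi n| <= C) -> (forall n, `|psi n| <= C) ->
  offdiag phi m - offdiag psi m = offdiag (fun n => phi n - psi n) m.
Proof.
move=> pC qC; have c1 := offdiag_cvg (m := m) pC; have c2 := offdiag_cvg (m := m) qC.
apply/esym/cvg_lim => //.
have -> : (fun N => \sum_(n < N) O m n * (phi n - psi n)) =
    (fun N => \sum_(n < N) O m n * phi n - \sum_(n < N) O m n * psi n).
  by apply/funext => N; rewrite -sumrB; apply: eq_bigr => n _; rewrite mulrBr.
exact: cvgB c1 c2.
Qed.

Lemma offdiag_l2 phi B M : (forall N, \sum_(n < N) phi n ^+ 2 <= B) ->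
  \sum_(m < M) offdiag phi m ^+ 2 <= beta ^+ 2 * B.
Proof.
move=> pB.
have pC n : `|phi n| <= B + 1.
  have : phi n ^+ 2 <= B.
    by apply: le_trans (pB n.+1); rewrite big_ord_recr/= lerDr sumr_ge0// => k _; exact: sqr_ge0.
  rewrite -(real_normK (num_real (phi n))) => H.
  by have := sqr_ge0 (`|phi n| - 1); nra.
have cv : (fun N => \sum_(m < M) (\sum_(n < N) O m n * phi n) ^+ 2) @ \oo -->
    \sum_(m < M) offdiag phi m ^+ 2.
  elim: M => [|M IH].
    by rewrite big_ord0; under eq_fun do rewrite big_ord0; exact: cvg_cst.
  rewrite big_ord_recr/=; under eq_fun do rewrite big_ord_recr/=.
  apply: cvgD => //; rewrite expr2; under eq_fun do rewrite expr2.
  by apply: cvgM; exact: (offdiag_cvg (m := M) pC).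
rewrite -(cvg_lim _ cv)//; apply: limr_le; first by apply/cvg_ex; eexists; exact: cv.
apply: nearW => N; apply: le_trans (schur_test _ _ _) _.
by rewrite ler_wpM2l ?sqr_ge0.
Qed.

End DiagonallyDominant.

Section Solve.
Context {R : realType}.
Variables (A b : nat -> nat -> R) (d : R) (g : nat -> R).
Hypothesis d0 : 0 < d.
Hypothesis Ad : forall m, d <= A m m.
Hypothesis Ab : forall m n, m != n -> `|A m n| <= b m n.
Hypothesis b0 : forall m n, 0 <= b m n.
Hypothesis rowb : forall m N, \sum_(n < N) b m n <= d / 2.
Hypothesis colb : forall n M, \sum_(m < M) b m n <= d / 2.
Hypothesis l2g : l2seq g.

Let O m n := if m == n then 0 else A m n.

Let Ob m n : `|O m n| <= b m n.
Proof. by rewrite /O; have [_|/Ab//] := eqVneq m n; rewrite normr0. Qed.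

(** Jacobi iteration for the system A phi = g. The diagonal is at least d and the off-diagonal row
    sums are at most d / 2, so it contracts the supremum norm by 1/2. *)
Fixpoint jacobi j m : R :=
  if j is i.+1 then (g m - offdiag O (jacobi i) m) / A m m else 0.

Arguments jacobi : simpl never.

Let jacobiS j m : jacobi j.+1 m = (g m - offdiag O (jacobi j) m) / A m m.
Proof. by []. Qed.

Let A0 m : 0 < A m m. Proof. exact: lt_le_trans d0 (Ad m). Qed.

Let jacobi_l2 : exists B, forall j M, \sum_(m < M) jacobi j m ^+ 2 <= B.
Proof.
have [G hG] := l2g; have G0 : 0 <= G by have := hG 0%N; rewrite big_ord0.
have dd : 0 < d ^+ 2 by rewrite exprn_gt0.
(* The fixed point of B = 2 / d^2 (G + (d / 2)^2 B), where d / 2 bounds the off-diagonal part on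
   l^2. *)
exists (4 * G / d ^+ 2); elim=> [|j IH] M.
  rewrite big1; last by move=> m _; rewrite /jacobi expr0n.
  by rewrite divr_ge0 ?mulr_ge0// ltW.
have oB := offdiag_l2 Ob rowb colb M IH.
apply: (@le_trans _ _ (\sum_(m < M) (2 / d ^+ 2 * g m ^+ 2 +
    2 / d ^+ 2 * offdiag O (jacobi j) m ^+ 2))).
  apply: ler_sum => m _; rewrite jacobiS -mulrDr expr_div_n.
  have H : (g m - offdiag O (jacobi j) m) ^+ 2 <= 2 * (g m ^+ 2 + offdiag O (jacobi j) m ^+ 2).
    by have := sqr_ge0 (g m + offdiag O (jacobi j) m); lra.
  rewrite [leRHS](_ : _ = (2 * (g m ^+ 2 + offdiag O (jacobi j) m ^+ 2)) * (d ^+ 2)^-1); last by ring.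
  apply: ler_pM; [exact: sqr_ge0|by rewrite invr_ge0 sqr_ge0|exact: H|].
  by rewrite lef_pV2 ?posrE ?exprn_gt0// ler_sqr ?nnegrE// ltW.
rewrite big_split/= -!mulr_sumr; have := hG M.
move: oB; set X := \sum_(i < M) _; set Y := \sum_(i < M) _ => oB gB.
rewrite -mulrDr [leRHS](_ : _ = 2 / d ^+ 2 * (2 * G)); last by ring.
rewrite ler_pM2l ?divr_gt0//; move: oB.
have -> : (d / 2) ^+ 2 * (4 * G / d ^+ 2) = G by field; exact: lt0r_neq0.
lra.
Qed.

Let jacobi_bound : exists2 C, 0 <= C & forall j m, `|jacobi j m| <= C.
Proof.
have [B hB] := jacobi_l2; exists (B + 1).
  by have := hB 0%N 0%N; rewrite big_ord0 => H; rewrite addr_ge0.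
move=> j m; have : jacobi j m ^+ 2 <= B.
  apply: le_trans (hB j m.+1); rewrite big_ord_recr/= lerDr sumr_ge0// => k _.
  exact: sqr_ge0.
rewrite -(real_normK (num_real (jacobi j m))) => H.
by have := sqr_ge0 (`|jacobi j m| - 1); nra.
Qed.

Let jacobi_step : exists2 C, 0 <= C &
  forall j m, `|jacobi j.+1 m - jacobi j m| <= C * 2^-1 ^+ j.
Proof.
have [C C0 hC] := jacobi_bound; exists (2 * C); first by rewrite mulr_ge0.
elim=> [|j IH] m.
  rewrite expr0 mulr1; apply: le_trans (ler_normB _ _) _.
  by have := hC 1%N m; have := hC 0%N m; lra.
have -> : jacobi j.+2 m - jacobi j.+1 m =
    - (offdiag O (fun n => jacobi j.+1 n - jacobi j n) m) / A m m.
  rewrite -(offdiagB Ob rowb m (hC j.+1) (hC j)).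
  by rewrite (jacobiS j.+1) (jacobiS j); ring.
have := offdiag_bound Ob rowb m IH; set o := offdiag _ _ _ => Ho.
rewrite normrM normrN normfV (ger0_norm (ltW (A0 m))) ler_pdivrMr//.
apply: le_trans Ho _.
have p : 0 <= 2 * C * 2^-1 ^+ j by rewrite !mulr_ge0// exprn_ge0// invr_ge0.
rewrite exprS; move: p; rewrite (_ : 2 * C * (2^-1 * 2^-1 ^+ j) * A m m =
  2 * C * 2^-1 ^+ j * (A m m / 2)); last by ring.
move=> p; rewrite mulrC ler_wpM2l//; have := Ad m; lra.
Qed.

Let jacobi_cvg : exists phi : nat -> R, forall eps, 0 < eps ->
  exists J, forall j m, (J <= j)%N -> `|phi m - jacobi j m| <= eps.
Proof.
have [C C0 hC] := jacobi_step.
have H m N : \sum_(0 <= j < N) 2 ^+ j * (jacobi j.+1 m - jacobi j m) ^+ 2 <= 2 * C ^+ 2.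
  apply: (@le_trans _ _ (C ^+ 2 * (2 - 2 * 2^-1 ^+ N))).
    rewrite big_mkord; elim: N => [|N IH]; first by rewrite big_ord0 expr0 mulr1 subrr mulr0.
    rewrite big_ord_recr/= (exprS 2^-1 N).
    have : 2 ^+ N * (jacobi N.+1 m - jacobi N m) ^+ 2 <= C ^+ 2 * 2^-1 ^+ N.
      have -> : C ^+ 2 * 2^-1 ^+ N = 2 ^+ N * (C * 2^-1 ^+ N) ^+ 2.
        have E : 2 ^+ N * 2^-1 ^+ N = 1 :> R by rewrite -exprMn divff// expr1n.
        rewrite exprMn; transitivity (C ^+ 2 * 2^-1 ^+ N * (2 ^+ N * 2^-1 ^+ N)); last by ring.
        by rewrite E mulr1.
      rewrite ler_wpM2l ?exprn_ge0// -(real_normK (num_real _)) ler_sqr ?nnegrE//.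
      by rewrite mulr_ge0// exprn_ge0// invr_ge0.
    by move: IH; lra.
  rewrite mulrC ler_wpM2r ?sqr_ge0//.
  have : 0 <= 2^-1 ^+ N :> R by rewrite exprn_ge0// invr_ge0.
  lra.
(* Here [flimsup] is taken over the space nat, the index m being the point. The bound [H] is uniform
   in m, and so is the convergence. *)
exists (flimsup jacobi) => eps e0.
have := fun m => @flimsup_bound _ nat R jacobi m _ (H m) => Hb.
have : (fun J => 2 / 2 ^+ J * (2 * C ^+ 2)) @ \oo --> (0 : R).
  rewrite -(mul0r (2 * C ^+ 2)); apply: cvgMl; rewrite -(mulr0 2); apply: cvgMr.
  under eq_fun do rewrite -exprVn.
  by apply: cvg_expr; rewrite ger0_norm ?invr_ge0// invf_lt1// ltr1n.
move=> /cvgrPdist_le /(_ (eps ^+ 2)); rewrite exprn_gt0// => /(_ isT) [J _ HJ].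
exists J => j m /HJ /=; rewrite sub0r normrN => H1.
rewrite -(@ler_pXn2r _ 2) ?nnegrE// ?(ltW e0)// real_normK ?num_real//.
by apply: le_trans (Hb m j) _; apply: le_trans (ler_norm _) H1.
Qed.

(** The l^2 bound passes to the limit through finite sums. The equation passes because the
    convergence is uniform in m and [offdiag] is bounded on bounded sequences. *)
Lemma solve_diagonally_dominant : exists2 phi, l2seq phi &
  forall m, (fun N => \sum_(n < N) A m n * phi n) @ \oo --> g m.
Proof.
have [phi cv] := jacobi_cvg; have [B hB] := jacobi_l2; have [C C0 hC] := jacobi_bound.
have cvj m : jacobi^~ m @ \oo --> phi m.
  apply/cvgrPdist_le => eps /cv [J HJ]; exists J => // j /= jJ; exact: HJ.
have pC m : `|phi m| <= C.
  have cn : (fun j => `|jacobi j m|) @ \oo --> `|phi m|.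
    by apply: cvg_norm; exact: cvj.
  rewrite -(cvg_lim _ cn)//; apply: limr_le; first by apply/cvg_ex; eexists; exact: cn.
  by apply: nearW => j; exact: hC.
have pB M : \sum_(m < M) phi m ^+ 2 <= B.
  have cs : (fun j => \sum_(m < M) jacobi j m ^+ 2) @ \oo --> \sum_(m < M) phi m ^+ 2.
    elim: M => [|M IH].
      by rewrite big_ord0; under eq_fun do rewrite big_ord0; exact: cvg_cst.
    rewrite big_ord_recr/=; under eq_fun do rewrite big_ord_recr/=.
    apply: cvgD => //; rewrite expr2; under eq_fun do rewrite expr2.
    by apply: cvgM; exact: cvj.
  rewrite -(cvg_lim _ cs)//; apply: limr_le; first by apply/cvg_ex; eexists; exact: cs.
  by apply: nearW => j; exact: hB.
exists phi; first by exists B.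
move=> m; have E : offdiag O phi m + A m m * phi m = g m.
  apply/eqP; rewrite -subr_eq0 -normr_le0; apply/ler_addgt0Pr => e e0; rewrite add0r.
  have e' : 0 < e / (d / 2 + A m m) by rewrite divr_gt0// addr_gt0// divr_gt0.
  have [J HJ] := cv _ e'.
  have -> : offdiag O phi m + A m m * phi m - g m =
      offdiag O (fun n => phi n - jacobi J n) m + A m m * (phi m - jacobi J.+1 m).
    rewrite -(offdiagB Ob rowb m pC (hC J)).
    rewrite jacobiS.
    by field; exact: lt0r_neq0.
  apply: le_trans (ler_normD _ _) _.
  have -> : e = d / 2 * (e / (d / 2 + A m m)) + A m m * (e / (d / 2 + A m m)).
    by field; apply: lt0r_neq0; have := A0 m; have := d0; lra.
  apply: lerD; first by apply: (offdiag_bound Ob rowb) => n; exact: HJ.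
  by rewrite normrM (ger0_norm (ltW (A0 m))) ler_pM2l//; apply: HJ.
rewrite -E; have cO := offdiag_cvg Ob rowb (m := m) pC.
have cc : (fun N => \sum_(n < N) O m n * phi n + A m m * phi m) @ \oo -->
    offdiag O phi m + A m m * phi m.
  by apply: cvgD => //; exact: cvg_cst.
apply: cvg_trans cc; apply: near_eq_cvg; exists m.+1 => // N /= mN.
rewrite (bigD1 (Ordinal mN))//= {1}/O eqxx mul0r add0r [RHS](bigD1 (Ordinal mN))//= addrC.
congr (_ + _); apply: eq_bigr => n nm; rewrite /O ifN//.
by rewrite eq_sym.
Qed.

End Solve.

Definition inv_sqr_dist {R : realType} (m n : nat) : R :=
  if m == n then 0 else ((m%:R - n%:R) ^+ 2)^-1.

Lemma inv_sqr_distC {R : realType} m n : @inv_sqr_dist R m n = inv_sqr_dist n m.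
Proof. by rewrite /inv_sqr_dist eq_sym -[_ - n%:R]opprB sqrrN. Qed.

Lemma inv_sqr_dist_ge0 {R : realType} m n : 0 <= inv_sqr_dist m n :> R.
Proof. by rewrite /inv_sqr_dist; case: ifP => // _; rewrite invr_ge0 sqr_ge0. Qed.

(** Since k^-2 <= 2 / k - 2 / (k + 1) for k >= 1, the sum on each side of m telescopes to at most
    2. *)
Lemma sum_inv_sqr_dist {R : realType} m N : \sum_(n < N) inv_sqr_dist m n <= 4 :> R.
Proof.
have tel (k : R) : 1 <= k -> (k ^+ 2)^-1 + 2 / (k + 1) <= 2 / k.
  move=> k1; have k0 : 0 < k by lra.
  have -> : 2 / k = (k ^+ 2)^-1 + 2 / (k + 1) + (k - 1) / (k ^+ 2 * (k + 1)).
    by field; apply/andP; split; apply: lt0r_neq0; lra.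
  rewrite lerDl divr_ge0 ?mulr_ge0 ?sqr_ge0//; lra.
suff [H1 H2] : ((N <= m)%N -> \sum_(n < N) inv_sqr_dist m n <= 2 / (m%:R - N%:R + 1) :> R) /\
   ((m < N)%N -> \sum_(n < N) inv_sqr_dist m n <= 4 - 2 / (N%:R - m%:R) :> R).
  have [Nm|mN] := leqP N m.
    apply: le_trans (H1 Nm) _; rewrite ler_pdivrMr; last by rewrite -natrB// ltr_wpDl.
    by have : 0 <= m%:R - N%:R :> R; [rewrite subr_ge0 ler_nat|lra].
  apply: le_trans (H2 mN) _; rewrite gerBl divr_ge0// subr_ge0 ler_nat ltnW//.
elim: N => [|N [IH1 IH2]].
  split => // _; rewrite big_ord0 subr0 divr_ge0// addr_ge0//.
have NS : N.+1%:R = N%:R + 1 :> R by rewrite natr1.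
rewrite big_ord_recr/= NS; split => [Nm|].
  have := IH1 (ltnW Nm); rewrite [inv_sqr_dist m N]/inv_sqr_dist ifN ?neq_ltn ?Nm ?orbT//.
  have k1 : 1 <= m%:R - N%:R :> R by rewrite lerBrDl natr1 ler_nat.
  have := tel _ k1; rewrite (_ : m%:R - (N%:R + 1) + 1 = m%:R - N%:R); last by ring.
  lra.
rewrite ltnS leq_eqVlt => /orP[/eqP mN|mN].
  rewrite mN in IH1 *.
  have -> : inv_sqr_dist N N = 0 :> R by rewrite /inv_sqr_dist eqxx.
  have := IH1 (leqnn N); rewrite subrr add0r.
  by have -> : N%:R + 1 - N%:R = 1 :> R by [ring]; lra.
have := IH2 mN; rewrite [inv_sqr_dist m N]/inv_sqr_dist ifN ?neq_ltn ?mN//.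
have k1 : 1 <= N%:R - m%:R :> R by rewrite lerBrDl natr1 ler_nat.
have := tel _ k1; rewrite (_ : N%:R + 1 - m%:R = N%:R - m%:R + 1); last by ring.
rewrite -[m%:R - N%:R]opprB sqrrN; lra.
Qed.

(** * Complex square integrable functions and the propagator *)

Section ComplexL2.
Context d (T : measurableType d) (R : realType).
Variable mu : {measure set T -> \bar R}.
Implicit Types (f g : T -> R[i]) (h : T -> R).

Definition csqint f := sqint mu (fun x => complex.Re (f x)) /\
  sqint mu (fun x => complex.Im (f x)).

Definition cip2 f : R := ip mu (fun x => complex.Re (f x)) (fun x => complex.Re (f x)) +
  ip mu (fun x => complex.Im (f x)) (fun x => complex.Im (f x)).

Lemma normc_sqr (z : R[i]) : normc z ^+ 2 = complex.Re z ^+ 2 + complex.Im z ^+ 2.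
Proof. by case: z => a b /=; rewrite sqr_sqrtr// addr_ge0 ?sqr_ge0. Qed.

Lemma ReD (z w : R[i]) : complex.Re (z + w) = complex.Re z + complex.Re w.
Proof. by case: z; case: w. Qed.

Lemma ImD (z w : R[i]) : complex.Im (z + w) = complex.Im z + complex.Im w.
Proof. by case: z; case: w. Qed.

Lemma ReB (z w : R[i]) : complex.Re (z - w) = complex.Re z - complex.Re w.
Proof. by case: z; case: w. Qed.

Lemma ImB (z w : R[i]) : complex.Im (z - w) = complex.Im z - complex.Im w.
Proof. by case: z; case: w. Qed.

Lemma ReZ (a : R) (z : R[i]) : complex.Re (real_complex R a * z) = a * complex.Re z.
Proof. by case: z => x y /=; rewrite mul0r subr0. Qed.

Lemma ImZ (a : R) (z : R[i]) : complex.Im (real_complex R a * z) = a * complex.Im z.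
Proof. by case: z => x y /=; rewrite mul0r addr0. Qed.

Lemma Re_sum I (r : seq I) (F : I -> R[i]) :
  complex.Re (\sum_(i <- r) F i) = \sum_(i <- r) complex.Re (F i).
Proof.
by elim: r => [|i r IH]; rewrite ?big_nil// !big_cons ReD IH.
Qed.

Lemma cip2_ge0 f : 0 <= cip2 f.
Proof. by rewrite addr_ge0 ?ip_ge0. Qed.

Lemma integral_normc2 f : csqint f ->
  (\int[mu]_x (normc (f x) ^+ 2)%:E = (cip2 f)%:E)%E.
Proof.
move=> [sr si]; rewrite EFinD -(ip_EFin sr) -(ip_EFin si) -ge0_integralD//=.
- by apply: eq_integral => x _; rewrite normc_sqr EFinD.
- by move=> x _; rewrite lee_fin sqr_ge0.
- by apply/measurable_EFinP; apply: measurable_funX; exact: sqint_measurable sr.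
- by move=> x _; rewrite lee_fin sqr_ge0.
- by apply/measurable_EFinP; apply: measurable_funX; exact: sqint_measurable si.
Qed.

Lemma L2normE f : csqint f -> L2norm mu setT f = (Num.sqrt (cip2 f))%:E.
Proof.
move=> sf; rewrite /L2norm integral_normc2// poweR_EFin powR12_sqrt//.
exact: cip2_ge0.
Qed.

Lemma csqintP f : cmeasurable_fun setT f ->
  (\int[mu]_x (normc (f x) ^+ 2)%:E < +oo)%E -> csqint f.
Proof.
move=> [mr mi] foo.
have mn : measurable_fun setT (fun x => (normc (f x) ^+ 2)%:E).
  apply/measurable_EFinP; under eq_fun do rewrite normc_sqr.
  by apply: measurable_funD; exact: measurable_funX.
split; apply: sqintP => //; apply: le_lt_trans foo; apply: ge0_le_integral => //.
- by move=> x _; rewrite lee_fin sqr_ge0.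
- by apply/measurable_EFinP; exact: measurable_funX.
- by move=> x _; rewrite lee_fin normc_sqr lerDl sqr_ge0.
- by move=> x _; rewrite lee_fin sqr_ge0.
- by apply/measurable_EFinP; exact: measurable_funX.
- by move=> x _; rewrite lee_fin normc_sqr lerDr sqr_ge0.
Qed.

Lemma inL2P f : inL2 mu setT f <-> csqint f.
Proof.
split=> [[mf nf]|sf]; last first.
  split; last by rewrite L2normE// ltry.
  by case: sf => sr si; split; [exact: sqint_measurable sr|exact: sqint_measurable si].
apply: csqintP => //; apply: lty_poweRy nf; exact: lt0r_neq0.
Qed.

Lemma csqintD f g : csqint f -> csqint g -> csqint (fun x => f x + g x).
Proof.
move=> [fr fi] [gr gi]; split.
  by under eq_fun do rewrite ReD; exact: sqintD.
by under eq_fun do rewrite ImD; exact: sqintD.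
Qed.

Lemma csqintB f g : csqint f -> csqint g -> csqint (fun x => f x - g x).
Proof.
move=> [fr fi] [gr gi]; split.
  by under eq_fun do rewrite ReB; exact: sqintB.
by under eq_fun do rewrite ImB; exact: sqintB.
Qed.

Lemma csqint0 : csqint (fun=> 0).
Proof. by split; exact: sqint0. Qed.

Lemma cip2B f g : cip2 (fun x => f x - g x) =
  ip mu (fun x => complex.Re (f x) - complex.Re (g x)) (fun x => complex.Re (f x) - complex.Re (g x)) +
  ip mu (fun x => complex.Im (f x) - complex.Im (g x)) (fun x => complex.Im (f x) - complex.Im (g x)).
Proof.
rewrite /cip2; under [X in ip _ X _ + _]eq_fun do rewrite ReB.
under [X in ip _ _ X + _]eq_fun do rewrite ReB.
under [X in _ + ip _ X _]eq_fun do rewrite ImB.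
by under [X in _ + ip _ _ X]eq_fun do rewrite ImB.
Qed.

Lemma cvg_sqrt0 (u : nat -> R) : (forall n, 0 <= u n) ->
  u @ \oo --> (0 : R) <-> (fun n => Num.sqrt (u n)) @ \oo --> (0 : R).
Proof.
move=> u0; split=> cu.
  apply/cvgrPdist_le => e e0.
  have e2 : 0 < e ^+ 2 by rewrite exprn_gt0.
  have /cvgrPdist_le /(_ _ e2) := cu; apply: filterS => n.
  rewrite !sub0r !normrN !ger0_norm ?sqrtr_ge0// => H.
  by rewrite -(ger0_norm (ltW e0)) -sqrtr_sqr ler_wsqrtr.
rewrite (_ : u = fun n => Num.sqrt (u n) * Num.sqrt (u n)).
  by rewrite -(mulr0 0); exact: cvgM.
by apply/funext => n; rewrite -expr2 sqr_sqrtr.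
Qed.

Lemma is_L2limP (u : nat -> T -> R[i]) f : (forall n, csqint (u n)) -> csqint f ->
  is_L2lim mu u f <-> (fun n => cip2 (fun x => u n x - f x)) @ \oo --> 0.
Proof.
move=> su sf; have sd n := csqintB (su n) sf.
have E : (fun n => L2norm mu setT (fun x => u n x - f x)) =
    (fun n => (Num.sqrt (cip2 (fun x => u n x - f x)))%:E).
  by apply/funext => n; rewrite L2normE.
rewrite cvg_sqrt0 => [|n]; last exact: cip2_ge0.
split=> [[_]|H].
  rewrite E => /fine_cvg; exact.
split; first exact/inL2P.
by rewrite E; apply: cvg_EFin => //; exact: nearW.
Qed.

Lemma cvg0_ip (u : nat -> T -> R) (g : T -> R) h : (forall n, sqint mu (u n)) -> sqint mu g ->
  sqint mu h -> (fun n => ip mu (fun x => u n x - g x) (fun x => u n x - g x)) @ \oo --> 0 ->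
  (fun n => ip mu (u n) h) @ \oo --> ip mu g h.
Proof.
move=> su sg sh cu; apply/subr_cvg0; apply/norm_cvg0P.
have H n : `|ip mu (u n) h - ip mu g h| <= Num.sqrt (ip mu h h *
    ip mu (fun x => u n x - g x) (fun x => u n x - g x)).
  rewrite -ipBl// -sqrtr_sqr ler_wsqrtr// mulrC.
  by apply: ip_CS => //; exact: sqintB.
apply: (@squeeze_cvgr _ _ _ _ (fun=> 0) (fun n => Num.sqrt (ip mu h h *
    ip mu (fun x => u n x - g x) (fun x => u n x - g x)))).
- by apply: nearW => n; rewrite H normr_ge0.
- exact: cvg_cst.
- apply: (cvg_sqrt0 _).1; first by move=> n; rewrite mulr_ge0 ?ip_ge0.
  by rewrite -(mulr0 (ip mu h h)); apply: cvgMr.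
Qed.

Lemma L2lim_ip (u : nat -> T -> R[i]) f h : (forall n, csqint (u n)) ->
  is_L2lim mu u f -> sqint mu h ->
  (fun n => ip mu (fun x => complex.Re (u n x)) h) @ \oo --> ip mu (fun x => complex.Re (f x)) h /\
  (fun n => ip mu (fun x => complex.Im (u n x)) h) @ \oo --> ip mu (fun x => complex.Im (f x)) h.
Proof.
move=> su uf sh; have /inL2P sf := uf.1.
have := (is_L2limP su sf).1 uf => c2.
have E n := cip2B (u n) f.
split; apply: cvg0_ip => //; try (by case: sf); try (by move=> n; case: (su n)).
- apply: (@squeeze_cvgr _ _ _ _ (fun=> 0) _ _ _ _ _ c2); last exact: cvg_cst.
  by apply: nearW => n; rewrite ip_ge0/= E lerDl ip_ge0.
- apply: (@squeeze_cvgr _ _ _ _ (fun=> 0) _ _ _ _ _ c2); last exact: cvg_cst.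
  by apply: nearW => n; rewrite ip_ge0/= E lerDr ip_ge0.
Qed.

End ComplexL2.

Section Propagator.
Context {R : realType}.
Variable lam : nat -> R.
Local Notation mu := (leb R).
Local Notation psi := (@hermite_fun R).
Implicit Types f : lebR R -> R[i].

(** The Hermite basis with arbitrary eigenvalues. [fractional_harmonic s] is the instance with
    eigenvalues (2 n + 1)^s. *)
Definition harmonic : diagonal_operator R :=
  {| eigfun := fun n x => real_complex R (psi n x); eigval := lam |}.

Definition cre f n : R := ip mu (fun x => complex.Re (f x)) (psi n).

Definition cim f n : R := ip mu (fun x => complex.Im (f x)) (psi n).

Lemma eq_coef f g : csqint mu f -> csqint mu g -> cre f =1 cre g -> cim f =1 cim g ->
  {ae mu, forall x, f x = g x}.
Proof.
move=> [fr fi] [gr gi] er ei.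
have Hr := eq_coef_ae sqint_hermite hermite_complete fr gr er.
have Hi := eq_coef_ae sqint_hermite hermite_complete fi gi ei.
apply: filterS2 Hr Hi => x.
by case: (f x) (g x) => a b [c e] /= -> ->.
Qed.

Lemma innerE f n : inner mu f (eigfun harmonic n) = Complex (cre f n) (cim f n).
Proof.
rewrite /inner /cintegral; congr Complex; apply: eq_Rintegral => x _ /=.
  by case: (f x) => a b /=; rewrite oppr0 mulr0 subr0.
by case: (f x) => a b /=; rewrite oppr0 mulr0 add0r.
Qed.

Lemma propagator_psum t f n x :
  \sum_(k < n) expi (- (t * lam k)) * inner mu f (eigfun harmonic k) * eigfun harmonic k x =
  Complex (psum psi (fun k => cos (t * lam k) * cre f k + sin (t * lam k) * cim f k) n x)
    (psum psi (fun k => cos (t * lam k) * cim f k - sin (t * lam k) * cre f k) n x).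
Proof.
under eq_bigr do rewrite innerE.
elim: n => [|n IH]; first by rewrite /psum !big_ord0.
rewrite big_ord_recr IH /psum !big_ord_recr/= /expi cosN sinN.
by congr Complex; ring.
Qed.

(** Each term is one coordinate of a rotated pair, so its square is at most a_n^2 + b_n^2. *)
Lemma l2seq_rot (c s a b : nat -> R) : (forall n, c n ^+ 2 + s n ^+ 2 = 1) ->
  l2seq a -> l2seq b -> l2seq (fun n => c n * a n + s n * b n).
Proof.
move=> cs [A HA] [B HB]; exists (A + B) => N.
apply: (@le_trans _ _ (\sum_(k < N) (a k ^+ 2 + b k ^+ 2))); last by rewrite big_split lerD.
apply: ler_sum => k _; have := sqr_ge0 (c k * b k - s k * a k); have := cs k.
move: (c k) (s k) (a k) (b k) => x y p q E.
have -> : p ^+ 2 + q ^+ 2 = (x ^+ 2 + y ^+ 2) * (p ^+ 2 + q ^+ 2) by rewrite E mul1r.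
by move=> ?; rewrite -subr_ge0; set z := (X in _ <= X); have -> : z = (x * q - y * p) ^+ 2 by rewrite /z; ring.
Qed.

Section Partial.
Variables a b : nat -> R.

Definition cpsum n (x : lebR R) : R[i] := Complex (psum psi a n x) (psum psi b n x).

Lemma csqint_cpsum n : csqint mu (cpsum n).
Proof. by split; exact: (sqint_psum sqint_hermite). Qed.

Lemma L2lim_cpsum f : is_L2lim mu cpsum f -> [/\ csqint mu f, cre f =1 a & cim f =1 b].
Proof.
move=> uf; have /inL2P sf := uf.1.
have H (c : nat -> R) n : (fun N => ip mu (psum psi c N) (psi n)) @ \oo --> c n.
  apply: cvg_near_cst; exists n.+1 => // N /= nN.
  by rewrite (ip_psum_e sqint_hermite ip_hermite) nN.
split => // n.
  have [cv _] := L2lim_ip csqint_cpsum uf (sqint_hermite n).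
  exact: (cvg_unique _ cv (H a n)).
have [_ cv] := L2lim_ip csqint_cpsum uf (sqint_hermite n).
exact: (cvg_unique _ cv (H b n)).
Qed.

Lemma cpsum_cvg f : csqint mu f ->
  (fun N => ip mu (fun x => complex.Re (f x) - psum psi a N x)
     (fun x => complex.Re (f x) - psum psi a N x)) @ \oo --> 0 ->
  (fun N => ip mu (fun x => complex.Im (f x) - psum psi b N x)
     (fun x => complex.Im (f x) - psum psi b N x)) @ \oo --> 0 ->
  is_L2lim mu cpsum f.
Proof.
move=> sf cr ci; apply/(is_L2limP csqint_cpsum sf).
have E n : cip2 mu (fun x => cpsum n x - f x) =
    ip mu (fun x => complex.Re (f x) - psum psi a n x) (fun x => complex.Re (f x) - psum psi a n x) +
    ip mu (fun x => complex.Im (f x) - psum psi b n x) (fun x => complex.Im (f x) - psum psi b n x).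
  by rewrite cip2B; congr (_ + _); apply: eq_Rintegral => x _ /=; ring.
under eq_fun do rewrite E.
by rewrite -(addr0 0); exact: cvgD cr ci.
Qed.

Lemma ex_L2lim_cpsum : l2seq a -> l2seq b -> exists f, is_L2lim mu cpsum f.
Proof.
move=> la lb.
have [g [sg cg lg]] := riesz_fischer sqint_hermite ip_hermite la.
have [h [sh ch lh]] := riesz_fischer sqint_hermite ip_hermite lb.
by exists (fun x => Complex (g x) (h x)); exact: cpsum_cvg.
Qed.

End Partial.

Lemma l2seq_cre f : csqint mu f -> l2seq (cre f).
Proof. by case=> sr _; exact: (l2seq_ip sqint_hermite ip_hermite sr). Qed.

Lemma l2seq_cim f : csqint mu f -> l2seq (cim f).
Proof. by case=> _ si; exact: (l2seq_ip sqint_hermite ip_hermite si). Qed.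

(** The rotated coefficients are square summable, so a limit exists and [L2lim] returns one. The
    coefficients of any such limit are forced by [L2lim_cpsum]. *)
Lemma propagatorP t f : csqint mu f -> [/\ csqint mu (propagator harmonic t f),
  cre (propagator harmonic t f) =1
    fun n => cos (t * lam n) * cre f n + sin (t * lam n) * cim f n &
  cim (propagator harmonic t f) =1
    fun n => cos (t * lam n) * cim f n - sin (t * lam n) * cre f n].
Proof.
move=> sf; apply: L2lim_cpsum.
set a := fun n => _ + _; set b := fun n => _ - _.
have la : l2seq a.
  by apply: l2seq_rot (l2seq_cre sf) (l2seq_cim sf) => n; rewrite cos2Dsin2.
have lb : l2seq b.
  rewrite /b; under eq_fun do rewrite -mulNr.
  by apply: l2seq_rot (l2seq_cim sf) (l2seq_cre sf) => n; rewrite sqrrN cos2Dsin2.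
have [g lg] := ex_L2lim_cpsum la lb.
have -> : propagator harmonic t f = L2lim mu (cpsum a b).
  rewrite /propagator /fun_calculus /L2series; congr L2lim.
  by apply/funext => n; apply/funext => x; exact: propagator_psum.
exact: (@xgetPex _ (fun=> 0) [set q | is_L2lim mu (cpsum a b) q] (ex_intro _ _ lg)).
Qed.

End Propagator.

(** * Bochner integrals through Hermite coefficients *)

Section BochnerCoef.
Context d (T : measurableType d) d' (X : measurableType d') (R : realType).
Variables (mu : {measure set T -> \bar R}) (nu : {measure set X -> \bar R}).
Implicit Types (s : L2simple T X R) (D : set X) (z w : R[i]) (f g : T -> R[i]).

(** Common form of [simple_value], for c E the indicator of E at t, and of [simple_integral], for c
    E the measure of D and E intersected. *)
Definition wsum (c : set X -> R) s (x : T) : R[i] :=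
  \sum_(p <- s) real_complex R (c p.1) * p.2 x.

(** The boolean lets one proof serve both [cre] and [cim]. *)
Definition cpart (b : bool) (z : R[i]) : R := if b then complex.Im z else complex.Re z.

Lemma cpartD b z w : cpart b (z + w) = cpart b z + cpart b w.
Proof. by case: b; rewrite /cpart ?ReD ?ImD. Qed.

Lemma cpartZ b a z : cpart b (real_complex R a * z) = a * cpart b z.
Proof. by case: b; rewrite /cpart ?ReZ ?ImZ. Qed.

Lemma csqint_cpart b f : csqint mu f -> sqint mu (fun x => cpart b (f x)).
Proof. by case: b => -[]. Qed.

Lemma ip_cpartB b f g : ip mu (fun x => cpart b (f x) - cpart b (g x))
    (fun x => cpart b (f x) - cpart b (g x)) <= cip2 mu (fun x => f x - g x).
Proof. by rewrite cip2B; case: b; rewrite /cpart ?lerDl ?lerDr ip_ge0. Qed.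

Lemma wsum_coef b c s e : (forall p, p \in s -> csqint mu p.2) -> sqint mu e ->
  csqint mu (wsum c s) /\ ip mu (fun x => cpart b (wsum c s x)) e =
    \sum_(p <- s) c p.1 * ip mu (fun x => cpart b (p.2 x)) e.
Proof.
move=> + se; elim: s => [|p s IH] H.
  rewrite /wsum big_nil; split.
    by under eq_fun do rewrite big_nil; exact: csqint0.
  rewrite -(ip0l mu e); congr (ip _ _ _); apply/funext => x.
  by rewrite big_nil; case: b.
have [|sw ipw] := IH; first by move=> q qs; apply: H; rewrite inE qs orbT.
have sp2 := H p (mem_head _ _).
have E x : wsum c (p :: s) x = real_complex R (c p.1) * p.2 x + wsum c s x.
  by rewrite /wsum big_cons.
have sp : csqint mu (fun x => real_complex R (c p.1) * p.2 x).
  split; first by under eq_fun do rewrite ReZ; apply: sqintZ; case: sp2.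
  by under eq_fun do rewrite ImZ; apply: sqintZ; case: sp2.
rewrite (_ : wsum c (p :: s) = fun x => real_complex R (c p.1) * p.2 x + wsum c s x); last exact/funext.
split; first exact: csqintD.
under eq_fun do rewrite cpartD cpartZ.
have sb := csqint_cpart b sp2.
by rewrite big_cons ipDl//; [rewrite ipw ipZl|exact: sqintZ|exact: csqint_cpart].
Qed.

Lemma simple_coef_integral D s (v : set X * (T -> R[i]) -> R) :
  measurable D ->
  (forall p, p \in s -> measurable p.1 /\ (nu (D `&` p.1) < +oo)%E) ->
  nu.-integrable D (EFin \o (fun t => \sum_(p <- s) \1_(p.1) t * v p)) /\
  \int[nu]_(t in D) (\sum_(p <- s) \1_(p.1) t * v p) =
    \sum_(p <- s) fine (nu (D `&` p.1)) * v p.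
Proof.
move=> mD; elim: s => [|p s IH] H.
  rewrite big_nil; under eq_fun do rewrite big_nil; split.
    by apply: (eq_integrable _ (cst 0%E)) => //; exact: integrable0.
  by rewrite Rintegral_cst// mul0r.
have [|is_ Es] := IH; first by move=> q qs; apply: H; rewrite inE qs orbT.
have [mp fp] := H p (mem_head _ _).
have i1 : nu.-integrable D (EFin \o (\1_p.1 : X -> R)).
  apply/integrableP; split; first exact/measurable_EFinP.
  rewrite (eq_integral (fun x => (\1_p.1 x)%:E)) => [|x _]; last by rewrite gee0_abs// lee_fin.
  by rewrite integral_indic// setIC.
have i2 : nu.-integrable D (EFin \o (fun t => v p * \1_p.1 t)).
  by have := integrableZl mD (v p) i1; apply: eq_integrable.
have pt t : \sum_(q <- p :: s) \1_(q.1) t * v q =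
    v p * \1_p.1 t + \sum_(q <- s) \1_(q.1) t * v q by rewrite big_cons mulrC.
split.
  have := integrableD mD i2 is_; apply: eq_integrable => // t _ /=.
  by rewrite pt EFinD.
under eq_Rintegral do rewrite pt.
rewrite RintegralD// Es big_cons; congr (_ + _).
rewrite (@RintegralZl _ _ _ nu D _ (v p) mD i1) mulrC; congr (_ * _).
by rewrite /Rintegral integral_indic// setIC.
Qed.

Section Coef.
Variables (D : set X) (F : X -> T -> R[i]) (h : T -> R[i]) (e : T -> R) (b : bool).
Hypotheses (mD : measurable D) (se : sqint mu e) (e1 : ip mu e e = 1).
Hypothesis Fh : is_bochner_integral mu nu D F h.

Definition coef (f : T -> R[i]) : R := ip mu (fun x => cpart b (f x)) e.

Lemma coef_dist f g : csqint mu f -> csqint mu g ->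
  (`|coef f - coef g|%:E <= L2norm mu setT (fun x => f x - g x)%R)%E.
Proof.
move=> sf sg; rewrite (L2normE (csqintB sf sg)) lee_fin /coef.
have sfb := csqint_cpart b sf; have sgb := csqint_cpart b sg.
rewrite -(ipBl sfb sgb se) -sqrtr_sqr ler_wsqrtr//.
apply: le_trans (ip_CS (sqintB sfb sgb) se) _.
by rewrite e1 mulr1 ip_cpartB.
Qed.

(** Taking a Hermite-type coefficient turns simple functions into scalar simple functions. They
    approximate the coefficient of F within an integrable error, and their integrals tend to the
    coefficient of h. *)
Lemma bochner_approx : exists (v : nat -> X -> R) (err : nat -> X -> \bar R),
  [/\ forall k, nu.-integrable D (EFin \o v k), forall k, measurable_fun D (err k),
    forall k t, (0 <= err k t)%E,
    {ae nu, forall t, D t -> forall k, (`|coef (F t) - v k t|%:E <= err k t)%E} &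
    (\int[nu]_(t in D) err k t)%E @[k --> \oo] --> 0%E /\
    (fun k => \int[nu]_(t in D) v k t) @ \oo --> coef h].
Proof.
have [FL2 [s [sD merr err0 lim]]] := Fh.
pose v (p : set X * (T -> R[i])) := coef p.2.
have ss k p : p \in s k -> csqint mu p.2 by move=> /sD[_ _ /inL2P].
have fs k p : p \in s k -> measurable p.1 /\ (nu (D `&` p.1) < +oo)%E by move=> /sD[].
have sL k : csqint mu (simple_integral nu D (s k)) :=
  (wsum_coef b (fun E => fine (nu (D `&` E))) (ss k) se).1.
exists (fun k t => \sum_(p <- s k) \1_(p.1) t * v p).
exists (fun k t => L2norm mu setT (fun x => F t x - simple_value (s k) t x)).
split => //.
- by move=> k; have [] := simple_coef_integral v mD (fs k).
- by move=> k t; exact: poweR_ge0.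
- apply: filterS FL2 => t Ft Dt k; have /inL2P sF := Ft Dt.
  have [sv Ev] := wsum_coef b (fun E => \1_E t) (ss k) se.
  have -> : \sum_(p <- s k) \1_(p.1) t * v p = coef (simple_value (s k) t) by rewrite -Ev.
  exact: coef_dist.
split => //.
have E k : \int[nu]_(t in D) (\sum_(p <- s k) \1_(p.1) t * v p) =
    coef (simple_integral nu D (s k)).
  have [_ ->] := simple_coef_integral v mD (fs k).
  by have [_ <-] := wsum_coef b (fun E => fine (nu (D `&` E))) (ss k) se.
rewrite (funext E) /coef; have [cr ci] := L2lim_ip sL lim se.
by case: (b).
Qed.

(** The coefficient of [F t] is not given as a measurable function of t. It is therefore compared
    with G and the error functions, which are measurable. *)
Lemma bochner_coef_le (G : X -> \bar R) : measurable_fun D G ->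
  (forall t, D t -> (0 <= G t)%E) ->
  {ae nu, forall t, D t -> (`|coef (F t)|%:E <= G t)%E} ->
  (`|coef h|%:E <= \int[nu]_(t in D) G t)%E.
Proof.
move=> mG G0 FG; have [v [err [iv merr err0 Fv [ierr cv]]]] := bochner_approx.
have bk k : (`|\int[nu]_(t in D) v k t|%:E <=
    \int[nu]_(t in D) G t + \int[nu]_(t in D) err k t)%E.
  have ms := measurable_int _ (iv k).
  apply: (@le_trans _ _ (\int[nu]_(t in D) `|(v k t)%:E|)%E).
    have := le_abse_integral nu mD ms; apply: le_trans.
    by rewrite /Rintegral -abse_EFin fineK//; exact: (integrable_fin_num mD (iv k)).
  rewrite -ge0_integralD//.
  apply: ae_ge0_le_integral => //.
  - exact: measurableT_comp ms.
  - by move=> t Dt; rewrite adde_ge0// G0.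
  - exact: emeasurable_funD.
  apply: filterS2 Fv FG => t Ft Gt Dt.
  apply: le_trans (leeD (Gt Dt) (Ft Dt k)); rewrite -EFinD lee_fin.
  rewrite -{1}(subKr (coef (F t)) (v k t)); exact: ler_normB.
have [Gfin|] := boolP (\int[nu]_(t in D) G t \is a fin_num)%E; last first.
  by rewrite ge0_fin_numE ?integral_ge0// -leNgt leye_eq => /eqP ->; rewrite leey.
have cvn : (fun k => `|\int[nu]_(t in D) v k t|%:E) @ \oo --> `|coef h|%:E.
  by apply: cvg_EFin; [exact: nearW|exact: cvg_norm].
have cvr : (fun k => \int[nu]_(t in D) G t + \int[nu]_(t in D) err k t)%E
    @ \oo --> (\int[nu]_(t in D) G t + 0)%E.
  by apply: cvgeD => //; [rewrite fin_num_adde_defr|exact: cvg_cst].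
rewrite -[leRHS]adde0 -(cvg_lim _ cvr)// -(cvg_lim _ cvn)//; apply: lee_lim.
- by apply/cvg_ex; eexists; exact: cvn.
- by apply/cvg_ex; eexists; exact: cvr.
- exact: nearW.
Qed.

Lemma bochner_coef (p : X -> R) : nu.-integrable D (EFin \o p) ->
  (forall t, D t -> coef (F t) = p t) -> coef h = \int[nu]_(t in D) p t.
Proof.
move=> ip_ Fp; have [v [err [iv merr err0 Fv [ierr cv]]]] := bochner_approx.
apply: (cvg_unique _ cv) => //; apply/subr_cvg0/norm_cvg0P.
have bk k : (`|\int[nu]_(t in D) v k t - \int[nu]_(t in D) p t|%:E <=
    \int[nu]_(t in D) err k t)%E.
  have id_ : nu.-integrable D (EFin \o (fun t => v k t - p t)).
    by have := integrableB mD (iv k) ip_; apply: eq_integrable.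
  rewrite -RintegralB//; have ms := measurable_int _ id_.
  apply: (@le_trans _ _ (\int[nu]_(t in D) `|(v k t - p t)%:E|)%E).
    have := le_abse_integral nu mD ms; apply: le_trans.
    by rewrite /Rintegral -abse_EFin fineK//; exact: (integrable_fin_num mD id_).
  apply: ae_ge0_le_integral => //; first exact: measurableT_comp ms.
  apply: filterS Fv => t Ft Dt; apply: le_trans (Ft Dt k).
  by rewrite Fp// distrC.
have : (fun k => `|\int[nu]_(t in D) v k t - \int[nu]_(t in D) p t|%:E) @ \oo --> 0%E.
  apply: (@squeeze_cvge _ _ _ _ (fun=> 0%E) _ (fun k => \int[nu]_(t in D) err k t)%E) => //.
    by apply: nearW => k; rewrite bk andbT lee_fin.
  exact: cvg_cst.
by move/fine_cvg.
Qed.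

End Coef.

End BochnerCoef.

Lemma measurable_sum_ord d (T : measurableType d) (R : realType) (D : set T) n
    (h : nat -> T -> R) : (forall i, measurable_fun D (h i)) ->
  measurable_fun D (fun x => \sum_(i < n) h i x).
Proof. by move=> mh; apply: measurable_sum => i. Qed.

(** Pythagoras: an arbitrary choice of N coefficients errs by its distance to the true ones plus the
    energy of the remaining modes. *)
Lemma ip_sub_psum_gen d (T : measurableType d) (R : realType) (mu : {measure set T -> \bar R})
    (e : nat -> T -> R) (se : forall n, sqint mu (e n))
    (oe : forall m n, ip mu (e m) (e n) = (m == n)%:R) (f : T -> R) (a : nat -> R) N :
  sqint mu f ->
  ip mu (fun x => f x - psum e a N x) (fun x => f x - psum e a N x) =
  \sum_(k < N) (ip mu f (e k) - a k) ^+ 2 + (ip mu f f - \sum_(k < N) ip mu f (e k) ^+ 2).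
Proof.
move=> sf; have sp := sqint_psum se a N.
rewrite ipBB// (ip_psum2 se oe) ipC (ip_psuml se)//.
have -> : \sum_(k < N) (ip mu f (e k) - a k) ^+ 2 =
    \sum_(k < N) ip mu f (e k) ^+ 2 - 2 * \sum_(k < N) a k * ip mu (e k) f + \sum_(k < N) a k ^+ 2.
  rewrite mulr_sumr -sumrB -big_split/=; apply: eq_bigr => k _.
  by rewrite (ipC mu f); ring.
by ring.
Qed.

(** * Existence of the Bochner integral from measurable bounded coefficients *)

Section BochnerExists.
Context d' (X : measurableType d') (R : realType).
Variables (nu : {measure set X -> \bar R}) (D : set X) (B : R).
Hypotheses (mD : measurable D) (nuD : (nu D < +oo)%E).
Local Notation mu := (leb R).
Local Notation psi := (@hermite_fun R).
Implicit Types (P Q : nat -> X -> R) (p : X -> R) (g : lebR R -> R).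

(** Bounds every coefficient, because x^2 <= B gives |x| <= B + 1. *)
Let C : R := `|B| + 1.

Let C0 : 0 <= C.
Proof. by rewrite addr_ge0. Qed.

(** Enough steps of length 1 / (k + 1) to cross [-C, C]. *)
Definition nlevels k : nat := Num.bound (2 * C * k.+1%:R).

(* [level] and [quant] round [p] down to the grid [- C + i / (k + 1)], the
   rounding being a sum of indicators of superlevel sets so that it also makes
   sense after integration. *)
Definition level k p i : set X := [set t | i.+1%:R / k.+1%:R - C <= p t].

Definition quant k (c : set X -> R) p : R :=
  - C * c setT + \sum_(i < nlevels k) c (level k p i) * k.+1%:R^-1.

Definition emb (b : bool) (y : R) : R[i] := if b then Complex 0 y else Complex y 0.

(** The pair on [setT] carries the offset - C of the rounding, and each level set adds one grid
    step. *)
Definition mode b k p g : L2simple (lebR R) X R :=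
  (setT, fun x => emb b (- C * g x)) ::
  [seq (level k p i, fun x => emb b (k.+1%:R^-1 * g x)) | i <- iota 0 (nlevels k)].

Fixpoint modes b k P M : L2simple (lebR R) X R :=
  if M is m.+1 then modes b k P m ++ mode b k (P m) (psi m) else [::].

Lemma embD b y z : emb b (y + z) = emb b y + emb b z.
Proof. by case: b; rewrite /emb; simpc. Qed.

Lemma embZ b y z : real_complex R y * emb b z = emb b (y * z).
Proof. by case: b; rewrite /emb; simpc. Qed.

Lemma emb0 b : emb b 0 = 0.
Proof. by case: b. Qed.

Lemma emb_sum b I (r : seq I) (F : I -> R) :
  emb b (\sum_(i <- r) F i) = \sum_(i <- r) emb b (F i).
Proof. by elim: r => [|i r IH]; rewrite ?big_nil ?emb0// !big_cons embD IH. Qed.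

Lemma wsum_mode c b k p g x : wsum c (mode b k p g) x = emb b (quant k c p * g x).
Proof.
rewrite /wsum big_cons big_map.
have -> : quant k c p * g x = c setT * (- C * g x) +
    \sum_(i < nlevels k) c (level k p i) * (k.+1%:R^-1 * g x).
  rewrite /quant mulrDl mulr_suml; congr (_ + _); first by ring.
  by apply: eq_bigr => i _; rewrite mulrA.
rewrite (@embD b (c setT * (- C * g x))) -embZ; congr (_ + _).
rewrite -(big_mkord xpredT (fun i => c (level k p i) * (k.+1%:R^-1 * g x))) /index_iota subn0.
by rewrite emb_sum; apply: eq_bigr => i _; rewrite embZ.
Qed.

Lemma wsum_modes c b k P M x :
  wsum c (modes b k P M) x = emb b (psum psi (fun m => quant k c (P m)) M x).
Proof.
elim: M => [|M IH]; first by rewrite /wsum big_nil /psum big_ord0 emb0.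
have -> : wsum c (modes b k P M.+1) x =
    wsum c (modes b k P M) x + wsum c (mode b k (P M) (psi M)) x by exact: big_cat.
by rewrite IH wsum_mode -embD /psum big_ord_recr.
Qed.

Lemma round_le (N y : R) K : 0 < N -> 0 <= y -> y <= K.+1%:R / N ->
  y - N^-1 <= \sum_(i < K) (i.+1%:R / N <= y)%R%:R * N^-1 <= y.
Proof.
move=> N0 y0; elim: K => [|K IH] yK.
  rewrite big_ord0 y0 subr_le0; apply/andP; split => //.
  by move: yK; rewrite mul1r.
rewrite big_ord_recr/=; have [yK1|yK1] := leP (K.+1%:R / N) y; last first.
  by rewrite mul0r addr0; apply: IH; exact: ltW.
rewrite mul1r (eq_bigr (fun=> N^-1)) => [|i _]; last first.
  rewrite (le_trans _ yK1) ?mul1r// ler_pM2r ?invr_gt0// ler_nat ltnS ltnW//.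
rewrite sumr_const card_ord -[N^-1 *+ K]mulr_natl.
move: yK yK1; rewrite -!natr1 => yK yK1.
by apply/andP; split; lra.
Qed.

Lemma quant_indic k p t : `|p t| <= C ->
  `|p t - quant k (fun E => \1_E t) p| <= k.+1%:R^-1.
Proof.
move=> pC; rewrite /quant indicE in_setT mulr1.
have k0 : 0 < k.+1%:R :> R by rewrite ltr0n.
have H : p t + C - k.+1%:R^-1 <= \sum_(i < nlevels k) (i.+1%:R / k.+1%:R <= p t + C)%R%:R * k.+1%:R^-1
    <= p t + C.
  move: pC; rewrite ler_norml => /andP[p1 p2].
  apply: round_le => //; first by lra.
  apply: (@le_trans _ _ (2 * C)); first by lra.
  rewrite ler_pdivlMr//; apply: ltW; apply: (@lt_le_trans _ _ (nlevels k)%:R); last by rewrite ler_nat.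
  apply: archi_boundP; by rewrite mulr_ge0 ?(ltW k0)// mulr_ge0.
have -> : \sum_(i < nlevels k) (\1_(level k p i) t : R) * k.+1%:R^-1 =
  \sum_(i < nlevels k) (i.+1%:R / k.+1%:R <= p t + C)%R%:R * k.+1%:R^-1.
  apply: eq_bigr => i _; rewrite indicE; congr (_%:R * _).
  by congr nat_of_bool; apply/idP/idP; rewrite inE /level /= lerBlDr.
have u0 : 0 < k.+1%:R^-1 :> R by rewrite invr_gt0.
move: H; set S := \sum_(i < nlevels k) _ => /andP[H1 H2]; clearbody S.
move: u0 H1 H2; move: (k.+1%:R^-1) => u u0 H1 H2.
by rewrite ler_norml opprD opprK; apply/andP; split; lra.
Qed.

Lemma measurable_level k p i : measurable_fun setT p -> measurable (level k p i).
Proof.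
move=> mp; have := mp measurableT `[i.+1%:R / k.+1%:R - C, +oo[%classic (measurable_itv _).
rewrite setTI; congr measurable; apply/seteqP; split => t /=; rewrite /level/= in_itv/= ?andbT//.
Qed.

Lemma nu_cut (E : set X) : measurable E -> (nu (D `&` E) < +oo)%E.
Proof.
move=> mE; apply: le_lt_trans nuD; apply: le_measure; rewrite ?inE//.
exact: measurableI.
Qed.

Lemma quant_integral k p : measurable_fun setT p -> (forall t, D t -> `|p t| <= C) ->
  `|\int[nu]_(t in D) p t - quant k (fun E => fine (nu (D `&` E))) p| <=
  k.+1%:R^-1 * fine (nu D).
Proof.
move=> mp pC.
(* The scalar rounding is recovered from the mode with constant profile 1, read at the arbitrary
   point 0, so that [simple_coef_integral] applies to it. *)
have Hm q : q \in mode false k p (fun=> 1) -> measurable q.1 /\ (nu (D `&` q.1) < +oo)%E.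
  rewrite inE => /orP[/eqP ->/=|/mapP[i _ ->]/=].
    by split => //; exact: nu_cut.
  by have mL := measurable_level k i mp; split => //; exact: nu_cut.
have [iS ES] := simple_coef_integral (fun q => complex.Re (q.2 (0 : R))) mD Hm.
have E c : \sum_(q <- mode false k p (fun=> 1)) c q.1 * complex.Re (q.2 (0 : R)) = quant k c p.
  have := congr1 (@complex.Re R) (wsum_mode c false k p (fun=> 1) (0 : R)).
  by rewrite /wsum Re_sum /emb /= mulr1 => <-; apply: eq_bigr => q _; rewrite ReZ.
have EI : \int[nu]_(t in D) quant k (fun E => \1_E t) p = quant k (fun E => fine (nu (D `&` E))) p.
  rewrite -(E (fun E => fine (nu (D `&` E)))) -ES; apply: eq_Rintegral => t _.
  by rewrite -(E (fun E => \1_E t)).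
have iq : nu.-integrable D (EFin \o (fun t => quant k (fun E => \1_E t) p)).
  by move: iS; apply: eq_integrable => // t _ /=; rewrite -(E (fun E => \1_E t)).
have ip_ : nu.-integrable D (EFin \o p).
  apply: measurable_bounded_integrable => //; first exact: measurable_funTS.
  exists C; split; first exact: num_real.
  by move=> M CM t Dt /=; apply: le_trans (pC t Dt) (ltW CM).
rewrite -EI -RintegralB//; apply: le_trans (le_normr_Rintegral mD _) _.
  by have := integrableB mD ip_ iq; apply: eq_integrable.
rewrite -Rintegral_cst//; apply: le_Rintegral => //.
- by have := integrable_norm (integrableB mD ip_ iq); apply: eq_integrable.
- apply: measurable_bounded_integrable => //.
  by exists (k.+1%:R^-1); split; [exact: num_real|move=> M /ltW kM t Dt /=; rewrite ger0_norm].
- by move=> t Dt; apply: quant_indic; exact: pC.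
Qed.

Section Family.
Variables (F : X -> lebR R -> R[i]) (P Q : nat -> X -> R) (h : lebR R -> R[i]).
Hypothesis mP : forall m, measurable_fun setT (P m).
Hypothesis mQ : forall m, measurable_fun setT (Q m).
Hypothesis sF : forall t, D t -> csqint mu (F t).
Hypothesis FP : forall t, D t -> forall m, cre (F t) m = P m t.
Hypothesis FQ : forall t, D t -> forall m, cim (F t) m = Q m t.
Hypothesis FB : forall t, D t -> cip2 mu (F t) <= B.
Hypothesis sh : csqint mu h.
Hypothesis hP : forall m, cre h m = \int[nu]_(t in D) P m t.
Hypothesis hQ : forall m, cim h m = \int[nu]_(t in D) Q m t.

Let simple k : L2simple (lebR R) X R := modes false k P k ++ modes true k Q k.

Let rp k (c : set X -> R) m := quant k c (P m).
Let rq k (c : set X -> R) m := quant k c (Q m).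

Let wsum_simple k c x : wsum c (simple k) x = cpsum (rp k c) (rq k c) k x.
Proof.
have -> : wsum c (simple k) x = wsum c (modes false k P k) x + wsum c (modes true k Q k) x.
  exact: big_cat.
by rewrite !wsum_modes /emb /cpsum; simpc.
Qed.

Let simple_ok k : simple_integrable mu nu D (simple k).
Proof.
have Hg b m g : sqint mu g -> csqint mu (fun x => emb b (m * g x)).
  move=> sg; have sz := sqintZ m sg; have s0 := sqint0 mu.
  by case: b; split.
have Hm b (S : nat -> X -> R) M : (forall m, measurable_fun setT (S m)) ->
    simple_integrable mu nu D (modes b k S M).
  move=> mS; elim: M => [//|M IH] p; rewrite mem_cat => /orP[/IH//|].
  rewrite inE => /orP[/eqP ->/=|/mapP[i _ ->]/=].
    have H := Hg b (- C) (psi M) (sqint_hermite M).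
    by split; [exact: measurableT|exact: nu_cut|exact/inL2P].
  have mL := measurable_level k i (mS M).
  have H := Hg b (k.+1%:R^-1) (psi M) (sqint_hermite M).
  by split; [exact: mL|exact: nu_cut|exact/inL2P].
by move=> p; rewrite mem_cat => /orP[]; exact: Hm.
Qed.

Let PC m t : D t -> `|P m t| <= C.
Proof.
move=> Dt; rewrite -FP//; have [sr _] := sF Dt.
have := bessel1 sqint_hermite ip_hermite m sr; rewrite -/(cre _ m) => H.
have : cre (F t) m ^+ 2 <= B.
  by apply: le_trans H _; apply: le_trans (FB Dt); rewrite lerDl ip_ge0.
rewrite -(real_normK (num_real (cre _ _))) => H2.
have := sqr_ge0 (`|cre (F t) m| - 1); have := ler_norm B; rewrite /C.
by have := sqr_ge0 `|cre (F t) m|; nra.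
Qed.

Let QC m t : D t -> `|Q m t| <= C.
Proof.
move=> Dt; rewrite -FQ//; have [_ si] := sF Dt.
have := bessel1 sqint_hermite ip_hermite m si; rewrite -/(cim _ m) => H.
have : cim (F t) m ^+ 2 <= B.
  by apply: le_trans H _; apply: le_trans (FB Dt); rewrite lerDr ip_ge0.
rewrite -(real_normK (num_real (cim _ _))) => H2.
have := sqr_ge0 (`|cim (F t) m| - 1); have := ler_norm B; rewrite /C.
by have := sqr_ge0 `|cim (F t) m|; nra.
Qed.

Let cip2_cpsum (f : lebR R -> R[i]) a b k : csqint mu f ->
  cip2 mu (fun x => f x - cpsum a b k x) =
  \sum_(m < k) ((cre f m - a m) ^+ 2 + (cim f m - b m) ^+ 2) +
  (cip2 mu f - \sum_(m < k) (cre f m ^+ 2 + cim f m ^+ 2)).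
Proof.
move=> [sr si]; rewrite cip2B /=.
rewrite (ip_sub_psum_gen sqint_hermite ip_hermite _ _ sr).
rewrite (ip_sub_psum_gen sqint_hermite ip_hermite _ _ si).
rewrite !big_split/= /cip2 -/(cre _ _) -/(cim _ _); ring.
Qed.

Let tail_cvg (f : lebR R -> R[i]) : csqint mu f ->
  (fun k => cip2 mu f - \sum_(m < k) (cre f m ^+ 2 + cim f m ^+ 2)) @ \oo --> 0.
Proof.
move=> [sr si]; rewrite -[X in _ --> X](subrr (cip2 mu f)); apply: cvgB; first exact: cvg_cst.
under eq_fun do rewrite big_split/=.
by apply: cvgD; exact: (parseval sqint_hermite ip_hermite hermite_complete).
Qed.

Let sum_round (u v : nat -> R) c k : (forall m, `|u m| <= c * k.+1%:R^-1) ->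
  (forall m, `|v m| <= c * k.+1%:R^-1) ->
  \sum_(m < k) (u m ^+ 2 + v m ^+ 2) <= 2 * c ^+ 2 * k.+1%:R^-1.
Proof.
move=> hu hv.
have k0 : 0 < k.+1%:R^-1 :> R by rewrite invr_gt0.
have H (y : R) : `|y| <= c * k.+1%:R^-1 -> y ^+ 2 <= (c * k.+1%:R^-1) ^+ 2.
  move=> yc; rewrite -(real_normK (num_real y)) ler_sqr ?nnegrE//.
  exact: le_trans (normr_ge0 _) yc.
apply: (@le_trans _ _ (\sum_(m < k) (2 * (c * k.+1%:R^-1) ^+ 2))).
  by apply: ler_sum => m _; rewrite mulr2n mulrDl !mul1r lerD// H.
rewrite sumr_const card_ord -[_ *+ k]mulr_natl exprMn (expr2 k.+1%:R^-1).
have -> : k%:R * (2 * (c ^+ 2 * (k.+1%:R^-1 * k.+1%:R^-1))) =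
  2 * c ^+ 2 * k.+1%:R^-1 * (k%:R * k.+1%:R^-1) :> R by ring.
have c0 : 0 <= 2 * c ^+ 2 * k.+1%:R^-1.
  by apply: mulr_ge0 (ltW k0); apply: mulr_ge0 => //; exact: sqr_ge0.
rewrite -[leRHS]mulr1 ler_wpM2l//.
by rewrite ler_pdivrMr// mul1r ler_nat.
Qed.

Let errE k t : D t -> L2norm mu setT (fun x => F t x - simple_value (simple k) t x) =
  (Num.sqrt (\sum_(m < k) ((P m t - rp k (fun E => \1_E t) m) ^+ 2 +
     (Q m t - rq k (fun E => \1_E t) m) ^+ 2) +
  (cip2 mu (F t) - \sum_(m < k) (P m t ^+ 2 + Q m t ^+ 2))))%:E.
Proof.
move=> Dt; have sFt := sF Dt.
transitivity (L2norm mu setT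
    (fun x => F t x - cpsum (rp k (fun E => \1_E t)) (rq k (fun E => \1_E t)) k x)).
  by congr L2norm; apply/funext => x; rewrite -wsum_simple.
have sc := csqint_cpsum (rp k (fun E => \1_E t)) (rq k (fun E => \1_E t)) k.
rewrite (L2normE (csqintB sFt sc)) (cip2_cpsum _ _ _ sFt).
congr ((Num.sqrt _)%:E); congr (_ + (_ - _)); apply: eq_bigr => m _.
  by rewrite (FP Dt) (FQ Dt).
by rewrite (FP Dt) (FQ Dt).
Qed.

Let err2 k t : R := \sum_(m < k) ((P m t - rp k (fun E => \1_E t) m) ^+ 2 +
     (Q m t - rq k (fun E => \1_E t) m) ^+ 2) +
  (cip2 mu (F t) - \sum_(m < k) (P m t ^+ 2 + Q m t ^+ 2)).

Let measurable_quant k p : measurable_fun setT p ->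
  measurable_fun setT (fun t => quant k (fun E => \1_E t) p).
Proof.
move=> mp; apply: measurable_funD; first by apply: measurable_funM.
apply: (@measurable_sum_ord _ _ _ _ _ (fun i t => \1_(level k p i) t * k.+1%:R^-1)) => i.
by apply: measurable_funM => //; apply: measurable_indic; exact: measurable_level.
Qed.

Let measurable_err2 k : measurable_fun D (err2 k).
Proof.
have mPQ N : measurable_fun D (fun t => \sum_(m < N) (P m t ^+ 2 + Q m t ^+ 2)).
  apply: measurable_funTS.
  apply: (@measurable_sum_ord _ _ _ _ _ (fun m t => P m t ^+ 2 + Q m t ^+ 2)) => m.
  by apply: measurable_funD; exact: measurable_funX.
apply: measurable_funD.
  apply: measurable_funTS.
  apply: (@measurable_sum_ord _ _ _ _ _ (fun m t => (P m t - rp k (fun E => \1_E t) m) ^+ 2 +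
     (Q m t - rq k (fun E => \1_E t) m) ^+ 2)) => m.
  apply: measurable_funD; apply: measurable_funX; apply: measurable_funB => //.
    exact: measurable_quant.
  exact: measurable_quant.
apply: measurable_funB (mPQ k).
(* Measurability of the squared norm in t comes from Parseval, which makes it a pointwise limit of
   sums of measurable coefficients. *)
suff : forall t, D t -> (fun N => \sum_(m < N) (P m t ^+ 2 + Q m t ^+ 2)) @ \oo --> cip2 mu (F t).
  by move=> cv; exact: (measurable_fun_cvg mPQ cv).
move=> t Dt.
have := tail_cvg (sF Dt) => H.
have {}H : (fun N => cip2 mu (F t) - (cip2 mu (F t) -
    \sum_(m < N) (cre (F t) m ^+ 2 + cim (F t) m ^+ 2))) @ \oo --> cip2 mu (F t) - 0.
  by apply: cvgB => //; exact: cvg_cst.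
rewrite subr0 in H; apply: cvg_trans H; apply: near_eq_cvg; apply: nearW => N.
by rewrite opprB addrC subrK; apply: eq_bigr => m _; rewrite FP// FQ.
Qed.

Let err2_round k t : D t -> \sum_(m < k) ((P m t - rp k (fun E => \1_E t) m) ^+ 2 +
     (Q m t - rq k (fun E => \1_E t) m) ^+ 2) <= 2 * k.+1%:R^-1.
Proof.
move=> Dt; have := @sum_round (fun m => P m t - rp k (fun E => \1_E t) m)
  (fun m => Q m t - rq k (fun E => \1_E t) m) 1 k.
rewrite expr1n mulr1 mul1r; apply => m.
  by apply: quant_indic; exact: PC.
by apply: quant_indic; exact: QC.
Qed.

Let err2_bound k t : D t -> 0 <= err2 k t <= 2 + B.
Proof.
move=> Dt; have H := err2_round k Dt.
have k1 : k.+1%:R^-1 <= 1 :> R by rewrite invf_le1 ?ler1n.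
have s0 : 0 <= \sum_(m < k) (P m t ^+ 2 + Q m t ^+ 2).
  by apply: sumr_ge0 => m _; rewrite addr_ge0 ?sqr_ge0.
have s1 : \sum_(m < k) (P m t ^+ 2 + Q m t ^+ 2) <= cip2 mu (F t).
  have [sr si] := sF Dt; rewrite /cip2 big_split/= lerD//.
    apply: le_trans (bessel sqint_hermite ip_hermite k sr).
    by apply: ler_sum => m _; rewrite -FP.
  apply: le_trans (bessel sqint_hermite ip_hermite k si).
  by apply: ler_sum => m _; rewrite -FQ.
have s2 : 0 <= \sum_(m < k) ((P m t - rp k (fun E => \1_E t) m) ^+ 2 +
     (Q m t - rq k (fun E => \1_E t) m) ^+ 2).
  by apply: sumr_ge0 => m _; rewrite addr_ge0 ?sqr_ge0.
have := FB Dt; rewrite /err2; move: s0 s1 s2 H.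
move: (\sum_(m < k) (P m t ^+ 2 + Q m t ^+ 2)) (\sum_(m < k) ((P m t - rp _ _ m) ^+ 2 + _)).
move: (k.+1%:R^-1) k1 (cip2 mu (F t)) => u u1 c S S'; move: (B) => b.
by move=> *; apply/andP; split; lra.
Qed.

Let inv_cvg0 (c : R) : (fun k => c * k.+1%:R^-1) @ \oo --> (0 : R).
Proof. by rewrite -(mulr0 c); apply: cvgMr; exact: cvg_harmonic. Qed.

Let err2_cvg t : D t -> err2^~ t @ \oo --> 0.
Proof.
move=> Dt; rewrite -(addr0 0); apply: cvgD.
  apply: (@squeeze_cvgr _ _ _ _ (fun=> 0) (fun k => 2 * k.+1%:R^-1)); last exact: inv_cvg0.
    apply: nearW => k; rewrite err2_round// andbT.
    by apply: sumr_ge0 => m _; rewrite addr_ge0 ?sqr_ge0.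
  exact: cvg_cst.
apply: cvg_trans (tail_cvg (sF Dt)); apply: near_eq_cvg; apply: nearW => k.
by congr (_ - _); apply: eq_bigr => m _; rewrite FP// FQ.
Qed.

Let measurable_err k : measurable_fun D (fun t => (Num.sqrt (err2 k t))%:E).
Proof.
apply/measurable_EFinP; apply: measurableT_comp (measurable_err2 k).
by apply: continuous_measurable_fun; exact: sqrt_continuous.
Qed.

Let err_cvg : (\int[nu]_(t in D) (Num.sqrt (err2 k t))%:E)%E @[k --> \oo] --> 0%E.
Proof.
have i1 : nu.-integrable D (cst (Num.sqrt (2 + B))%:E).
  have ms : measurable_fun D (cst (Num.sqrt (2 + B)) : X -> R) by exact: measurable_cst.
  apply: (measurable_bounded_integrable mD nuD ms).
  by exists (Num.sqrt (2 + B)); split; [exact: num_real|move=> M /ltW ? t Dt /=; rewrite ger0_norm].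
have cv : {ae nu, forall t, D t -> (fun k => (Num.sqrt (err2 k t))%:E) @ \oo --> 0%E}.
  apply: aeW => t Dt; apply: cvg_EFin; first exact: nearW.
  apply: (cvg_sqrt0 _).1; last exact: err2_cvg.
  by move=> k; have /andP[] := err2_bound k Dt.
have bd : {ae nu, forall t k, D t -> (`|(Num.sqrt (err2 k t))%:E| <= (Num.sqrt (2 + B))%:E)%E}.
  apply: aeW => t k Dt; have /andP[_ e2] := err2_bound k Dt.
  by rewrite lee_fin ger0_norm ?sqrtr_ge0// ler_wsqrtr.
have m0 : measurable_fun D (cst 0%E : X -> \bar R) by exact: measurable_cst.
have [_ _] := dominated_convergence mD measurable_err m0 cv i1 bd.
by rewrite integral0.
Qed.

(** The candidate h is given beforehand with the right coefficients. The error of the simple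
    functions tends to 0 at each t and is at most sqrt (2 + B), so its integral over D tends to 0.
    Their integrals converge to h by rounding and truncation again. *)
Lemma bochner_exists : is_bochner_integral mu nu D F h.
Proof.
split; first by apply: aeW => t Dt; apply/inL2P; exact: sF.
exists simple; split.
- exact: simple_ok.
- move=> k; apply: (eq_measurable_fun (fun t => (Num.sqrt (err2 k t))%:E)).
    by move=> t; rewrite inE => Dt; rewrite errE.
  exact: measurable_err.
- apply: cvg_trans err_cvg; apply: near_eq_cvg; apply: nearW => k.
  by apply: eq_integral => t; rewrite inE => Dt; rewrite errE.
have E k : simple_integral nu D (simple k) =
    cpsum (rp k (fun E => fine (nu (D `&` E)))) (rq k (fun E => fine (nu (D `&` E)))) k.
  by apply/funext => x; exact: wsum_simple.
have cE k : cip2 mu (fun x => simple_integral nu D (simple k) x - h x) =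
  \sum_(m < k) ((cre h m - rp k (fun E => fine (nu (D `&` E))) m) ^+ 2 +
    (cim h m - rq k (fun E => fine (nu (D `&` E))) m) ^+ 2) +
  (cip2 mu h - \sum_(m < k) (cre h m ^+ 2 + cim h m ^+ 2)).
  rewrite E -(cip2_cpsum _ _ _ sh) !cip2B; congr (_ + _); apply: eq_Rintegral => x _ /=; ring.
have cv : (fun k => \sum_(m < k) ((cre h m - rp k (fun E => fine (nu (D `&` E))) m) ^+ 2 +
    (cim h m - rq k (fun E => fine (nu (D `&` E))) m) ^+ 2)) @ \oo --> (0 : R).
  apply: (@squeeze_cvgr _ _ _ _ (fun=> 0) (fun k => 2 * fine (nu D) ^+ 2 * k.+1%:R^-1)).
  - apply: nearW => k; apply/andP; split.
      by apply: sumr_ge0 => m _; rewrite addr_ge0 ?sqr_ge0.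
    apply: (@sum_round (fun m => cre h m - rp k (fun E => fine (nu (D `&` E))) m)
      (fun m => cim h m - rq k (fun E => fine (nu (D `&` E))) m)) => m; rewrite mulrC.
      by rewrite hP; apply: quant_integral => // t Dt; exact: PC.
    by rewrite hQ; apply: quant_integral => // t Dt; exact: QC.
  - exact: cvg_cst.
  - exact: inv_cvg0.
have cD : (fun k => \sum_(m < k) ((cre h m - rp k (fun E => fine (nu (D `&` E))) m) ^+ 2 +
    (cim h m - rq k (fun E => fine (nu (D `&` E))) m) ^+ 2) +
  (cip2 mu h - \sum_(m < k) (cre h m ^+ 2 + cim h m ^+ 2))) @ \oo --> (0 + 0 : R).
  by apply: cvgD => //; exact: (tail_cvg sh).
apply/(is_L2limP _ sh) => [k|]; first by rewrite E; exact: csqint_cpsum.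
rewrite addr0 in cD; apply: cvg_trans cD; apply: near_eq_cvg; apply: nearW => k.
by rewrite cE.
Qed.

End Family.

End BochnerExists.

(** * Necessity of positive density *)

Section SliceEnergy.
Context d1 d2 (T1 : measurableType d1) (T2 : measurableType d2) (R : realType).
Variables (m1 : {sigma_finite_measure set T1 -> \bar R})
  (m2 : {sigma_finite_measure set T2 -> \bar R}) (D : set T1) (u : T1 * T2 -> R[i]).
Hypotheses (mD : measurable D) (L2u : inL2 (m1 \x m2)%E (D `*` setT) u).

Let mDT : measurable (D `*` setT : set (T1 * T2)).
Proof. exact: measurableX. Qed.

Definition energy2 : T1 * T2 -> \bar R :=
  (fun p => (normc (u p) ^+ 2)%:E) \_ (D `*` setT).

Let energy2_ge0 p : (0 <= energy2 p)%E.
Proof. by rewrite /energy2 patchE; case: ifP => // _; rewrite lee_fin sqr_ge0. Qed.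

Let measurable_energy2 : measurable_fun setT energy2.
Proof.
apply: (measurable_restrictT _ mDT).1; apply/measurable_EFinP.
have [mr mi] := L2u.1.
have pt p : normc (u p) ^+ 2 = complex.Re (u p) ^+ 2 + complex.Im (u p) ^+ 2.
  exact: normc_sqr.
rewrite (funext pt).
by apply: measurable_funD; exact: measurable_funX.
Qed.

(** Spatial energy of the control at time t. By Tonelli it has a finite integral, but it may be
    infinite at exceptional times. *)
Definition slice_energy (t : T1) : \bar R := \int[m2]_y energy2 (t, y).

Lemma slice_energy_ge0 t : (0 <= slice_energy t)%E.
Proof. by apply: integral_ge0 => y _; exact: energy2_ge0. Qed.

Lemma measurable_slice_energy : measurable_fun setT slice_energy.
Proof.
rewrite -[slice_energy]/(fubini_F m2 energy2).
by apply: measurable_fun_fubini_tonelli_F; [exact: measurable_energy2|exact: energy2_ge0].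
Qed.

Lemma slice_energy_fin : (\int[m1]_t slice_energy t < +oo)%E.
Proof.
rewrite -[X in (X < _)%E]/(\int[m1]_t fubini_F m2 energy2 t)%E.
rewrite -fubini_tonelli1//.
have [_] := L2u; rewrite /L2norm => /lty_poweRy H.
rewrite /energy2 -integral_mkcond; apply: H; exact: lt0r_neq0.
Qed.

Lemma slice_energy_fin_num : (\int[m1]_(t in D) slice_energy t \is a fin_num)%E.
Proof.
have s0 t : (0 <= slice_energy t)%E by exact: slice_energy_ge0.
rewrite ge0_fin_numE; last exact: integral_ge0.
apply: le_lt_trans slice_energy_fin; apply: ge0_subset_integral => //.
exact: measurable_slice_energy.
Qed.

Lemma csqint_control t : D t -> (slice_energy t < +oo)%E ->
  csqint m2 (fun y => u (t, y)) /\
  ((cip2 m2 (fun y => u (t, y)))%:E = slice_energy t)%E.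
Proof.
move=> Dt fin; have E y : energy2 (t, y) = (normc (u (t, y)) ^+ 2)%:E.
  by rewrite /energy2 patchE mem_set//; split.
have eE : slice_energy t = (\int[m2]_y (normc (u (t, y)) ^+ 2)%:E)%E.
  by apply: eq_integral => y _; exact: E.
have sec (f : T1 * T2 -> R) : measurable_fun (D `*` setT) f ->
    measurable_fun setT (fun y => f (t, y)).
  move=> /(measurable_restrictT _ mDT).1 /(measurable_fun_pair2 t).
  by apply: eq_measurable_fun => y _; rewrite patchE mem_set//; split.
have su : csqint m2 (fun y => u (t, y)).
  apply: csqintP; last by rewrite -eE.
  by split; [exact: (sec _ L2u.1.1)|exact: (sec _ L2u.1.2)].
by split => //; rewrite eE integral_normc2.
Qed.

End SliceEnergy.

Section AffineIntegral.
Context d (T : measurableType d) (R : realType) (mu : {measure set T -> \bar R}).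
Variables (D : set T) (U : T -> \bar R) (c k : R).
Hypotheses (mD : measurable D) (mU : measurable_fun D U) (U0 : forall t, (0 <= U t)%E).
Hypotheses (c0 : 0 <= c) (k0 : 0 <= k).

Lemma measurable_affine : measurable_fun D (fun t => c%:E * U t + k%:E)%E.
Proof. by apply: emeasurable_funD => //; exact: measurable_funeM. Qed.

Lemma affine_ge0 t : (0 <= c%:E * U t + k%:E)%E.
Proof. by rewrite adde_ge0 ?mule_ge0 ?lee_fin. Qed.

Lemma integral_affine :
  (\int[mu]_(t in D) (c%:E * U t + k%:E) = c%:E * \int[mu]_(t in D) U t + k%:E * mu D)%E.
Proof.
rewrite ge0_integralD//.
- by rewrite ge0_integralZl// integral_cst.
- by move=> t _; rewrite mule_ge0 ?lee_fin.
- exact: measurable_funeM.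
Qed.

End AffineIntegral.

Section ReIm.
Context d (T : measurableType d) (R : realType) (mu : {measure set T -> \bar R}).
Implicit Types (f g : T -> R[i]) (e : T -> R).

Lemma ip_ReD f g e : csqint mu f -> csqint mu g -> sqint mu e ->
  ip mu (fun x => complex.Re (f x + g x)) e =
  ip mu (fun x => complex.Re (f x)) e + ip mu (fun x => complex.Re (g x)) e.
Proof.
by move=> [fr _] [gr _] se; under eq_fun do rewrite ReD; exact: ipDl.
Qed.

Lemma ae_eq_ip_Re f g e : csqint mu f -> csqint mu g -> sqint mu e ->
  {ae mu, forall x, f x = g x} ->
  ip mu (fun x => complex.Re (f x)) e = ip mu (fun x => complex.Re (g x)) e.
Proof.
move=> [fr _] [gr _] se fg; apply: ae_eq_ip => //; last exact: aeW.
by apply: filterS fg => x ->.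
Qed.

End ReIm.

Section Observability.
Context {R : realType}.
Local Notation mu := (leb R).
Local Notation psi := (@hermite_fun R).
Variable omega : set (lebR R).
Hypothesis mo : measurable omega.

Definition opsi n (x : lebR R) : R := \1_omega x * psi n x.

Lemma measurable_indic_omega : measurable_fun setT (\1_omega : lebR R -> R).
Proof. exact: measurable_indic. Qed.

Lemma sqint_indicM (f : lebR R -> R) : sqint mu f -> sqint mu (fun x => \1_omega x * f x).
Proof.
move=> sf; apply: (le_sqint _ sf).
  exact: (measurable_funM measurable_indic_omega (sqint_measurable sf)).
move=> x; rewrite exprMn indicE; case: (x \in omega).
  by rewrite expr1n mul1r.
by rewrite expr0n mul0r sqr_ge0.
Qed.

Lemma sqint_opsi n : sqint mu (opsi n).
Proof. by apply: sqint_indicM; exact: sqint_hermite. Qed.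

Lemma indicM_idem (x : lebR R) : \1_omega x * \1_omega x = \1_omega x :> R.
Proof. by rewrite indicE; case: (x \in omega); rewrite ?mulr1 ?mulr0. Qed.

Lemma ip_opsi n : ip mu (opsi n) (opsi n) = \int[mu]_(x in omega) (psi n x ^+ 2).
Proof.
rewrite Rintegral_mkcond; apply: eq_Rintegral => x _.
rewrite /opsi mulrACA indicM_idem patchE indicE; case: (x \in omega).
  by rewrite mul1r expr2.
by rewrite mul0r.
Qed.

Lemma ip_indicM (f : lebR R -> R) n :
  ip mu (fun x => \1_omega x * f x) (psi n) = ip mu f (opsi n).
Proof. by apply: eq_Rintegral => x _; rewrite /opsi; ring. Qed.

Lemma ip_indicM_opsi (f : lebR R -> R) n :
  ip mu (fun x => \1_omega x * f x) (opsi n) = ip mu (fun x => \1_omega x * f x) (psi n).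
Proof.
apply: eq_Rintegral => x _; rewrite /opsi.
by rewrite mulrACA indicM_idem mulrA.
Qed.

Definition control_slice (f : lebR R -> R[i]) (y : lebR R) : R[i] :=
  real_complex R (\1_omega y) * f y.

Lemma csqint_slice f : csqint mu f -> csqint mu (control_slice f).
Proof.
move=> [fr fi]; split; rewrite /control_slice.
  by under eq_fun do rewrite ReZ; exact: sqint_indicM.
by under eq_fun do rewrite ImZ; exact: sqint_indicM.
Qed.

Lemma slice_coef_le f m : csqint mu f ->
  cre (control_slice f) m ^+ 2 + cim (control_slice f) m ^+ 2 <=
  cip2 mu f * ip mu (opsi m) (opsi m).
Proof.
move=> sf; have [fr fi] := sf.
have H (g : lebR R -> R) : sqint mu g ->
    ip mu (fun x => \1_omega x * g x) (psi m) ^+ 2 <= ip mu g g * ip mu (opsi m) (opsi m).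
  by move=> sg; rewrite ip_indicM; exact: (ip_CS sg (sqint_opsi m)).
rewrite /cip2 mulrDl /cre /cim /control_slice.
under [X in ip _ X _ ^+ 2 + _]eq_fun do rewrite ReZ.
under [X in _ + ip _ X _ ^+ 2]eq_fun do rewrite ImZ.
by rewrite lerD ?H.
Qed.

Lemma propagator_coef_le lam t f m : csqint mu f ->
  cre (propagator (harmonic lam) t f) m ^+ 2 <= cre f m ^+ 2 + cim f m ^+ 2.
Proof.
move=> sf; have [_ -> _] := propagatorP lam t sf.
have := sqr_ge0 (cos (t * lam m) * cim f m - sin (t * lam m) * cre f m).
have := cos2Dsin2 (t * lam m); move: (cos _) (sin _) (cre f m) (cim f m) => x y p q E H.
have -> : p ^+ 2 + q ^+ 2 = (x ^+ 2 + y ^+ 2) * (p ^+ 2 + q ^+ 2) by rewrite E mul1r.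
by rewrite -subr_ge0 (_ : _ - _ = (x * q - y * p) ^+ 2)//; ring.
Qed.

(** Replaces sqrt (V w) by an expression affine in V, which integrates in time once V is the slice
    energy. The parameter kappa is optimized only after integration. *)
Lemma amgm_sqr (x V w kappa : R) : 0 < kappa -> 0 <= V -> 0 <= w -> x ^+ 2 <= V * w ->
  `|x| <= kappa / 2 * V + w / (2 * kappa).
Proof.
move=> k0 V0 w0 xV.
rewrite -(@ler_pXn2r _ 2) ?nnegrE//; last first.
  by rewrite addr_ge0// ?mulr_ge0 ?divr_ge0 ?invr_ge0 ?mulr_ge0// ltW.
rewrite real_normK ?num_real//; apply: le_trans xV _.
rewrite -subr_ge0 (_ : _ - _ = (kappa / 2 * V - w / (2 * kappa)) ^+ 2) ?sqr_ge0//.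
by field; exact: lt0r_neq0.
Qed.

(** The choice kappa = |A| / (N + 1) recovers a Cauchy-Schwarz bound. Adding 1 to N avoids a
    division by zero for a vanishing energy. *)
Lemma sqr_le_of_amgm (A N w : R) : 0 <= N -> 0 <= w ->
  (forall kappa, 0 < kappa -> `|A| <= kappa / 2 * N + w / (2 * kappa)) ->
  A ^+ 2 <= (N + 1) * w.
Proof.
move=> N0 w0 H; rewrite -(real_normK (num_real A)).
have [->|A0] := eqVneq `|A| 0; first by rewrite expr0n mulr_ge0// addr_ge0.
have {}A0 : 0 < `|A| by rewrite lt_neqAle eq_sym A0 normr_ge0.
have N1 : 0 < N + 1 by lra.
have := H (`|A| / (N + 1)); rewrite divr_gt0// => /(_ isT).
move: (`|A|) A0 => a a0 Ha.
have : a * (2 * a / (N + 1)) <= a * (2 * a / (N + 1)) by [].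
have E1 : a / (N + 1) / 2 * N <= a / 2.
  rewrite -subr_ge0 (_ : _ - _ = a / (2 * (N + 1))); last by field; exact: lt0r_neq0.
  by rewrite divr_ge0 ?mulr_ge0// ltW.
have E2 : w / (2 * (a / (N + 1))) = w * (N + 1) / (2 * a).
  by field; rewrite !lt0r_neq0.
have : a / 2 <= w * (N + 1) / (2 * a) by rewrite -E2; lra.
rewrite ler_pdivlMr ?mulr_gt0//; rewrite (mulrC (N + 1)) expr2; lra.
Qed.

Lemma slice_control_bound lam (T : R) u m (kappa : R) (t s : R) :
  inL2 (mu \x mu)%E ((`]0, T[%classic : set (lebR R)) `*` setT) u -> 0 < kappa ->
  (`]0, T[%classic : set (lebR R)) t ->
  (`|cre (propagator (harmonic lam) s (control_slice (fun y => u (t, y)))) m|%:E <=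
    (kappa / 2)%:E * slice_energy mu `]0%R, T[%classic u t +
    (ip mu (opsi m) (opsi m) / (2 * kappa))%:E)%E.
Proof.
move=> L2u k0 Dt; have w0 := ip_ge0 mu (opsi m).
have U0 := slice_energy_ge0 mu `]0%R, T[%classic u t.
have [fin|] := boolP (slice_energy mu `]0%R, T[%classic u t < +oo)%E; last first.
  rewrite -leNgt leye_eq => /eqP ->; rewrite gt0_muley ?lte_fin ?divr_gt0//.
  by rewrite addye// leey.
have mD : measurable (`]0, T[%classic : set (lebR R)) by exact: measurable_itv_lebR.
have [su E] := csqint_control mD L2u Dt fin.
have -> : slice_energy mu `]0%R, T[%classic u t = (cip2 mu (fun y => u (t, y)))%:E by [].
rewrite -EFinM -EFinD lee_fin; apply: amgm_sqr => //; first exact: cip2_ge0.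
apply: le_trans (propagator_coef_le _ _ _ (csqint_slice su)) _.
exact: slice_coef_le.
Qed.

Lemma leb_itv_oo (T : R) : 0 < T -> leb R (`]0, T[%classic : set (lebR R)) = T%:E.
Proof.
move=> T0; have := @lebesgue_measure_itv R `]0, T[; rewrite /= lte_fin T0 oppr0 adde0 => H.
by transitivity (lebesgue_measure (`]0, T[%classic : set R)).
Qed.

(** Steer 0 to the state with coefficients a. The m-th coefficient of the Bochner integral only sees
    the control through 1_omega psi_m. With N the energy of the control, Cauchy-Schwarz in space and
    time gives the bound (N + 1) T. *)
Lemma controllable_coef_bound lam (T : R) a : 0 < T ->
  exactly_controllable (harmonic lam) omega T -> l2seq a ->
  exists B, forall m, a m ^+ 2 <= B * ip mu (opsi m) (opsi m).
Proof.
move=> T0 ec la.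
have l20 : l2seq (fun=> 0 : R) by exists 0 => N; rewrite big1// => k _; rewrite expr0n.
have [fT /L2lim_cpsum[sfT cfT _]] := ex_L2lim_cpsum la l20.
have s0 : csqint mu (fun=> 0) by exact: csqint0.
have [u [L2u _ mild]] := ec _ _ ((inL2P _ _).2 s0) ((inL2P _ _).2 sfT).
pose D : set (lebR R) := `]0, T[%classic.
have mD : measurable D by exact: measurable_itv_lebR.
have DT : leb R D = T%:E by exact: leb_itv_oo.
pose U := slice_energy mu D u.
pose F (t : lebR R) := propagator (harmonic lam) (T - t) (control_slice (fun y => u (t, y))).
pose h := bochner_integral mu mu D F.
have [p0 p0r _] := propagatorP lam T s0.
have hP : csqint mu h /\ (is_bochner_integral mu mu D F h \/ h = fun=> 0).
  (* If the integral does not exist, h is 0 by default, its coefficients vanish and the bound is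
     trivial. *)
  rewrite /h /bochner_integral; case: xgetP => [g -> Pg|].
    by split; [apply/inL2P; case: Pg => _ [s [_ _ _ []]]|left].
  by move=> _; split; [exact: csqint0|right].
have [sh hD] := hP.
have ch m : cre h m = a m.
  rewrite -cfT /cre -(ae_eq_ip_Re (csqintD p0 sh) sfT (sqint_hermite m) mild).
  rewrite (ip_ReD p0 sh (sqint_hermite m)).
  by rewrite -!/(cre _ _) p0r /cre /cim !ip0l !mulr0 !addr0 add0r.
have Ufin : (\int[mu]_(t in D) U t \is a fin_num)%E.
  exact: (slice_energy_fin_num mD L2u).
pose N := fine (\int[mu]_(t in D) U t)%E.
exists ((N + 1) * T) => m; rewrite -mulrA.
have N0 : 0 <= N by apply: fine_ge0; apply: integral_ge0 => t _; exact: slice_energy_ge0.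
have w0 := ip_ge0 mu (opsi m).
apply: sqr_le_of_amgm => //; first by rewrite mulr_ge0// ltW.
move=> kappa k0; rewrite -ch.
case: hD => [hb|->]; last first.
  rewrite /cre ip0l normr0; apply: addr_ge0; apply: mulr_ge0 => //.
  - by rewrite divr_ge0// ltW.
  - by rewrite mulr_ge0// ltW.
  - by rewrite invr_ge0 mulr_ge0// ltW.
have U0 t : (0 <= U t)%E by exact: slice_energy_ge0.
have mU : measurable_fun D U by apply: measurable_funTS; exact: (measurable_slice_energy mD L2u).
have k20 : 0 <= kappa / 2 by rewrite divr_ge0// ltW.
have wk0 : 0 <= ip mu (opsi m) (opsi m) / (2 * kappa) by rewrite divr_ge0// mulr_ge0// ltW.
have bd : {ae mu, forall t, D t -> (`|cre (F t) m|%:E <= (kappa / 2)%:E * U t +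
    (ip mu (opsi m) (opsi m) / (2 * kappa))%:E)%E}.
  by apply: aeW => t Dt; exact: slice_control_bound.
have e1 : ip mu (psi m) (psi m) = 1 by rewrite ip_hermite eqxx.
have H := bochner_coef_le (b := false) mD (sqint_hermite m) e1 hb (measurable_affine _ _ mU)
  (fun t _ => affine_ge0 U0 k20 wk0 t) bd.
rewrite -lee_fin; apply: le_trans H _.
have -> : (\int[mu]_(t in D) ((kappa / 2)%:E * U t +
    (ip mu (opsi m) (opsi m) / (2 * kappa))%:E))%E =
    ((kappa / 2)%:E * N%:E + (ip mu (opsi m) (opsi m) / (2 * kappa))%:E * T%:E)%E.
  rewrite [LHS](integral_affine mu mD mU U0 k20 wk0); congr (_ * _ + _ * _)%E.
    by rewrite -(fineK Ufin).
  exact: DT.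
rewrite -EFinM -EFinM -EFinD lee_fin lerD2l (mulrC T).
by rewrite [leRHS]mulrAC.
Qed.

Lemma controllable_density lam (T : R) : 0 < T ->
  exactly_controllable (harmonic lam) omega T -> (0 < lower_density omega)%E.
Proof.
move=> T0 ec.
have H a : l2seq a -> exists B, forall m, a m ^+ 2 <= B * ip mu (opsi m) (opsi m).
  exact: controllable_coef_bound ec.
have [c [N0 [c0 Hc]]] := l2_dominated_lower (fun n => ip_ge0 mu (opsi n)) H.
apply: (density_of_observed mo c0 (N0 := N0)) => n nN.
by rewrite -ip_opsi; exact: Hc.
Qed.

End Observability.

(** * Synthesis of a control *)

Section BoundedConvergence.
Context d (X : measurableType d) (R : realType).
Variables (nu : {measure set X -> \bar R}) (D : set X).
Hypotheses (mD : measurable D) (nuD : (nu D < +oo)%E).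
Implicit Types (f : nat -> X -> R) (g : X -> R) (C : R).

Lemma bounded_integrable g C : measurable_fun D g -> (forall t, D t -> `|g t| <= C) ->
  nu.-integrable D (EFin \o g).
Proof.
move=> mg gC; apply: (measurable_bounded_integrable mD nuD mg).
by exists C; split; [exact: num_real|move=> M /ltW CM t Dt; exact: le_trans (gC t Dt) CM].
Qed.

Lemma Rintegral_cvg_bounded f g C : (forall N, measurable_fun D (f N)) ->
  (forall N t, D t -> `|f N t| <= C) -> (forall t, D t -> f^~ t @ \oo --> g t) ->
  (fun N => \int[nu]_(t in D) f N t) @ \oo --> \int[nu]_(t in D) g t.
Proof.
move=> mf fC fg; have mg := measurable_fun_cvg mf fg.
have iC : nu.-integrable D (cst C%:E).
  by apply: (bounded_integrable (g := cst C) (C := `|C|)) => //; exact: measurable_cst.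
have cv : {ae nu, forall t, D t -> (fun N => (f N t)%:E) @ \oo --> (g t)%:E}.
  by apply: aeW => t Dt; apply: cvg_EFin; [exact: nearW|exact: fg].
have bd : {ae nu, forall t N, D t -> (`|(f N t)%:E| <= (cst C%:E : X -> \bar R) t)%E}.
  by apply: aeW => t N Dt; rewrite lee_fin; exact: fC.
have mfE N : measurable_fun D (fun t => (f N t)%:E) by apply/measurable_EFinP.
have mgE : measurable_fun D (fun t => (g t)%:E) by apply/measurable_EFinP.
have [ig _ H] := dominated_convergence mD mfE mgE cv iC bd.
by apply: fine_cvg; rewrite fineK//; exact: (integrable_fin_num mD ig).
Qed.

Lemma Rintegral_sum_ord f N : (forall n, nu.-integrable D (EFin \o f n)) ->
  nu.-integrable D (EFin \o (fun t => \sum_(n < N) f n t)) /\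
  \int[nu]_(t in D) (\sum_(n < N) f n t) = \sum_(n < N) \int[nu]_(t in D) f n t.
Proof.
move=> if_; elim: N => [|N [iS ES]].
  rewrite big_ord0; under eq_fun do rewrite big_ord0; split.
    by apply: (eq_integrable _ (cst 0%E)) => //; exact: integrable0.
  by rewrite Rintegral_cst// mul0r.
have pt t : \sum_(n < N.+1) f n t = \sum_(n < N) f n t + f N t by rewrite big_ord_recr.
split; first by have := integrableD mD iS (if_ N); apply: eq_integrable => // t _ /=; rewrite pt EFinD.
by under eq_Rintegral do rewrite pt; rewrite RintegralD// ES big_ord_recr.
Qed.

Lemma Rintegral_lin2 (x y : R) (f g : X -> R) :
  nu.-integrable D (EFin \o f) -> nu.-integrable D (EFin \o g) ->
  nu.-integrable D (EFin \o (fun t => x * f t + y * g t)) /\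
  \int[nu]_(t in D) (x * f t + y * g t) = x * \int[nu]_(t in D) f t + y * \int[nu]_(t in D) g t.
Proof.
move=> if_ ig.
have xf : nu.-integrable D (EFin \o (fun t => x * f t)).
  by have := integrableZl mD x if_; apply: eq_integrable.
have yg : nu.-integrable D (EFin \o (fun t => y * g t)).
  by have := integrableZl mD y ig; apply: eq_integrable.
split; first by have := integrableD mD xf yg; apply: eq_integrable.
by rewrite RintegralD// !RintegralZl.
Qed.

End BoundedConvergence.

Section JointlyMeasurable.
Context d1 d2 (T1 : measurableType d1) (T2 : measurableType d2) (R : realType).
Variables (m1 : {sigma_finite_measure set T1 -> \bar R})
  (m2 : {sigma_finite_measure set T2 -> \bar R}).

Section RieszFischer.
Variable e : nat -> T2 -> R.
Hypothesis se : forall n, sqint m2 (e n).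
Hypothesis oe : forall m n, ip m2 (e m) (e n) = (m == n)%:R.

(** The majorant q does not depend on t, so one subsequence works for every t. The upper limit of
    jointly measurable partial sums is then jointly measurable and restricts, at each t, to the
    Riesz-Fischer function. *)
Lemma joint_riesz_fischer (a : nat -> T1 -> R) (q : nat -> R) B :
  (forall n, measurable_fun setT (a n)) -> (forall n, 0 <= q n) -> (forall n t, a n t ^+ 2 <= q n) ->
  (forall N, \sum_(n < N) q n <= B) ->
  exists2 f : T1 * T2 -> R, measurable_fun setT f &
    forall t, [/\ sqint m2 (fun x => f (t, x)),
      forall n, ip m2 (fun x => f (t, x)) (e n) = a n t,
      ip m2 (fun x => f (t, x)) (fun x => f (t, x)) <= B &
      (fun N => ip m2 (fun x => psum e (a^~ t) N x - f (t, x))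
        (fun x => psum e (a^~ t) N x - f (t, x))) @ \oo --> 0].
Proof.
move=> ma q0 aq qB.
have [n_ [jn nS hn]] := tail_subseq q0 (ex_intro _ B qB).
pose H j (p : T1 * T2) := psum e (a^~ p.1) (n_ j) p.2.
have mH j : measurable_fun setT (H j).
  apply: (@measurable_sum_ord _ _ _ _ _ (fun k p => a k p.1 * e k p.2)) => k.
  apply: measurable_funM.
    exact: measurableT_comp (ma k) measurable_fst.
  exact: measurableT_comp (sqint_measurable (se k)) measurable_snd.
exists (flimsup H); first exact: measurable_flimsup.
move=> t.
have tl j N : \sum_(n_ j <= k < N) a k t ^+ 2 <= 4^-1 ^+ j.
  by apply: le_trans (hn j N); apply: ler_sum => k _.
have [sf cf lf] := riesz_fischer_subseq se oe jn nS tl.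
have lf' : (fun N => ip m2 (fun x => psum e (a^~ t) N x - flimsup H (t, x))
        (fun x => psum e (a^~ t) N x - flimsup H (t, x))) @ \oo --> 0.
  apply: cvg_trans lf; apply: near_eq_cvg; apply: nearW => N.
  by apply: eq_Rintegral => x _; rewrite -mulrNN !opprB.
split => //.
rewrite -subr_le0; apply: (cvg0_ge lf); apply: nearW => N.
rewrite -/(flimsup _).
have := ip_sub_psum se oe N sf.
have -> : (fun k => ip m2 (flimsup (fun j => psum e (a^~ t) (n_ j))) (e k)) = a^~ t.
  by apply/funext => k; rewrite cf.
move=> ->; rewrite lerB//; apply: le_trans (qB N); apply: ler_sum => k _.
by rewrite cf.
Qed.

End RieszFischer.

Lemma measurable_joint_mul (w : T1 -> R) (c : T2 -> R) (f : T1 * T2 -> R) :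
  measurable_fun setT w -> measurable_fun setT c -> measurable_fun setT f ->
  measurable_fun setT (fun p => w p.1 * (c p.2 * f p)).
Proof.
move=> mw mc mf; apply: measurable_funM.
  exact: measurableT_comp mw measurable_fst.
by apply: measurable_funM => //; exact: measurableT_comp mc measurable_snd.
Qed.

Lemma inL2_prod (u : T1 * T2 -> R[i]) (D : set T1) C : measurable D -> (m1 D < +oo)%E ->
  cmeasurable_fun setT u ->
  (forall t, D t -> csqint m2 (fun x => u (t, x)) /\ cip2 m2 (fun x => u (t, x)) <= C) ->
  inL2 (m1 \x m2)%E (D `*` setT) u.
Proof.
move=> mD D_fin [mr mi] uC.
have mDT : measurable (D `*` setT : set (T1 * T2)) by exact: measurableX.
split; first by split; exact: measurable_funTS.
apply: poweR_lty; rewrite integral_mkcond.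
set g := _ \_ _.
have g0 p : (0 <= g p)%E by rewrite /g patchE; case: ifP => // _; rewrite lee_fin sqr_ge0.
have mg : measurable_fun setT g.
  apply: (measurable_restrictT _ mDT).1; apply/measurable_EFinP; apply: measurable_funTS.
  have pt p : normc (u p) ^+ 2 = complex.Re (u p) ^+ 2 + complex.Im (u p) ^+ 2.
    exact: normc_sqr.
  by rewrite (funext pt); apply: measurable_funD; exact: measurable_funX.
rewrite fubini_tonelli1//.
apply: (@le_lt_trans _ _ (\int[m1]_t ((cst C%:E : T1 -> \bar R) \_ D) t)%E); last first.
  rewrite -integral_mkcond integral_cst//.
  have [r Dr] : exists r : R, m1 D = r%:E.
    by exists (fine (m1 D)); rewrite fineK// ge0_fin_numE.
  apply: (@le_lt_trans _ _ (C%:E * r%:E)%E); last by rewrite -EFinM ltry.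
  by rewrite -Dr; exact: lexx.
apply: ge0_le_integral => //.
- by move=> t _; apply: integral_ge0.
- exact: measurable_fun_fubini_tonelli_F.
- by apply: (measurable_restrictT _ mD).1; exact: measurable_cst.
move=> t _; rewrite patchE; case: ifPn => tD.
  have [|su uc] := uC t; first by move: tD; rewrite inE.
  apply: (@le_trans _ _ (\int[m2]_x (normc (u (t, x)) ^+ 2)%:E)%E).
    rewrite le_eqVlt; apply/orP; left; apply/eqP/eq_integral => x _.
    by rewrite /g patchE mem_set//; split => //; move: tD; rewrite inE.
  by rewrite integral_normc2// lee_fin.
rewrite /fubini_F integral0_eq// => x _; rewrite /g patchE memNset//.
by move=> [/= Dt _]; move: tD; rewrite mem_set.
Qed.

End JointlyMeasurable.

Section Synthesis.
Context {R : realType}.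
Local Notation mu := (leb R).
Local Notation psi := (@hermite_fun R).
Variable omega : set (lebR R).
Hypothesis mo : measurable omega.
Local Notation opsi := (opsi omega).
Local Notation control_slice := (control_slice omega).

Lemma sqr_le_norm (x B : R) : x ^+ 2 <= B -> `|x| <= B + 1.
Proof.
by rewrite -(real_normK (num_real x)) => H; have := sqr_ge0 (`|x| - 1); nra.
Qed.

Lemma coef_bound f m B : csqint mu f -> cip2 mu f <= B ->
  `|cre f m| <= B + 1 /\ `|cim f m| <= B + 1.
Proof.
move=> [fr fi] fB; split; apply: sqr_le_norm; apply: le_trans fB; rewrite /cip2.
  by apply: le_trans (bessel1 sqint_hermite ip_hermite m fr) _; rewrite lerDl ip_ge0.
by apply: le_trans (bessel1 sqint_hermite ip_hermite m fi) _; rewrite lerDr ip_ge0.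
Qed.

Lemma ip_psi_opsi n m : ip mu (psi n) (opsi m) = ip mu (opsi n) (opsi m).
Proof. by rewrite -(ip_indicM omega (psi n)) -(ip_indicM_opsi omega (psi n)). Qed.

Lemma ip_opsi_le1 m : ip mu (opsi m) (opsi m) <= 1.
Proof.
have := ip_CS (sqint_hermite m) (sqint_opsi mo m).
rewrite ip_psi_opsi ip_hermite eqxx mul1r expr2.
by have := ip_ge0 mu (opsi m); move: (ip _ _ _) => y y0 yy; nra.
Qed.

Lemma ip_opsi_abs m n : `|ip mu (opsi m) (opsi n)| <= 1.
Proof.
rewrite -(@ler_pXn2r _ 2) ?nnegrE// expr1n real_normK ?num_real//.
apply: le_trans (ip_CS (sqint_opsi mo m) (sqint_opsi mo n)) _.
by rewrite -[leRHS]mulr1 ler_pM ?ip_ge0 ?ip_opsi_le1.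
Qed.

Lemma ip_opsi_sqr (f : lebR R -> R) m B : sqint mu f -> ip mu f f <= B ->
  `|ip mu f (opsi m)| <= B + 1.
Proof.
move=> sf fB; have B0 := le_trans (ip_ge0 mu f) fB.
rewrite -(@ler_pXn2r _ 2) ?nnegrE ?addr_ge0// real_normK ?num_real//.
apply: le_trans (ip_CS sf (sqint_opsi mo m)) _.
apply: (@le_trans _ _ (B * 1)); first by rewrite ler_pM ?ip_ge0 ?ip_opsi_le1.
by rewrite mulr1; nra.
Qed.

Section Slice.
Variables (v0 : R) (fr fi : lebR R -> R).
Hypotheses (sr : sqint mu fr) (si : sqint mu fi).

(** The control at a fixed time, v0 being the value of the time profile there. *)
Definition cut (x : lebR R) : R[i] :=
  Complex (v0 * (\1_omega x * fr x)) (v0 * (\1_omega x * fi x)).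

Lemma csqint_cut : csqint mu cut.
Proof. by split; apply: sqintZ; exact: sqint_indicM. Qed.

Lemma slice_cut : control_slice cut = cut.
Proof.
apply/funext => x; rewrite /control_slice /cut; simpc.
by congr Complex; rewrite mulrCA (mulrA (\1_omega x)) indicM_idem.
Qed.

Lemma cre_cut m : cre cut m = v0 * ip mu fr (opsi m).
Proof.
by rewrite /cre /= (ipZl _ (sqint_indicM mo sr) (sqint_hermite m)) ip_indicM.
Qed.

Lemma cim_cut m : cim cut m = v0 * ip mu fi (opsi m).
Proof.
by rewrite /cim /= (ipZl _ (sqint_indicM mo si) (sqint_hermite m)) ip_indicM.
Qed.

Lemma ip_indicM_le (f : lebR R -> R) : sqint mu f ->
  ip mu (fun x => \1_omega x * f x) (fun x => \1_omega x * f x) <= ip mu f f.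
Proof.
move=> sf; have so := sqint_indicM mo sf; rewrite !ipE; apply: le_Rintegral => //.
- by case: so.
- by case: sf.
move=> x _; rewrite (exprMn 2 (\1_omega x)) indicE; case: (x \in omega).
  by rewrite expr1n mul1r.
by rewrite expr0n mul0r sqr_ge0.
Qed.

Lemma cip2_cut : cip2 mu cut <= v0 ^+ 2 * (ip mu fr fr + ip mu fi fi).
Proof.
have H f : sqint mu f -> ip mu (fun x => v0 * (\1_omega x * f x)) (fun x => v0 * (\1_omega x * f x)) <=
    v0 ^+ 2 * ip mu f f.
  move=> sf; have so := sqint_indicM mo sf; have soz := sqintZ v0 so.
  rewrite (ipZl _ so soz) ipC (ipZl _ so so) mulrA -expr2 ler_wpM2l ?sqr_ge0//.
  exact: ip_indicM_le.
by rewrite /cip2 /= mulrDr lerD ?H.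
Qed.

End Slice.

Lemma cip2_propagator lam t f : csqint mu f ->
  cip2 mu (propagator (harmonic lam) t f) <= cip2 mu f.
Proof.
move=> sf; have [[pr pi_] cr ci] := propagatorP lam t sf.
have [fr fi] := sf.
have cv : (fun N => \sum_(k < N) ip mu (fun x => complex.Re (propagator (harmonic lam) t f x)) (psi k) ^+ 2 +
    \sum_(k < N) ip mu (fun x => complex.Im (propagator (harmonic lam) t f x)) (psi k) ^+ 2) @ \oo -->
    cip2 mu (propagator (harmonic lam) t f).
  by apply: cvgD; exact: (parseval sqint_hermite ip_hermite hermite_complete).
rewrite -(cvg_lim _ cv)//; apply: limr_le; first by apply/cvg_ex; eexists; exact: cv.
apply: nearW => N; rewrite -big_split/=.
apply: (@le_trans _ _ (\sum_(k < N) (cre f k ^+ 2 + cim f k ^+ 2))); last first.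
  by rewrite big_split lerD ?(bessel sqint_hermite ip_hermite).
apply: ler_sum => k _; rewrite -/(cre _ _) -/(cim _ _) cr ci.
have := cos2Dsin2 (t * lam k); move: (cos _) (sin _) (cre f k) (cim f k) => x y p q E.
have -> : p ^+ 2 + q ^+ 2 = (x ^+ 2 + y ^+ 2) * (p ^+ 2 + q ^+ 2) by rewrite E mul1r.
by rewrite le_eqVlt; apply/orP; left; apply/eqP; ring.
Qed.

(** * Control built from a time profile even about T / 2 *)

Section Profile.
Variables (lam : nat -> R) (T W : R) (v : R -> R) (K b : nat -> nat -> R) (gap : R).
Hypothesis T0 : 0 < T.
Local Notation D := (`]0, T[%classic : set (lebR R)).
Hypothesis mv : measurable_fun (setT : set (lebR R)) v.
Hypothesis vW : forall t, D t -> `|v t| <= W.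
Hypothesis vK : forall m n c,
  \int[mu]_(t in D) (v t * cos ((t - T / 2) * (lam m - lam n) - c)) = cos c * K m n.
Hypothesis gap0 : 0 < gap.
Hypothesis Kd : forall m, gap <= K m m * ip mu (opsi m) (opsi m).
Hypothesis Kb : forall m n, m != n -> `|K m n| <= b m n.
Hypothesis b0 : forall m n, 0 <= b m n.
Hypothesis rowb : forall m N, \sum_(n < N) b m n <= gap / 2.
Hypothesis colb : forall n M, \sum_(m < M) b m n <= gap / 2.

Let mD : measurable D.
Proof. exact: measurable_itv_lebR. Qed.

Let D_fin : (mu D < +oo)%E.
Proof.
have -> : mu D = T%:E by exact: leb_itv_oo.
by rewrite ltry.
Qed.

Let W0 : 0 <= W.
Proof.
have DT : D (T / 2) by rewrite /= in_itv/= divr_gt0//= ltr_pdivrMr// mulr2n mulrDr mulr1 ltrDl.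
exact: le_trans (normr_ge0 _) (vW DT).
Qed.

Let measurable_phase (f : R -> R) (x y : R) : continuous f ->
  measurable_fun (setT : set (lebR R)) (fun t => f ((t - T / 2) * x - y)).
Proof.
move=> cf; apply: measurable_fun_lebR; apply: continuous_measurable_fun => t.
apply: (@continuous_comp _ _ _ (fun t : R => (t - T / 2) * x - y) f); last exact: cf.
apply: cvgB; last exact: cvg_cst.
apply: cvgM; last exact: cvg_cst.
by apply: cvgB; [exact: cvg_id|exact: cvg_cst].
Qed.

Section Data.
Variables gr gi : nat -> R.
Hypotheses (lgr : l2seq gr) (lgi : l2seq gi).

Let cphase m : R := T / 2 * lam m.

Let coupling m n : R := K m n * ip mu (opsi m) (opsi n).

Let solvable (g : nat -> R) : l2seq g -> exists2 phi, l2seq phi &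
  forall m, (fun N => \sum_(n < N) coupling m n * phi n) @ \oo --> g m.
Proof.
move=> lg; apply: (solve_diagonally_dominant (b := b) gap0) => // m n mn.
rewrite /coupling normrM; apply: le_trans (Kb mn).
by rewrite -[leRHS]mulr1 ler_wpM2l// ip_opsi_abs.
Qed.

(* Both real systems have the same real matrix because the time profile is even
   about [T / 2]; the phases are moved to the right-hand side. *)
Lemma resolving_amplitudes : exists alpha beta : nat -> R, [/\ l2seq alpha, l2seq beta,
  forall m, (fun N => \sum_(n < N) coupling m n *
     (alpha n * cos (cphase m) + beta n * sin (cphase m))) @ \oo --> gr m &
  forall m, (fun N => \sum_(n < N) coupling m n *
     (beta n * cos (cphase m) - alpha n * sin (cphase m))) @ \oo --> gi m].
Proof.
pose G m := cos (cphase m) * gr m + - sin (cphase m) * gi m.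
pose H m := cos (cphase m) * gi m + sin (cphase m) * gr m.
have lG : l2seq G by apply: l2seq_rot => // n; rewrite sqrrN cos2Dsin2.
have lH : l2seq H by apply: l2seq_rot => // n; rewrite cos2Dsin2.
have [alpha la Ha] := solvable lG; have [beta lb Hb] := solvable lH.
exists alpha, beta; split => // m.
  have -> : gr m = G m * cos (cphase m) + H m * sin (cphase m).
    rewrite /G /H -[LHS]mulr1 -(cos2Dsin2 (cphase m)); ring.
  have E N : \sum_(n < N) coupling m n * (alpha n * cos (cphase m) + beta n * sin (cphase m)) =
      (\sum_(n < N) coupling m n * alpha n) * cos (cphase m) +
      (\sum_(n < N) coupling m n * beta n) * sin (cphase m).
    by rewrite !mulr_suml -big_split/=; apply: eq_bigr => n _; ring.
  rewrite (funext E); apply: cvgD; apply: cvgM; [exact: Ha|exact: cvg_cst|exact: Hb|exact: cvg_cst].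
have -> : gi m = H m * cos (cphase m) - G m * sin (cphase m).
  rewrite /G /H -[LHS]mulr1 -(cos2Dsin2 (cphase m)); ring.
have E N : \sum_(n < N) coupling m n * (beta n * cos (cphase m) - alpha n * sin (cphase m)) =
    (\sum_(n < N) coupling m n * beta n) * cos (cphase m) -
    (\sum_(n < N) coupling m n * alpha n) * sin (cphase m).
  by rewrite !mulr_suml -sumrB; apply: eq_bigr => n _; ring.
rewrite (funext E); apply: cvgB; apply: cvgM; [exact: Hb|exact: cvg_cst|exact: Ha|exact: cvg_cst].
Qed.

End Data.

Let phase m n (t : R) : R := (t - T / 2) * (lam m - lam n) - T / 2 * lam m.

Let vcos_int m n : mu.-integrable D (EFin \o (fun t => v t * cos (phase m n t))) /\
  \int[mu]_(t in D) (v t * cos (phase m n t)) = cos (T / 2 * lam m) * K m n.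
Proof.
split; last exact: vK.
apply: (bounded_integrable mD D_fin (C := W)).
  apply: measurable_funTS; apply: (measurable_funM mv).
  by apply: measurable_phase; exact: continuous_cos.
move=> t Dt; rewrite normrM -[leRHS]mulr1 ler_pM ?vW// ler_norml.
by rewrite cos_geN1 cos_le1.
Qed.

Let vsin_int m n : mu.-integrable D (EFin \o (fun t => v t * sin (phase m n t))) /\
  \int[mu]_(t in D) (v t * sin (phase m n t)) = - sin (T / 2 * lam m) * K m n.
Proof.
split.
  apply: (bounded_integrable mD D_fin (C := W)).
    apply: measurable_funTS; apply: (measurable_funM mv).
    by apply: measurable_phase; exact: continuous_sin.
  move=> t Dt; rewrite normrM -[leRHS]mulr1 ler_pM ?vW// ler_norml.
  by rewrite sin_geN1 sin_le1.
(* A sine is a cosine delayed by a quarter turn, so [vK], assumed for every phase c, also gives the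
   sine integrals. *)
rewrite -cosDpihalf -vK; apply: eq_Rintegral => t _; congr (_ * _).
by rewrite opprD addrA -/(phase m n t) cosB cos_pihalf sin_pihalf mulr0 add0r mulr1.
Qed.

Let wave_integral m N (x y : nat -> R) :
  \int[mu]_(t in D) (\sum_(n < N) (x n * (v t * cos (phase m n t)) + y n * (v t * sin (phase m n t)))) =
  \sum_(n < N) (x n * cos (T / 2 * lam m) - y n * sin (T / 2 * lam m)) * K m n.
Proof.
have L n := Rintegral_lin2 mD (x n) (y n) (vcos_int m n).1 (vsin_int m n).1.
have [_ ->] := Rintegral_sum_ord mD (f := fun n t =>
  x n * (v t * cos (phase m n t)) + y n * (v t * sin (phase m n t))) N (fun n => (L n).1).
apply: eq_bigr => n _; rewrite (L n).2 (vcos_int m n).2 (vsin_int m n).2; ring.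
Qed.

Section Waves.
Variables (alpha beta : nat -> R) (B : R) (fr fi : lebR R * lebR R -> R).
Hypothesis abB : forall N, \sum_(n < N) (alpha n ^+ 2 + beta n ^+ 2) <= B.

Let theta n (t : R) : R := (T / 2 - t) * lam n.

(* Real and imaginary parts of [(alpha_n + i beta_n) e^{i (T / 2 - t) lam_n}]. *)
Definition wave_re n (t : lebR R) : R :=
  cos (theta n t) * alpha n - sin (theta n t) * beta n.

Definition wave_im n (t : lebR R) : R :=
  cos (theta n t) * beta n + sin (theta n t) * alpha n.

Hypothesis Hr : forall t, [/\ sqint mu (fun x => fr (t, x)),
      forall n, ip mu (fun x => fr (t, x)) (psi n) = wave_re n t,
      ip mu (fun x => fr (t, x)) (fun x => fr (t, x)) <= B &
      (fun N => ip mu (fun x => psum psi (wave_re^~ t) N x - fr (t, x))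
        (fun x => psum psi (wave_re^~ t) N x - fr (t, x))) @ \oo --> 0].
Hypothesis Hi : forall t, [/\ sqint mu (fun x => fi (t, x)),
      forall n, ip mu (fun x => fi (t, x)) (psi n) = wave_im n t,
      ip mu (fun x => fi (t, x)) (fun x => fi (t, x)) <= B &
      (fun N => ip mu (fun x => psum psi (wave_im^~ t) N x - fi (t, x))
        (fun x => psum psi (wave_im^~ t) N x - fi (t, x))) @ \oo --> 0].

Lemma wave_sqr n t : wave_re n t ^+ 2 + wave_im n t ^+ 2 = alpha n ^+ 2 + beta n ^+ 2.
Proof.
rewrite -[RHS]mul1r -(cos2Dsin2 (theta n t)) /wave_re /wave_im.
by move: (cos _) (sin _) => c s; ring.
Qed.

Lemma measurable_wave n : measurable_fun setT (wave_re n) /\ measurable_fun setT (wave_im n).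
Proof.
have E t : theta n t = (t - T / 2) * (- lam n) - 0 by rewrite /theta; ring.
have mc : measurable_fun setT (fun t : lebR R => cos (theta n t)).
  rewrite (funext (fun t => congr1 cos (E t))).
  by apply: measurable_phase; exact: continuous_cos.
have ms : measurable_fun setT (fun t : lebR R => sin (theta n t)).
  rewrite (funext (fun t => congr1 sin (E t))).
  by apply: measurable_phase; exact: continuous_sin.
split.
  exact: (measurable_funB (measurable_funM mc (measurable_cst (alpha n)))
    (measurable_funM ms (measurable_cst (beta n)))).
exact: (measurable_funD (measurable_funM mc (measurable_cst (beta n)))
    (measurable_funM ms (measurable_cst (alpha n)))).
Qed.

Let S (a : nat -> lebR R -> R) m N (t : lebR R) : R := \sum_(n < N) a n t * ip mu (psi n) (opsi m).

Let SE a m N t : S a m N t = ip mu (psum psi (a^~ t) N) (opsi m).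
Proof. exact/esym/(ip_psuml sqint_hermite (a^~ t) N (sqint_opsi mo m)). Qed.

Let S_cvg a m (f : lebR R -> R) t : sqint mu f ->
  (fun N => ip mu (fun x => psum psi (a^~ t) N x - f x) (fun x => psum psi (a^~ t) N x - f x)) @ \oo --> 0 ->
  (fun N => S a m N t) @ \oo --> ip mu f (opsi m).
Proof.
move=> sf cf; rewrite (funext (fun N => SE a m N t)).
have sp N : sqint mu (psum psi (a^~ t) N) by exact: (sqint_psum sqint_hermite).
exact: (cvg0_ip sp sf (sqint_opsi mo m) cf).
Qed.

Let S_bound (a : nat -> lebR R -> R) m N t : (forall M, \sum_(n < M) a n t ^+ 2 <= B) -> `|S a m N t| <= B + 1.
Proof.
move=> aB; rewrite SE; apply: ip_opsi_sqr; first exact: (sqint_psum sqint_hermite).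
by rewrite (ip_psum2 sqint_hermite ip_hermite).
Qed.

Let mS a m N : (forall n, measurable_fun setT (a n)) -> measurable_fun setT (S a m N).
Proof.
move=> ma; apply: (@measurable_sum_ord _ _ _ _ _ (fun n t => a n t * ip mu (psi n) (opsi m))) => n.
exact: (measurable_funM (ma n) (measurable_cst _)).
Qed.

Let wre_le t M : \sum_(n < M) wave_re n t ^+ 2 <= B.
Proof.
apply: le_trans (abB M); apply: ler_sum => n _.
by rewrite -(wave_sqr n t) lerDl sqr_ge0.
Qed.

Let wim_le t M : \sum_(n < M) wave_im n t ^+ 2 <= B.
Proof.
apply: le_trans (abB M); apply: ler_sum => n _.
by rewrite -(wave_sqr n t) lerDr sqr_ge0.
Qed.

Let X m (t : lebR R) : R := ip mu (fun x => fr (t, x)) (opsi m).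
Let Y m (t : lebR R) : R := ip mu (fun x => fi (t, x)) (opsi m).

(* Hermite coefficients of [e^{- i (T - t) A} (1_omega u(t))]. *)
Definition flux_re m (t : lebR R) : R :=
  v t * (cos ((T - t) * lam m) * X m t + sin ((T - t) * lam m) * Y m t).

Definition flux_im m (t : lebR R) : R :=
  v t * (cos ((T - t) * lam m) * Y m t - sin ((T - t) * lam m) * X m t).

Let X_cvg m t : (fun N => S wave_re m N t) @ \oo --> X m t.
Proof. by have [sf _ _ cf] := Hr t; exact: S_cvg. Qed.

Let Y_cvg m t : (fun N => S wave_im m N t) @ \oo --> Y m t.
Proof. by have [sf _ _ cf] := Hi t; exact: S_cvg. Qed.

Let phaseE m n t : phase m n t = theta n t - (T - t) * lam m.
Proof. by rewrite /phase /theta; field. Qed.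

Let flux_re_series m N t :
  v t * (cos ((T - t) * lam m) * S wave_re m N t + sin ((T - t) * lam m) * S wave_im m N t) =
  \sum_(n < N) (ip mu (psi n) (opsi m) * alpha n * (v t * cos (phase m n t)) +
    (- (ip mu (psi n) (opsi m) * beta n)) * (v t * sin (phase m n t))).
Proof.
rewrite /S !mulr_sumr -big_split mulr_sumr; apply: eq_bigr => n _ /=.
rewrite phaseE cosB sinB /wave_re /wave_im.
by move: (cos _) (sin _) (cos _) (sin _) (ip _ _ _) => c1 s1 c2 s2 M; ring.
Qed.

Let flux_im_series m N t :
  v t * (cos ((T - t) * lam m) * S wave_im m N t - sin ((T - t) * lam m) * S wave_re m N t) =
  \sum_(n < N) (ip mu (psi n) (opsi m) * beta n * (v t * cos (phase m n t)) +
    (ip mu (psi n) (opsi m) * alpha n) * (v t * sin (phase m n t))).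
Proof.
rewrite /S !mulr_sumr -sumrB mulr_sumr; apply: eq_bigr => n _ /=.
rewrite phaseE cosB sinB /wave_re /wave_im.
by move: (cos _) (sin _) (cos _) (sin _) (ip _ _ _) => c1 s1 c2 s2 M; ring.
Qed.

Let mcosT m : measurable_fun (setT : set (lebR R)) (fun t => cos ((T - t) * lam m)).
Proof.
have E t : (T - t) * lam m = (t - T / 2) * (- lam m) - (- (T / 2 * lam m)) by field.
rewrite (funext (fun t => congr1 cos (E t))).
by apply: measurable_phase; exact: continuous_cos.
Qed.

Let msinT m : measurable_fun (setT : set (lebR R)) (fun t => sin ((T - t) * lam m)).
Proof.
have E t : (T - t) * lam m = (t - T / 2) * (- lam m) - (- (T / 2 * lam m)) by field.
rewrite (funext (fun t => congr1 sin (E t))).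
by apply: measurable_phase; exact: continuous_sin.
Qed.

Let mSr m N : measurable_fun (setT : set (lebR R)) (S wave_re m N).
Proof. by apply: mS => n; have [] := measurable_wave n. Qed.

Let mSi m N : measurable_fun (setT : set (lebR R)) (S wave_im m N).
Proof. by apply: mS => n; have [] := measurable_wave n. Qed.

Let mX m : measurable_fun (setT : set (lebR R)) (X m).
Proof.
have cv (t : lebR R) : setT t -> (S wave_re m)^~ t @ \oo --> X m t by move=> _; exact: X_cvg.
exact: measurable_fun_cvg (mSr m) cv.
Qed.

Let mY m : measurable_fun (setT : set (lebR R)) (Y m).
Proof.
have cv (t : lebR R) : setT t -> (S wave_im m)^~ t @ \oo --> Y m t by move=> _; exact: Y_cvg.
exact: measurable_fun_cvg (mSi m) cv.
Qed.

Let measurable_rot (c s x y : lebR R -> R) : measurable_fun setT c -> measurable_fun setT s ->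
  measurable_fun setT x -> measurable_fun setT y ->
  measurable_fun (setT : set (lebR R)) (fun t : lebR R => v t * (c t * x t + s t * y t)) /\
  measurable_fun (setT : set (lebR R)) (fun t : lebR R => v t * (c t * x t - s t * y t)).
Proof.
move=> mc ms mx my; split.
  exact: (measurable_funM mv (measurable_funD (measurable_funM mc mx) (measurable_funM ms my))).
exact: (measurable_funM mv (measurable_funB (measurable_funM mc mx) (measurable_funM ms my))).
Qed.

Lemma measurable_flux m : measurable_fun (setT : set (lebR R)) (flux_re m) /\
  measurable_fun (setT : set (lebR R)) (flux_im m).
Proof.
split.
  exact: (measurable_rot (mcosT m) (msinT m) (mX m) (mY m)).1.
exact: (measurable_rot (mcosT m) (msinT m) (mY m) (mX m)).2.
Qed.

Let rot_bound m (t : lebR R) (x y : R) : D t -> `|x| <= B + 1 -> `|y| <= B + 1 ->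
  `|v t * (cos ((T - t) * lam m) * x + sin ((T - t) * lam m) * y)| <= W * (2 * (B + 1)) /\
  `|v t * (cos ((T - t) * lam m) * x - sin ((T - t) * lam m) * y)| <= W * (2 * (B + 1)).
Proof.
move=> Dt xB yB; have c1 : `|cos ((T - t) * lam m)| <= 1 by rewrite ler_norml cos_geN1 cos_le1.
have s1 : `|sin ((T - t) * lam m)| <= 1 by rewrite ler_norml sin_geN1 sin_le1.
have cx : `|cos ((T - t) * lam m) * x| <= B + 1.
  by rewrite (normrM (cos _)) -[leRHS]mul1r ler_pM.
have sy : `|sin ((T - t) * lam m) * y| <= B + 1.
  by rewrite (normrM (sin _)) -[leRHS]mul1r ler_pM.
split; rewrite (normrM (v t)) ler_pM ?vW//.
  by apply: le_trans (ler_normD _ _) _; lra.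
by apply: le_trans (ler_normB _ _) _; lra.
Qed.

(** Bounded convergence on the bounded interval D justifies integrating the Hermite expansion of the
    control term by term. *)
Let flux_limit (f : nat -> lebR R -> R) (g : lebR R -> R) l :
  (forall N, measurable_fun setT (f N)) ->
  (forall N t, D t -> `|f N t| <= W * (2 * (B + 1))) ->
  (forall t, f^~ t @ \oo --> g t) ->
  (fun N => \int[mu]_(t in D) f N t) @ \oo --> l -> \int[mu]_(t in D) g t = l.
Proof.
move=> mf fB fg fl.
have H := Rintegral_cvg_bounded mD D_fin (fun N => measurable_funTS (mf N)) fB (fun t _ => fg t).
exact: (cvg_unique _ H fl).
Qed.

(** Term by term the time integral produces [K m n] and the phase T lam_m / 2. The hypothesis is
    thus the first system solved in [resolving_amplitudes]. *)
Lemma flux_re_integral m l : (fun N => \sum_(n < N) K m n * ip mu (opsi m) (opsi n) *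
     (alpha n * cos (T / 2 * lam m) + beta n * sin (T / 2 * lam m))) @ \oo --> l ->
  \int[mu]_(t in D) flux_re m t = l.
Proof.
move=> cl; apply: (@flux_limit (fun N t => v t * (cos ((T - t) * lam m) * S wave_re m N t +
    sin ((T - t) * lam m) * S wave_im m N t))).
- by move=> N; exact: (measurable_rot (mcosT m) (msinT m) (mSr m N) (mSi m N)).1.
- move=> N t Dt; apply: (rot_bound m Dt _ _).1; first exact: (S_bound _ _ (wre_le t)).
  exact: (S_bound _ _ (wim_le t)).
- move=> t; apply: cvgM; first exact: cvg_cst.
  by apply: cvgD; apply: cvgM; [exact: cvg_cst|exact: X_cvg|exact: cvg_cst|exact: Y_cvg].
apply: cvg_trans cl; apply: near_eq_cvg; apply: nearW => N.
transitivity (\int[mu]_(t in D) \sum_(n < N) (ip mu (psi n) (opsi m) * alpha n * (v t * cos (phase m n t)) +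
    (- (ip mu (psi n) (opsi m) * beta n)) * (v t * sin (phase m n t)))); last first.
  by apply: eq_Rintegral => t _; rewrite flux_re_series.
rewrite (wave_integral m N (fun n => ip mu (psi n) (opsi m) * alpha n)
  (fun n => - (ip mu (psi n) (opsi m) * beta n))).
by apply: eq_bigr => n _; rewrite ip_psi_opsi (ipC _ (opsi n)); ring.
Qed.

Lemma flux_im_integral m l : (fun N => \sum_(n < N) K m n * ip mu (opsi m) (opsi n) *
     (beta n * cos (T / 2 * lam m) - alpha n * sin (T / 2 * lam m))) @ \oo --> l ->
  \int[mu]_(t in D) flux_im m t = l.
Proof.
move=> cl; apply: (@flux_limit (fun N t => v t * (cos ((T - t) * lam m) * S wave_im m N t -
    sin ((T - t) * lam m) * S wave_re m N t))).
- by move=> N; exact: (measurable_rot (mcosT m) (msinT m) (mSi m N) (mSr m N)).2.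
- move=> N t Dt; apply: (rot_bound m Dt _ _).2; first exact: (S_bound _ _ (wim_le t)).
  exact: (S_bound _ _ (wre_le t)).
- move=> t; apply: cvgM; first exact: cvg_cst.
  by apply: cvgB; apply: cvgM; [exact: cvg_cst|exact: Y_cvg|exact: cvg_cst|exact: X_cvg].
apply: cvg_trans cl; apply: near_eq_cvg; apply: nearW => N.
transitivity (\int[mu]_(t in D) \sum_(n < N) (ip mu (psi n) (opsi m) * beta n * (v t * cos (phase m n t)) +
    (ip mu (psi n) (opsi m) * alpha n) * (v t * sin (phase m n t)))); last first.
  by apply: eq_Rintegral => t _; rewrite flux_im_series.
rewrite (wave_integral m N (fun n => ip mu (psi n) (opsi m) * beta n)
  (fun n => ip mu (psi n) (opsi m) * alpha n)).
by apply: eq_bigr => n _; rewrite ip_psi_opsi (ipC _ (opsi n)); ring.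
Qed.

End Waves.

(** The control has to contribute h, the target minus the free evolution of f0. The amplitudes are
    chosen so that the flux coefficients integrate to those of h, and [bochner_exists] then
    certifies h as a Bochner integral. *)
Lemma controllable_of_profile : exactly_controllable (harmonic lam) omega T.
Proof.
move=> f0 fT /inL2P s0 /inL2P sT.
have [sp _ _] := propagatorP lam T s0.
have sh := csqintB sT sp.
set h := (fun x => fT x - propagator (harmonic lam) T f0 x) in sh.
have [alpha [beta [[Ba HBa] [Bb HBb] Ha Hb]]] :=
  resolving_amplitudes (l2seq_cre sh) (l2seq_cim sh).
have abB N : \sum_(n < N) (alpha n ^+ 2 + beta n ^+ 2) <= Ba + Bb.
  by rewrite big_split lerD.
have q0 n : 0 <= alpha n ^+ 2 + beta n ^+ 2 by rewrite addr_ge0 ?sqr_ge0.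
have qr n t : wave_re alpha beta n t ^+ 2 <= alpha n ^+ 2 + beta n ^+ 2.
  by rewrite -(wave_sqr alpha beta n t) lerDl sqr_ge0.
have qi n t : wave_im alpha beta n t ^+ 2 <= alpha n ^+ 2 + beta n ^+ 2.
  by rewrite -(wave_sqr alpha beta n t) lerDr sqr_ge0.
have [fr mfr Hr] := joint_riesz_fischer sqint_hermite ip_hermite
  (fun n => (measurable_wave alpha beta n).1) q0 qr abB.
have [fi mfi Hi] := joint_riesz_fischer sqint_hermite ip_hermite
  (fun n => (measurable_wave alpha beta n).2) q0 qi abB.
pose u (p : lebR R * lebR R) : R[i] :=
  Complex (v p.1 * (\1_omega p.2 * fr p)) (v p.1 * (\1_omega p.2 * fi p)).
have sfr t : sqint mu (fun x => fr (t, x)) by have [] := Hr t.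
have sfi t : sqint mu (fun x => fi (t, x)) by have [] := Hi t.
have uE t : (fun x => u (t, x)) = cut (v t) (fun x => fr (t, x)) (fun x => fi (t, x)) by [].
have uC t : D t -> csqint mu (fun x => u (t, x)) /\
    cip2 mu (fun x => u (t, x)) <= W ^+ 2 * ((Ba + Bb) + (Ba + Bb)).
  move=> Dt; rewrite uE; split; first exact: csqint_cut.
  apply: le_trans (cip2_cut _ (sfr t) (sfi t)) _.
  have [_ _ br _] := Hr t; have [_ _ bi _] := Hi t.
  apply: ler_pM; [exact: sqr_ge0|by rewrite addr_ge0 ?ip_ge0| |exact: lerD].
  by rewrite -(real_normK (num_real (v t))) ler_sqr ?nnegrE// vW.
have mu_ : cmeasurable_fun setT u.
  have mi := measurable_indic_omega mo.
  by split; [exact: measurable_joint_mul mv mi mfr|exact: measurable_joint_mul mv mi mfi].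
exists u; split.
- exact: (inL2_prod mD D_fin mu_ uC).
- apply: aeW => p _ op; rewrite /u indicE memNset// !mul0r !mulr0.
  by [].
pose F (t : lebR R) := propagator (harmonic lam) (T - t) (control_slice (fun x => u (t, x))).
have sS t : D t -> csqint mu (control_slice (fun x => u (t, x))).
  by move=> Dt; rewrite uE slice_cut; exact: (uC t Dt).1.
have sF t : D t -> csqint mu (F t).
  by move=> Dt; have [] := propagatorP lam (T - t) (sS t Dt).
have FP t : D t -> forall m, cre (F t) m = flux_re fr fi m t.
  move=> Dt m; have [_ -> _] := propagatorP lam (T - t) (sS t Dt).
  rewrite uE slice_cut cre_cut// cim_cut// /flux_re; ring.
have FQ t : D t -> forall m, cim (F t) m = flux_im fr fi m t.
  move=> Dt m; have [_ _ ->] := propagatorP lam (T - t) (sS t Dt).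
  rewrite uE slice_cut cre_cut// cim_cut// /flux_im; ring.
have FB t : D t -> cip2 mu (F t) <= W ^+ 2 * ((Ba + Bb) + (Ba + Bb)).
  move=> Dt; apply: le_trans (cip2_propagator _ _ (sS t Dt)) _.
  by rewrite uE slice_cut; exact: (uC t Dt).2.
have hP m : cre h m = \int[mu]_(t in D) flux_re fr fi m t.
  by apply/esym; exact: (flux_re_integral abB Hr Hi (Ha m)).
have hQ m : cim h m = \int[mu]_(t in D) flux_im fr fi m t.
  by apply/esym; exact: (flux_im_integral abB Hr Hi (Hb m)).
have mfl m := measurable_flux Hr Hi m.
have bh : is_bochner_integral mu mu D F h.
  exact: (bochner_exists mD D_fin (fun m => (mfl m).1) (fun m => (mfl m).2) sF FP FQ FB sh hP hQ).
(* The integral H selected by [bochner_integral] need not be the function h. The two agree almost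
   everywhere because their coefficients do. *)
pose H := bochner_integral mu mu D F.
have bH : is_bochner_integral mu mu D F H.
  exact: (@xgetPex _ (fun=> 0) [set q | is_bochner_integral mu mu D F q] (ex_intro _ _ bh)).
have sH : csqint mu H by apply/inL2P; case: bH => _ [s [_ _ _ []]].
have e1 m : ip mu (psi m) (psi m) = 1 by rewrite ip_hermite eqxx.
have iP m : mu.-integrable D (EFin \o flux_re fr fi m).
  apply: (bounded_integrable mD D_fin (C := W ^+ 2 * ((Ba + Bb) + (Ba + Bb)) + 1)).
    by apply: measurable_funTS; exact: (mfl m).1.
  by move=> t Dt; rewrite -(FP t Dt); exact: (coef_bound m (sF t Dt) (FB t Dt)).1.
have iQ m : mu.-integrable D (EFin \o flux_im fr fi m).
  apply: (bounded_integrable mD D_fin (C := W ^+ 2 * ((Ba + Bb) + (Ba + Bb)) + 1)).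
    by apply: measurable_funTS; exact: (mfl m).2.
  by move=> t Dt; rewrite -(FQ t Dt); exact: (coef_bound m (sF t Dt) (FB t Dt)).2.
have cH m : cre H m = cre h m.
  rewrite hP.
  exact: (bochner_coef (b := false) mD (sqint_hermite m) (e1 m) bH (iP m) (fun t Dt => FP t Dt m)).
have dH m : cim H m = cim h m.
  rewrite hQ.
  exact: (bochner_coef (b := true) mD (sqint_hermite m) (e1 m) bH (iQ m) (fun t Dt => FQ t Dt m)).
have hH := eq_coef sH sh cH dH.
apply: filterS hH => x Hx; rewrite /mild_solution.
have -> : fT x = propagator (harmonic lam) T f0 x + h x by rewrite /h addrC subrK.
by rewrite -Hx.
Qed.

End Profile.

End Synthesis.

(** * Time profiles *)

Section Profiles.
Context {R : realType}.
Local Notation mu := (leb R).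
Implicit Types (a delta c : R).

Lemma Rintegral_leb_oo (F f : R -> R) (x y : R) : x <= y ->
  (forall t : R, is_derive t 1 F (f t)) -> continuous f ->
  \int[mu]_(t in (`]x, y[%classic : set (lebR R))) f t = F y - F x.
Proof.
move=> xy dF cf; have mf : measurable_fun setT f by exact: continuous_measurable_fun.
rewrite -(Rintegral_FTC xy dF cf) Rintegral_leb//.
rewrite /Rintegral; congr fine.
have mfE : measurable_fun `]x, y[%classic (EFin \o f).
  by apply/measurable_EFinP; exact: measurable_funTS.
by rewrite -(@integral_itv_bndoo _ x y (EFin \o f) true false mfE).
Qed.

Lemma is_derive_sin_phase a delta c (x : R) :
  is_derive x 1 (fun t : R => sin ((t - a) * delta - c)) (delta * cos ((x - a) * delta - c)).
Proof.
have E t : (t - a) * delta - c = ((cst delta * id) + cst (- (a * delta) - c)) t.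
  by rewrite !fctE /GRing.scale /=; ring.
rewrite (_ : (fun t => _) = sin \o ((cst delta * id) + cst (- (a * delta) - c))).
  apply: is_derive_eq; rewrite E !fctE /GRing.scale/=; ring.
by apply/funext => t; rewrite E.
Qed.

Lemma is_derive_cos_phase a delta c (x : R) :
  is_derive x 1 (fun t : R => cos ((t - a) * delta - c)) (- delta * sin ((x - a) * delta - c)).
Proof.
have E t : (t - a) * delta - c = ((cst delta * id) + cst (- (a * delta) - c)) t.
  by rewrite !fctE /GRing.scale /=; ring.
rewrite (_ : (fun t => _) = cos \o ((cst delta * id) + cst (- (a * delta) - c))).
  apply: is_derive_eq; rewrite E !fctE /GRing.scale/=; ring.
by apply/funext => t; rewrite E.
Qed.

Lemma continuous_cos_phase a delta c : continuous (fun t : R => cos ((t - a) * delta - c)).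
Proof. by move=> x; exact: (is_derive_cont (f := fun x => - delta * sin ((x - a) * delta - c))
  (is_derive_cos_phase a delta c x)). Qed.

(** It vanishes at 0 and 2 a, so its Fourier transform about a decays like delta^-2, which is
    summable over the spectral gaps. The delta^-1 decay of an indicator would not be. *)
Definition parabola a (t : R) : R := a ^+ 2 - (t - a) ^+ 2.

Lemma is_derive_parabola a (x : R) : is_derive x 1 (parabola a) (- 2 * (x - a)).
Proof.
rewrite (_ : parabola a = cst (a ^+ 2) - (id - cst a) ^+ 2).
  by apply: is_derive_eq; rewrite !fctE /GRing.scale/=; ring.
by apply/funext => t; rewrite /parabola !fctE.
Qed.

Lemma is_derive_shift a (x : R) : is_derive x 1 (fun t : R => t - a) 1.
Proof.
rewrite (_ : (fun t : R => t - a) = id - cst a).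
  by apply: is_derive_eq; rewrite subr0.
by apply/funext => t; rewrite !fctE.
Qed.

(* Integral of [(a ^ 2 - rho ^ 2) cos (rho delta)] over [|rho| < a]. *)
Definition parabola_ft a delta : R :=
  if delta == 0 then 4 / 3 * a ^+ 3
  else 4 * sin (a * delta) / delta ^+ 3 - 4 * a * cos (a * delta) / delta ^+ 2.

Lemma continuous_parabola a : continuous (parabola a).
Proof. by move=> x; exact: (is_derive_cont (f := fun x => - 2 * (x - a)) (is_derive_parabola a x)). Qed.

Lemma parabola_fourier a delta c : 0 < a ->
  \int[mu]_(t in (`]0, 2 * a[%classic : set (lebR R))) (parabola a t * cos ((t - a) * delta - c)) =
  cos c * parabola_ft a delta.
Proof.
move=> a0; have ta : 0 <= 2 * a by rewrite mulr_ge0// ltW.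
have dQ := is_derive_parabola a; have dL := is_derive_shift a.
have cf : continuous (fun t => parabola a t * cos ((t - a) * delta - c)).
  by move=> t; apply: cvgM; [exact: continuous_parabola|exact: continuous_cos_phase].
rewrite /parabola_ft; have [d0|d0] := eqVneq delta 0.
  pose F : R -> R := cos c \*: (a ^+ 2 \*: (fun t => t - a) - 3^-1 \*: ((fun t => t - a) ^+ 3)).
  have dF (t : R) : is_derive t 1 F (parabola a t * cos ((t - a) * delta - c)).
    rewrite d0 mulr0 sub0r cosN /F; apply: is_derive_eq.
    by rewrite /parabola /GRing.scale/=; field.
  have FE t : F t = cos c * (a ^+ 2 * (t - a) - 3^-1 * (t - a) ^+ 3) by [].
  by rewrite (Rintegral_leb_oo ta dF cf) !FE; field.
have dS := is_derive_sin_phase a delta c; have dC := is_derive_cos_phase a delta c.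
pose S := fun t : R => sin ((t - a) * delta - c).
pose C := fun t : R => cos ((t - a) * delta - c).
pose L := fun t : R => t - a.
(* Antiderivative from repeated integration by parts. Its first term vanishes at both ends, which
   removes the order 1 / delta. *)
pose F : R -> R := delta^-1 \*: (parabola a * S) - (2 / delta ^+ 2) \*: (L * C) +
  (2 / delta ^+ 3) \*: S.
have dF (t : R) : is_derive t 1 F (parabola a t * cos ((t - a) * delta - c)).
  rewrite /F /S /C /L; apply: is_derive_eq.
  by rewrite /GRing.scale/=; field.
have FE t : F t = delta^-1 * (parabola a t * sin ((t - a) * delta - c)) -
    2 / delta ^+ 2 * ((t - a) * cos ((t - a) * delta - c)) +
    2 / delta ^+ 3 * sin ((t - a) * delta - c) by [].
rewrite (Rintegral_leb_oo ta dF cf) !FE /parabola.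
have -> : (2 * a - a) * delta = a * delta by ring.
have -> : (0 - a) * delta = - (a * delta) by ring.
rewrite sinB cosB sinB cosB cosN sinN.
by field.
Qed.

(** The bound is affine in a, while [parabola_ft a 0] grows like a^3. The hypothesis on delta turns
    4 / |delta| into the constant 2. *)
Lemma parabola_ft_bound a delta : 0 < a -> 2 <= `|delta| ->
  `|parabola_ft a delta| <= (4 * a + 2) / delta ^+ 2.
Proof.
move=> a0 d2; have d0 : delta != 0 by rewrite -normr_gt0; lra.
rewrite /parabola_ft (negbTE d0).
have -> : 4 * sin (a * delta) / delta ^+ 3 - 4 * a * cos (a * delta) / delta ^+ 2 =
  (4 * sin (a * delta) / delta - 4 * a * cos (a * delta)) / delta ^+ 2 by field.
rewrite normrM normfV (ger0_norm (sqr_ge0 delta)) ler_wpM2r ?invr_ge0 ?sqr_ge0//.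
apply: le_trans (ler_normB _ _) _; rewrite addrC lerD//.
  have a4 : 0 <= 4 * a by rewrite mulr_ge0// ltW.
  rewrite (normrM (4 * a)) (ger0_norm a4) -[leRHS]mulr1 ler_wpM2l//.
  by rewrite ler_norml cos_geN1 cos_le1.
have s1 : `|sin (a * delta)| <= 1 by rewrite ler_norml sin_geN1 sin_le1.
rewrite normrM normfV (normrM 4) (ger0_norm (x := 4))// ler_pdivrMr ?normr_gt0//.
lra.
Qed.

Section Control.
Variable omega : set (lebR R).
Hypothesis mo : measurable omega.
Local Notation opsi := (opsi omega).

Lemma density_observed : (0 < lower_density omega)%E ->
  exists2 c : R, 0 < c & forall n, c <= ip mu (opsi n) (opsi n).
Proof.
move=> /(hermite_observed mo)[c c0 Hc]; exists c => // n.
by rewrite ip_opsi.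
Qed.

Lemma gapped_controllable (lam : nat -> R) :
  (forall m n, (m < n)%N -> 2 * (n%:R - m%:R) <= lam n - lam m) ->
  (0 < lower_density omega)%E ->
  exists T : R, 0 < T /\ exactly_controllable (harmonic lam) omega T.
Proof.
move=> gap /density_observed[c c0 Hc].
(* Dominance requires 4 (a + 1/2) <= 2/3 a^3 c. As a >= 1 and a c >= 9, the right-hand side is at
   least 6 a, which suffices. *)
pose a : R := 1 + 9 / c; have a0 : 0 < a by rewrite addr_gt0// divr_gt0.
have gapn m n : m != n -> 2 * `|m%:R - n%:R| <= `|lam m - lam n|.
  rewrite neq_ltn => /orP[mn|nm].
    have -> : `|m%:R - n%:R| = n%:R - m%:R :> R.
      by rewrite distrC ger0_norm// subr_ge0 ler_nat ltnW.
    by rewrite (distrC (lam m)); apply: le_trans (gap _ _ mn) _; exact: ler_norm.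
  have -> : `|m%:R - n%:R| = m%:R - n%:R :> R.
    by rewrite ger0_norm// subr_ge0 ler_nat ltnW.
  by apply: le_trans (gap _ _ nm) _; exact: ler_norm.
have dist1 (m n : nat) : m != n -> 1 <= `|m%:R - n%:R| :> R.
  rewrite neq_ltn => /orP[mn|nm].
    rewrite distrC; apply: le_trans (ler_norm _).
    by rewrite lerBrDl natr1 ler_nat.
  by apply: le_trans (ler_norm _); rewrite lerBrDl natr1 ler_nat.
pose K m n : R := parabola_ft a (lam m - lam n).
(* The bound (4 a + 2) / delta^2 for delta^2 >= 4 (m - n)^2. *)
pose b m n : R := (a + 2^-1) * inv_sqr_dist m n.
have T0 : 0 < 2 * a by rewrite mulr_gt0.
exists (2 * a); split => //.
have half : 2 * a / 2 = a by field.
have mv : measurable_fun (setT : set (lebR R)) (parabola a).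
  by apply: measurable_fun_lebR; apply: continuous_measurable_fun; exact: continuous_parabola.
have vW (t : lebR R) : (`]0, 2 * a[%classic : set (lebR R)) t -> `|parabola a t| <= a ^+ 2.
  rewrite /= in_itv/= => /andP[t0 t2]; rewrite /parabola ger0_norm; last by nra.
  by rewrite lerBlDr lerDl sqr_ge0.
have vK m n z : \int[mu]_(t in (`]0, 2 * a[%classic : set (lebR R)))
    (parabola a t * cos ((t - 2 * a / 2) * (lam m - lam n) - z)) = cos z * K m n.
  by rewrite half parabola_fourier.
have g0 : 0 < 4 / 3 * a ^+ 3 * c by rewrite !mulr_gt0 ?exprn_gt0 ?divr_gt0.
have Kd m : 4 / 3 * a ^+ 3 * c <= K m m * ip mu (opsi m) (opsi m).
  by rewrite /K subrr /parabola_ft eqxx ler_pM2l ?mulr_gt0 ?exprn_gt0 ?divr_gt0.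
have Kb m n : m != n -> `|K m n| <= b m n.
  move=> mn; have d2 : 2 <= `|lam m - lam n|.
    by apply: le_trans (gapn _ _ mn); have := dist1 _ _ mn; lra.
  apply: le_trans (parabola_ft_bound a0 d2) _; rewrite /b /inv_sqr_dist (negbTE mn).
  have p : 0 < (m%:R - n%:R) ^+ 2 :> R.
    by rewrite -(real_normK (num_real _)) exprn_gt0// (lt_le_trans ltr01)// dist1.
  have H : 4 * (m%:R - n%:R) ^+ 2 <= (lam m - lam n) ^+ 2.
    rewrite -(real_normK (num_real (m%:R - n%:R))) -(real_normK (num_real (lam m - lam n))).
    have -> : 4 * `|m%:R - n%:R| ^+ 2 = (2 * `|m%:R - n%:R|) ^+ 2 :> R by ring.
    by rewrite ler_sqr ?nnegrE ?mulr_ge0// gapn.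
  have q : 0 < (lam m - lam n) ^+ 2 by apply: lt_le_trans H; rewrite mulr_gt0.
  rewrite ler_pdivrMr// mulrAC ler_pdivlMr//.
  have -> : (a + 2^-1) * (lam m - lam n) ^+ 2 = (4 * a + 2) * (4^-1 * (lam m - lam n) ^+ 2) by field.
  rewrite ler_wpM2l//; first by rewrite addr_ge0// mulr_ge0// ltW.
  lra.
have ah : 0 <= a + 2^-1 by rewrite addr_ge0 ?invr_ge0 ?ltW.
have b0 m n : 0 <= b m n by rewrite mulr_ge0// inv_sqr_dist_ge0.
have small : (a + 2^-1) * 4 <= 4 / 3 * a ^+ 3 * c / 2.
  have a1 : 1 <= a by rewrite lerDl divr_ge0// ltW.
  have ac : 9 <= a * c by rewrite /a mulrDl mul1r divfK ?lt0r_neq0// lerDr ltW.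
  have a2 : 9 <= a * (a * c).
    by apply: le_trans ac _; rewrite ler_peMl// mulr_ge0 ?ltW.
  have : 9 * a <= a * (a * c) * a by rewrite ler_wpM2r// ltW.
  have -> : 4 / 3 * a ^+ 3 * c / 2 = 2 / 3 * (a * (a * c) * a) by field.
  lra.
have rowb m N : \sum_(n < N) b m n <= 4 / 3 * a ^+ 3 * c / 2.
  by apply: le_trans small; rewrite -mulr_sumr ler_wpM2l// sum_inv_sqr_dist.
have colb n M : \sum_(m < M) b m n <= 4 / 3 * a ^+ 3 * c / 2.
  apply: le_trans small; rewrite -mulr_sumr ler_wpM2l//.
  by under eq_bigr do rewrite inv_sqr_distC; exact: sum_inv_sqr_dist.
exact: (controllable_of_profile mo T0 mv vW vK g0 Kd Kb b0 rowb colb).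
Qed.

(** x^s - y^s = x (x^(s-1) - y^(s-1)) + (x - y) y^(s-1), and s >= 1 makes the first term nonnegative
    and y^(s-1) at least 1. *)
Lemma powR_gap (s x y : R) : 1 <= s -> 1 <= y -> y <= x -> x - y <= x `^ s - y `^ s.
Proof.
move=> s1 y1 yx; have y0 : 0 < y by lra.
have x0 : 0 < x by lra.
have E (z : R) : 0 < z -> z `^ s = z * z `^ (s - 1).
  by move=> z0; rewrite -{2}(powRr1 (ltW z0)) -powRD ?(gt_eqF z0) ?implybT// addrC subrK.
have s0 : 0 <= s - 1 by lra.
have py1 : 1 <= y `^ (s - 1).
  by have := @ge0_ler_powR R _ s0 1 y; rewrite !nnegrE powR1 => H; apply: H => //; exact: ltW.
have pxy : y `^ (s - 1) <= x `^ (s - 1) by rewrite ge0_ler_powR ?nnegrE// ltW.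
rewrite (E x x0) (E y y0).
have := mulr_ge0 (ltW x0) (_ : 0 <= x `^ (s - 1) - y `^ (s - 1)); rewrite subr_ge0 => /(_ pxy).
have := mulr_ge0 (_ : 0 <= x - y) (_ : 0 <= y `^ (s - 1) - 1); rewrite !subr_ge0 => /(_ yx py1).
lra.
Qed.

Lemma fractional_gap (s : R) m n : 1 <= s -> (m < n)%N ->
  2 * (n%:R - m%:R) <= (2 * n + 1)%:R `^ s - (2 * m + 1)%:R `^ s.
Proof.
move=> s1 mn; apply: le_trans (powR_gap s1 _ _); last 2 first.
- by rewrite ler1n addn1.
- by rewrite ler_nat leq_add2r leq_mul2l ltnW// orbT.
have e k : (2 * k + 1)%:R = 2 * k%:R + 1 :> R by rewrite natrD natrM.
by rewrite !e; lra.
Qed.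

Lemma sin_natpi n : sin (n%:R * pi) = 0 :> R.
Proof.
by elim: n => [|n IH]; [rewrite mul0r sin0|rewrite -natr1 mulrDl mul1r sinDpi IH oppr0].
Qed.

Lemma harmonic_controllable (T : R) : (0 < lower_density omega)%E -> pi <= T ->
  exactly_controllable (fractional_harmonic (1 : R)) omega T.
Proof.
move=> /density_observed[c c0 Hc] piT.
have pi0 : 0 < pi :> R by exact: pi_gt0.
have T0 : 0 < T by exact: lt_le_trans piT.
pose lam n : R := (2 * n + 1)%:R `^ 1.
have lamE n : lam n = 2 * n%:R + 1 by rewrite /lam powRr1// natrD natrM.
(* An interval of length pi centred at T / 2, contained in (0, T) because pi <= T. Any remaining
   time is left without control. The matrix [K] becomes diagonal, so dominance holds with zero
   off-diagonal bounds. *)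
pose J : set R := `]T / 2 - pi / 2, T / 2 + pi / 2[%classic.
pose v : R -> R := \1_J.
pose K (m n : nat) : R := if m == n then pi else 0.
have mJ : measurable (J : set (measurableTypeR R)) by exact: measurable_itv.
have mv : measurable_fun (setT : set (lebR R)) v.
  by apply: measurable_fun_lebR; exact: measurable_indic.
have vW (t : lebR R) : (`]0, T[%classic : set (lebR R)) t -> `|v t| <= 1.
  by move=> _; rewrite /v indicE; case: (_ \in _); rewrite ?normr1 ?normr0.
have JT : T / 2 - pi / 2 <= T / 2 + pi / 2 by lra.
have subJ : J `<=` `]0, T[%classic.
  by move=> t; rewrite /J /= !in_itv/= => /andP[t1 t2]; apply/andP; split; lra.
have vint (f : R -> R) : \int[mu]_(t in (`]0, T[%classic : set (lebR R))) (v t * f t) =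
    \int[mu]_(t in (J : set (lebR R))) f t.
  rewrite Rintegral_mkcond [RHS]Rintegral_mkcond; apply: eq_Rintegral => t _.
  rewrite !patchE /v indicE; have [tJ|tJ] := boolP (t \in J).
    by rewrite mem_set ?mul1r//; apply: subJ; rewrite inE in tJ.
  by rewrite mul0r; case: ifP.
have vK m n z : \int[mu]_(t in (`]0, T[%classic : set (lebR R)))
    (v t * cos ((t - T / 2) * (lam m - lam n) - z)) = cos z * K m n.
  rewrite vint /K; have [->|mn] := eqVneq m n.
    have E t : cos ((t - T / 2) * (lam n - lam n) - z) = cos z.
      by rewrite subrr mulr0 sub0r cosN.
    pose F : R -> R := cos z \*: (fun t => t - T / 2).
    have dL := is_derive_shift (T / 2).
    have dF (t : R) : is_derive t 1 F (cos ((t - T / 2) * (lam n - lam n) - z)).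
      by rewrite E /F; apply: is_derive_eq; rewrite /GRing.scale/= mulr1.
    have FE t : F t = cos z * (t - T / 2) by [].
    rewrite (Rintegral_leb_oo JT dF); last exact: continuous_cos_phase.
    by rewrite !FE; field.
  set delta := lam m - lam n; have d0 : delta != 0.
    rewrite /delta !lamE subr_eq0; apply: contra mn => /eqP /addIr.
    by move=> /mulfI; rewrite pnatr_eq0 => /(_ isT) /eqP; rewrite eqr_nat.
  have dS := is_derive_sin_phase (T / 2) delta z.
  pose F : R -> R := delta^-1 \*: (fun t => sin ((t - T / 2) * delta - z)).
  have dF (t : R) : is_derive t 1 F (cos ((t - T / 2) * delta - z)).
    by rewrite /F; apply: is_derive_eq; rewrite /GRing.scale/= mulrA mulVf// mul1r.
  have FE t : F t = delta^-1 * sin ((t - T / 2) * delta - z) by [].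
  rewrite (Rintegral_leb_oo JT dF); last exact: continuous_cos_phase.
  rewrite !FE.
  (* Since delta = 2 (m - n), the half-length pi / 2 gives an integer multiple of pi, where the sine
     vanishes. *)
  have E1 : (T / 2 + pi / 2 - T / 2) * delta = m%:R * pi - n%:R * pi by rewrite /delta !lamE; field.
  have E2 : (T / 2 - pi / 2 - T / 2) * delta = - (m%:R * pi - n%:R * pi) by rewrite /delta !lamE; field.
  have sm0 : sin (m%:R * pi - n%:R * pi) = 0 :> R.
    by rewrite sinB !sin_natpi mul0r mulr0 subrr.
  rewrite E1 E2; move: (m%:R * pi - n%:R * pi) sm0 => theta sm0.
  by rewrite 2!sinB sinN cosN sm0; ring.
have g0 : 0 < pi * c by rewrite mulr_gt0.
have Kd m : pi * c <= K m m * ip mu (opsi m) (opsi m).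
  by rewrite /K eqxx ler_pM2l.
have Kb m n : m != n -> `|K m n| <= (fun _ _ => 0 : R) m n.
  by rewrite /K => /negbTE ->; rewrite normr0.
have b0 (m n : nat) : 0 <= (fun _ _ => 0 : R) m n by [].
have s0 N : \sum_(n < N) (0 : R) <= pi * c / 2.
  by rewrite big1// divr_ge0// ltW.
exact: (controllable_of_profile mo T0 mv vW vK g0 Kd Kb b0 (fun _ => s0) (fun _ => s0)).
Qed.

End Control.

End Profiles.

Theorem theorem2p2 (R : realType) (s : R) (hs : 1 <= s)
    (omega : set (lebR R)) (momega : measurable omega) :
  ((exists T : R, 0 < T /\
      exactly_controllable (fractional_harmonic s) omega T)
   <-> (0 < lower_density omega)%E)
  /\
  ((exists T : R, 0 < T /\
      exactly_controllable (fractional_harmonic (1 : R)) omega T)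
   \/ (0 < lower_density omega)%E ->
   forall T : R, pi <= T ->
     exactly_controllable (fractional_harmonic (1 : R)) omega T).
Proof.
have density (r : R) : (exists T : R, 0 < T /\
    exactly_controllable (fractional_harmonic r) omega T) -> (0 < lower_density omega)%E.
  by move=> [T [T0 ec]]; exact: (controllable_density momega T0 ec).
split; first split; first exact: density.
  by apply: gapped_controllable => // m n; exact: fractional_gap.
move=> H T piT; apply: harmonic_controllable => //.
by case: H => // /density.
Qed.
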